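(* Let $\Lambda\subset\mathbb{D}$ be a discrete set, let $f:\mathbb{D}\setminus\Lambda\to\mathbb{C}$, and fix an integer $\kappa\ge 0$. The following are equivalent: (1) $f\in\mathcal{S}_\kappa$. (2) $f$ admits an extension to a standard function with $\ell$ jumps, for some $0\le\ell\le\kappa$, and $\kappa-\ell$ poles (counted with multiplicity), and all jumps of this standard function lie in $\mathbb{D}\setminus\Lambda$. (3) There is an integer $n\ge 0$ such that $\mathbf{k}_n(f)=\mathbf{k}_{n+3}(f)=\kappa$.
   Context: $\mathbb{D}$ is the open unit disk. A set $\Lambda\subset\mathbb{D}$ is discrete if it is at most countable with accumulation points (if any) only on the unit circle. A Schur function is an analytic $S:\mathbb{D}\to\mathbb{C}$ with $|S|\le1$. A (finite) Blaschke product is a rational function analytic on $\mathbb{D}$ and unimodular on the unit circle; its degree is its number of zeros in $\mathbb{D}$ counted with multiplicity. For a function $f$ with domain $\mathrm{Dom}(f)\subseteq\mathbb{D}$ and distinct points $z_1,\dots,z_n\in\mathrm{Dom}(f)$, the Pick matrix is $P_n(f;z_1,\dots,z_n)=\left[\frac{1-f(z_i)\overline{f(z_j)}}{1-z_i\overline{z_j}}\right]_{i,j=1}^n$. For a Hermitian matrix $P$, $\mathrm{sq}_-P$ is its number of negative eigenvalues counted with multiplicity. $\mathbf{k}_n(f)=\max\,\mathrm{sq}_-P_n(f;z_1,\dots,z_n)$ over all distinct $z_1,\dots,z_n\in\mathrm{Dom}(f)$, and $\mathbf{k}_0(f)=0$. The class $\mathcal{S}_\kappa$ consists of functions $f$ defined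 on $\mathbb{D}\setminus\Lambda$ for some discrete $\Lambda$ such that every Pick matrix of $f$ (at distinct points of $\mathbb{D}\setminus\Lambda$) has at most $\kappa$ negative eigenvalues and at least one has exactly $\kappa$. A function $g$ is an extension of $f$ if $\mathrm{Dom}(g)\supseteq\mathrm{Dom}(f)$ and $g=f$ on $\mathrm{Dom}(f)$. A standard function is a function of the form $f(z)=S(z)/B(z)$ for $z\notin\mathcal{W}\cup\mathcal{Z}$ and $f(z_j)=\gamma_j$ for $z_j\in\mathcal{Z}$, where: $\mathcal{Z}=\{z_1,\dots,z_\ell\}$ and $\mathcal{W}=\{w_1,\dots,w_p\}$ are disjoint sets of distinct points of $\mathbb{D}$; $\gamma_1,\dots,\gamma_\ell\in\mathbb{C}$; $B$ is a Blaschke product of degree $q\ge0$ and $S$ is a Schur function with $\mathcal{W}\subseteq Z(B)\subseteq\mathcal{W}\cup\mathcal{Z}$ and $Z(B)\cap Z(S)=\emptyset$ ($Z(\cdot)$ = zero set); and if $z_j\in\mathcal{Z}\setminus Z(B)$ then $S(z_j)/B(z_j)\ne\gamma_j$. Its domain is $\mathbb{D}\setminus\mathcal{W}$. Such $f$ is said to have $q$ poles (zeros of $B$ with multiplicity) and $\ell$ jumps $z_1,\dots,z_\ell$ (poles and jumps may coincide). *)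

(* Defs.v *)
(* complex numbers are R[i] (mathcomp-real-closed) over an
   arbitrary R : realType (MathComp-Analysis); finite linear algebra from
   MathComp (matrices, characteristic polynomial). *)
From HB Require Import structures.
From mathcomp Require Import all_boot all_order all_algebra.
From mathcomp Require Import complex.
From mathcomp Require Import boolp classical_sets cardinality reals.

Set Implicit Arguments.
Unset Strict Implicit.
Unset Printing Implicit Defensive.

Import Order.TTheory GRing.Theory Num.Theory.
Local Open Scope ring_scope.
Local Open Scope classical_set_scope.

Section Defs.
Variable R : realType.
Local Notation C := R[i].

(** The open unit disk. *)
Definition inD (z : C) : Prop := `|z| < 1.

(** Discrete subset of D: contained in D, at most countable, and no point of
    D is an accumulation point of it (so accumulation points, if any, lie on
    the unit circle). *)
Definition discrete_set (L : set C) : Prop :=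
  [/\ L `<=` inD, countable L &
      forall z, inD z -> ~ (forall r : R, 0 < r ->
         exists w, [/\ L w, w != z & `|w - z| < (r%:C)%C])].

(** Analytic (= complex differentiable at every point) on D;
    only the values of [S] on D are used. *)
Definition analytic_on_D (S : C -> C) : Prop :=
  forall z, inD z -> exists L : C, forall e : R, 0 < e ->
    exists d : R, 0 < d /\ forall w, inD w -> `|w - z| < (d%:C)%C ->
      `|S w - S z - L * (w - z)| <= (e%:C)%C * `|w - z|.

(** Schur function. *)
Definition schur (S : C -> C) : Prop :=
  analytic_on_D S /\ forall z, inD z -> `|S z| <= 1.

(** The rational function p/q. *)
Definition ratfun (p q : {poly C}) : C -> C := fun z => p.[z] / q.[z].

(** Finite Blaschke product: a rational function p/q (written in lowest
    terms) that is analytic on D and unimodular on the unit circle. *)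
Definition blaschke (p q : {poly C}) : Prop :=
  [/\ q != 0, coprimep p q, analytic_on_D (ratfun p q) &
      forall z, `|z| = 1 -> `|ratfun p q z| = 1].

(** A list of the roots of a polynomial, with multiplicity. *)
Definition roots_mult (p : {poly C}) : seq C :=
  sval (closed_field_poly_normal p).

(** Degree of the Blaschke product p/q: number of zeros in D with
    multiplicity (for p/q in lowest terms, these are the roots of p in D). *)
Definition blaschke_degree (p q : {poly C}) : nat :=
  count (fun a => `|a| < 1) (roots_mult p).

(** Zero set in D of a function. *)
Definition zeroset (F : C -> C) : set C := [set z | inD z /\ F z = 0].

(** [standard_function g Ws Zs nq]: on its domain D \ Ws, g is a standard
    function with poles Ws = {w_1..w_p}, jumps Zs = [z_1;..;z_l] (jump values
    gamma_j = g z_j) and a Blaschke product of degree nq. *)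
Definition standard_function (g : C -> C) (Ws Zs : seq C) (nq : nat) : Prop :=
  exists (S : C -> C) (p q : {poly C}),
    [/\ uniq Zs, uniq Ws, (forall z, z \in Zs -> inD z),
        (forall w, w \in Ws -> inD w) &
        (forall z, z \in Zs -> z \notin Ws)] /\
    [/\ blaschke p q, blaschke_degree p q = nq & schur S] /\
    [/\ [set w | w \in Ws] `<=` zeroset (ratfun p q),
        zeroset (ratfun p q) `<=` [set z | (z \in Ws) || (z \in Zs)] &
        zeroset (ratfun p q) `&` zeroset S = set0] /\
    (forall z, inD z -> z \notin Ws -> z \notin Zs ->
        g z = S z / ratfun p q z) /\
    (forall z, z \in Zs -> ratfun p q z != 0 ->
        S z / ratfun p q z != g z).

(** Pick matrix of f at the points z_1..z_n. *)
Definition pick_matrix (f : C -> C) (n : nat) (z : 'I_n -> C) : 'M[C]_n :=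
  \matrix_(i, j) ((1 - f (z i) * (f (z j))^*) / (1 - z i * (z j)^*)).

(** Number of negative eigenvalues, counted with multiplicity. *)
Definition sq_minus (n : nat) (P : 'M[C]_n) : nat :=
  count (fun l => l < 0) (roots_mult (char_poly P)).

(** Admissible nodes: n distinct points of Dom f = D \ L. *)
Definition nodes (L : set C) (n : nat) (z : 'I_n -> C) : Prop :=
  injective z /\ forall i, inD (z i) /\ ~ L (z i).

(** k_n(f) for f with domain D \ L (the max exists since sq_- <= n;
    for n = 0 this gives 0). *)
Definition kn (L : set C) (f : C -> C) (n : nat) : nat :=
  (\max_(k < n.+1 | `[< exists z : 'I_n -> C,
        nodes L z /\ sq_minus (pick_matrix f z) = k >]) k)%N.

(** f (with domain D \ L) belongs to S_kappa. *)
Definition in_S_kappa (L : set C) (f : C -> C) (kappa : nat) : Prop :=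
  discrete_set L /\
  (forall n (z : 'I_n -> C), nodes L z ->
      (sq_minus (pick_matrix f z) <= kappa)%N) /\
  (exists n (z : 'I_n -> C), nodes L z /\
      sq_minus (pick_matrix f z) = kappa).

End Defs.

(* Main.v *)
(* Work with formal combinations x of Szego kernels k_z, z in D \ L, and the diagonal operator
   T k_z = f(z) k_z; the Pick form is Q(x) = |x|^2 - |T x|^2 and kappa is the maximal dimension
   of a negative subspace.  If combinations x tend to 0 while T x tends to k_a, then passing
   from f to b_a f (b_a the Blaschke factor at a) lowers the index by one.  Such x exist whenever
   f is unbounded near a, or has no limit at a, or is continuous but not differentiable at a.
   Hence a function of finite index becomes, after multiplication by a finite Blaschke product,
   the restriction of an analytic function, which the index forces to be bounded by 1 near the
   circle, hence everywhere.  The same step, applied to the poles and jumps of a standard function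
   one after the other, bounds its index from below; the upper bound holds because the Pick form
   of S/B is a difference of the nonnegative forms of S and of B, the latter of rank deg B.

   If k_n = k_(n+3) = kappa, take a minimal set of nodes with kappa negative squares.  Its Pick
   matrix is invertible, and the Schur complement kernel, nonnegative on triples of points, has
   the shape (p p^* - q q^* ) / (1 - z w^* ).  Hindmarsh's theorem makes q/p a Schur function, so the
   complement is nonnegative on all finite sets and no further negative square appears.

   The complex analysis needed is the maximum principle for complex differentiable functions,
   obtained from Goursat's theorem by integrating twice and comparing with second differences. *)
Require Import Defs.
From HB Require Import structures.
From mathcomp Require Import all_boot all_order all_algebra.
From mathcomp Require Import complex ring lra.
From mathcomp Require Import boolp classical_sets cardinality reals.

Set Implicit Arguments.
Unset Strict Implicit.
Unset Printing Implicit Defensive.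

Import Order.TTheory GRing.Theory Num.Theory.
Local Open Scope ring_scope.
Local Open Scope classical_set_scope.

(** * The modulus as a real number *)

Section Modulus.
Variable R : realType.
Local Notation C := R[i].
Implicit Types (z w : C) (r : R).

(** Analyticity means pointwise differentiability here, and the recurring obstacle is removability:
    dividing by [bl a], or taking a Schur transform at [z1], yields a quotient known only to be
    continuous at one point. Such functions form [class_fun E]. A factor [w - a] for each point of
    [E] makes their powers differentiable, which gives a maximum principle for the class; Schur's
    algorithm preserves the class, so the kernels are positive off [E]; Hindmarsh's theorem then
    turns positivity back into differentiability ([class_schur]). The number 3 has the same source:
    two points give a Schwarz-Pick estimate, hence Lipschitz continuity, and a third one, spent on a
    Schur step, gives the derivative. Negative squares are counted by negative definite Gram
    matrices of formal combinations with possibly repeated points, because this count survives small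
    perturbations and asks for no limit vector: a singular point only provides approximating
    combinations. *)

Definition nm z : R := complex.Re `|z|.

(** [R[i]] is only partially ordered; estimates are moved to [R] through [nm], where [lra] and [nra]
    work. *)
Lemma nmE z : `|z| = ((nm z)%:C)%C.
Proof. by rewrite /nm RRe_real // normr_real. Qed.

Lemma nm_ge0 z : 0 <= nm z.
Proof. by rewrite -ler0c -nmE. Qed.

Lemma nm0 : nm 0 = 0.
Proof. by rewrite /nm normr0. Qed.

Lemma nm1 : nm 1 = 1.
Proof. by rewrite /nm normr1. Qed.

Lemma nmN z : nm (- z) = nm z.
Proof. by rewrite /nm normrN. Qed.

Lemma nmBC z w : nm (z - w) = nm (w - z).
Proof. by rewrite /nm distrC. Qed.

Lemma nmM z w : nm (z * w) = nm z * nm w.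
Proof. by apply: complexI; rewrite rmorphM /= -!nmE normrM. Qed.

Lemma nmV z : nm z^-1 = (nm z)^-1.
Proof. by apply: complexI; rewrite fmorphV /= -!nmE normfV. Qed.

Lemma nmX z n : nm (z ^+ n) = nm z ^+ n.
Proof. by apply: complexI; rewrite rmorphXn /= -!nmE normrX. Qed.

Lemma nmD z w : nm (z + w) <= nm z + nm w.
Proof. by rewrite -lecR rmorphD /= -!nmE ler_normD. Qed.

Lemma nmB z w : nm (z - w) <= nm z + nm w.
Proof. by rewrite -(nmN w) nmD. Qed.

Lemma nm_eq0 z : (nm z == 0) = (z == 0).
Proof. by rewrite -(inj_eq (@complexI R)) -nmE normr_eq0. Qed.

Lemma nm_gt0 z : (0 < nm z) = (z != 0).
Proof. by rewrite lt0r nm_ge0 andbT nm_eq0. Qed.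

Lemma nmJ z : nm (z^*) = nm z.
Proof. by rewrite /nm norm_conjC. Qed.

Lemma nm_real r : nm (r%:C)%C = `|r|.
Proof. by rewrite /nm normc_def /= expr0n addr0 sqrtr_sqr. Qed.

Lemma nm_Re z : `|complex.Re z| <= nm z.
Proof. by rewrite -lecR -nmE; apply: normc_ge_Re. Qed.

Lemma nm_Im z : `|complex.Im z| <= nm z.
Proof.
rewrite -lecR -nmE normc_def lecR -sqrtr_sqr ler_sqrt ?lerDr ?sqr_ge0 //.
by rewrite addr_ge0 ?sqr_ge0.
Qed.

Lemma nm_ReIm z : nm z <= `|complex.Re z| + `|complex.Im z|.
Proof.
rewrite {1}[z]complexE; apply: le_trans (nmD _ _) _.
rewrite nmM !nm_real lerD2l.
suff -> : nm ('i)%C = 1 by rewrite mul1r.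
by rewrite /nm normc_def /= expr0n add0r expr1n sqrtr1.
Qed.

Lemma mulJ_nm z : z * z^* = ((nm z ^+ 2)%:C)%C.
Proof. by rewrite rmorphXn /= -nmE -normCK. Qed.

Lemma inDE z : inD z <-> nm z < 1.
Proof. by rewrite /inD nmE -(ltcR (nm z)). Qed.

Lemma nm_prod (I : Type) (s : seq I) (F : I -> C) :
  nm (\prod_(i <- s) F i) = \prod_(i <- s) nm (F i).
Proof. by elim/big_rec2: _ => [|i x y _ <-]; rewrite ?nm1 // nmM. Qed.

Lemma nm_sum (I : Type) (s : seq I) (P : pred I) (F : I -> C) :
  nm (\sum_(i <- s | P i) F i) <= \sum_(i <- s | P i) nm (F i).
Proof.
elim/big_rec2: _ => [|i x y _ le]; first by rewrite nm0.
by apply: le_trans (nmD _ _) _; rewrite lerD2l.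
Qed.

Lemma nm_lt1_neq0 z w : nm z < 1 -> nm w < 1 -> 1 - z * w^* != 0.
Proof.
move=> hz hw; rewrite subr_eq0; apply/eqP => /(congr1 nm).
rewrite nm1 nmM nmJ => e.
by have := nm_ge0 z; have := nm_ge0 w; nra.
Qed.

Lemma nm_triang z w x : nm (z - x) <= nm (z - w) + nm (w - x).
Proof. by rewrite -[z - x](subrKA w) nmD. Qed.

End Modulus.

(** * Completeness of the complex numbers *)

Section Completeness.
Variable R : realType.
Local Notation C := R[i].

(** The limit is the supremum of the set [E] of eventual lower bounds of [u]. *)
Lemma real_cauchy_limit (u : nat -> R) :
  (forall e, 0 < e -> exists N, forall n m, (N <= n)%N -> (N <= m)%N ->
     `|u n - u m| <= e) ->
  exists l, forall e, 0 < e -> exists N, forall n, (N <= n)%N -> `|u n - l| <= e.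
Proof.
move=> hu.
pose E := [set x | exists N, forall n, (N <= n)%N -> x <= u n].
have hE e : 0 < e -> exists N, E (u N - e) /\ ubound E (u N + e) /\
    forall n, (N <= n)%N -> `|u n - u N| <= e.
  move=> e0; have [N hN] := hu e e0; exists N; split; [|split].
  - by exists N => n /(hN N n (leqnn N)); rewrite ler_norml => /andP[]; lra.
  - move=> x [M hM].
    have := hN (maxn N M) N (leq_maxl _ _) (leqnn N).
    by have := hM _ (leq_maxr N M); rewrite ler_norml => ? /andP[]; lra.
  - by move=> n hn; apply: hN.
have Es : has_sup E.
  by have [N [h1 [h2 _]]] := hE 1 ltr01; split; [exists (u N - 1)|exists (u N + 1)].
exists (sup E) => e e0.
have [|N [h1 [h2 h3]]] := hE (e / 2); first by lra.
exists N => n /h3; rewrite !ler_norml => /andP[h4 h5].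
have h6 := ub_le_sup Es.2 h1; have h7 := ge_sup Es.1 h2.
by apply/andP; split; lra.
Qed.

Lemma cauchy_limit (u : nat -> C) :
  (forall e, 0 < e -> exists N, forall n m, (N <= n)%N -> (N <= m)%N ->
     nm (u n - u m) <= e) ->
  exists l, forall e, 0 < e -> exists N, forall n, (N <= n)%N ->
     nm (u n - l) <= e.
Proof.
move=> hu.
have [|x hx] := @real_cauchy_limit (fun n => complex.Re (u n)).
  move=> e /hu[N hN]; exists N => n m hn hm; apply: le_trans (hN n m hn hm).
  by have := nm_Re (u n - u m); case: (u n) (u m) => [? ?] [? ?].
have [|y hy] := @real_cauchy_limit (fun n => complex.Im (u n)).
  move=> e /hu[N hN]; exists N => n m hn hm; apply: le_trans (hN n m hn hm).
  by have := nm_Im (u n - u m); case: (u n) (u m) => [? ?] [? ?].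
exists (x +i* y)%C => e e0.
have e2 : 0 < e / 2 by lra.
have [N hN] := hx _ e2; have [M hM] := hy _ e2.
exists (maxn N M) => n; rewrite geq_max => /andP[/hN h1 /hM h2].
apply: le_trans (nm_ReIm _) _.
by move: h1 h2; case: (u n) => a b /=; lra.
Qed.

(** A sequence in [X] tending to [a] supplies the limit. The point [a] may itself lie in [X]; the
    conclusion at [w = a] then identifies [f a] with the limit. *)
Lemma cauchy_limit_at (X : set C) (f : C -> C) (a : C) :
  (forall d, 0 < d -> exists w, [/\ X w & nm (w - a) < d]) ->
  (forall e, 0 < e -> exists d, 0 < d /\ forall w v, X w -> X v ->
     nm (w - a) < d -> nm (v - a) < d -> nm (f w - f v) <= e) ->
  exists l, forall e, 0 < e -> exists d, 0 < d /\ forall w, X w ->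
     nm (w - a) < d -> nm (f w - l) <= e.
Proof.
move=> hX hf.
have hpos n : (0 : R) < n.+1%:R^-1 by rewrite invr_gt0 ltr0n.
have /choice[w hw] : forall n, exists w, X w /\ nm (w - a) < n.+1%:R^-1.
  by move=> n; have [w [? ?]] := hX _ (hpos n); exists w.
have hsmall d : 0 < d -> exists N, forall n, (N <= n)%N -> nm (w n - a) < d.
  move=> d0; exists (Num.bound d^-1) => n hn.
  apply: lt_le_trans (hw n).2 _.
  rewrite -[leRHS]invrK lef_pV2 ?posrE ?invr_gt0 ?ltr0n //.
  apply: le_trans (ltW (archi_boundP _)) _; first by rewrite invr_ge0 ltW.
  by rewrite ler_nat (leq_trans hn).
have [|l hl] := @cauchy_limit (fun n => f (w n)).
  move=> e /hf[d [d0 hd]]; have [N hN] := hsmall _ d0.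
  by exists N => n m /hN h1 /hN h2; apply: hd => //; have [] := hw n; have [] := hw m.
exists l => e e0; have e2 : 0 < e / 2 by lra.
have [d [d0 hd]] := hf _ e2; have [N hN] := hl _ e2; have [M hM] := hsmall _ d0.
exists d; split=> // v Xv vd.
pose n := maxn N M; have h1 := hN n (leq_maxl _ _); have h2 := hM n (leq_maxr _ _).
have h3 := hd v (w n) Xv (hw n).1 vd h2.
by apply: le_trans (nm_triang _ (f (w n)) _) _; lra.
Qed.

Lemma half_pow_small (c d : R) : 0 < d -> exists N, forall n, (N <= n)%N ->
  c / 2 ^+ n < d.
Proof.
move=> d0.
have [c0|c0] := leP c 0.
  exists 0%N => n _; apply: le_lt_trans d0.
  by rewrite mulr_le0_ge0 // invr_ge0 exprn_ge0.
exists (Num.bound (c / d)) => n hn.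
rewrite ltr_pdivrMr ?exprn_gt0 // mulrC -ltr_pdivrMr //.
apply: lt_le_trans (archi_boundP _) _; first by rewrite divr_ge0 // ltW.
rewrite -natrX ler_nat; apply: leq_trans hn _.
by apply: ltnW; apply: ltn_expl.
Qed.

Lemma half_cauchy (u : nat -> C) (c : R) :
  (forall n, nm (u n.+1 - u n) <= c / 2 ^+ n) ->
  exists l, forall n, nm (u n - l) <= 2 * c / 2 ^+ n.
Proof.
move=> hu.
have hc n : 2 * c / 2 ^+ n.+1 = c / 2 ^+ n.
  by rewrite exprS invfM mulrACA divff ?mul1r // pnatr_eq0.
have c0 : 0 <= c by have := hu 0%N; rewrite expr0 divr1; apply: le_trans (nm_ge0 _).
(* The subtracted term makes the induction on [k] close. *)
have tail n k : nm (u (n + k)%N - u n) <= 2 * c / 2 ^+ n - 2 * c / 2 ^+ (n + k).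
  elim: k => [|k IH]; first by rewrite addn0 !subrr nm0.
  rewrite addnS; apply: le_trans (nm_triang _ (u (n + k)%N) _) _.
  have := hu (n + k)%N; rewrite (hc (n + k)%N).
  move: IH; have -> : 2 * c / 2 ^+ (n + k) = c / 2 ^+ (n + k) + c / 2 ^+ (n + k) by ring.
  by set x := c / 2 ^+ (n + k); set y := 2 * c / _; move=> *; lra.
have tail0 n k : nm (u (n + k)%N - u n) <= 2 * c / 2 ^+ n.
  apply: le_trans (tail n k) _; rewrite lerBlDr lerDl.
  by rewrite divr_ge0 ?exprn_ge0 // mulr_ge0.
have [|l hl] := @cauchy_limit u.
  move=> e e0; have [|N hN] := @half_pow_small (2 * c) (e / 2); first by lra.
  exists N => n m hn hm; have := hN N (leqnn _).
  have := tail0 N (n - N)%N; have := tail0 N (m - N)%N; rewrite !subnKC //.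
  move=> h1 h2 h3; apply: le_trans (nm_triang _ (u N) _) _.
  by rewrite [X in _ + X]nmBC; lra.
exists l => n; apply/ler_addgt0Pr => e e0.
have [N hN] := hl e e0.
have := hN (n + N)%N (leq_addl _ _); have := tail0 n N => h1 h2.
apply: le_trans (nm_triang _ (u (n + N)%N) _) _.
by rewrite [X in X + _]nmBC; lra.
Qed.

End Completeness.

(** * Limits along families of parameters *)

Section Limits.
Variable R : realType.
Local Notation C := R[i].
Variables (T : Type) (P : R -> T -> Prop).
Implicit Types (F G : T -> C) (l m : C).

(* P d t reads: the parameter t is d-close to its limiting position. *)
Definition tends F l := forall e : R, 0 < e -> exists d : R, 0 < d /\
  forall d', 0 < d' -> d' <= d -> forall t, P d' t -> nm (F t - l) <= e.

Lemma tends_cst l : tends (fun=> l) l.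
Proof. by move=> e e0; exists 1; split=> // *; rewrite subrr nm0 ltW. Qed.

Lemma tends_ext F G l : F =1 G -> tends F l -> tends G l.
Proof. by move=> /funext ->. Qed.

(** [P] is not assumed monotone in the scale; since [tends] speaks about every smaller [d'], two
    limits can still be combined at the minimum of their scales. *)
Lemma tendsD F G l m : tends F l -> tends G m -> tends (fun t => F t + G t) (l + m).
Proof.
move=> h1 h2 e e0; have e2 : 0 < e / 2 by lra.
have [d [d0 hd]] := h1 _ e2; have [d' [d'0 hd']] := h2 _ e2.
exists (Num.min d d'); split; first by rewrite lt_min d0.
move=> x x0; rewrite le_min => /andP[x1 x2] t Pt.
have k1 := hd _ x0 x1 t Pt; have k2 := hd' _ x0 x2 t Pt.
have -> : F t + G t - (l + m) = (F t - l) + (G t - m) by ring.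
by apply: le_trans (nmD _ _) _; lra.
Qed.

Lemma tendsM F G l m : tends F l -> tends G m -> tends (fun t => F t * G t) (l * m).
Proof.
move=> h1 h2 e e0; pose k := nm l + nm m + 1.
have p1 := nm_ge0 l; have p2 := nm_ge0 m.
have k0 : 0 < k by rewrite /k; lra.
pose e2 := Num.min 1 (e / k).
have e20 : 0 < e2 by rewrite lt_min ltr01 divr_gt0.
have [d [d0 hd]] := h1 _ e20; have [d' [d'0 hd']] := h2 _ e20.
exists (Num.min d d'); split; first by rewrite lt_min d0.
move=> x x0; rewrite le_min => /andP[x1 x2] t Pt.
have k1 := hd _ x0 x1 t Pt; have k2 := hd' _ x0 x2 t Pt.
have -> : F t * G t - l * m = (F t - l) * (G t - m) + l * (G t - m) + (F t - l) * m by ring.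
apply: le_trans (nmD _ _) _; apply: le_trans (lerD (nmD _ _) (lexx _)) _.
rewrite !nmM; have q1 := nm_ge0 (F t - l); have q2 := nm_ge0 (G t - m).
have e21 : e2 <= 1 by rewrite ge_min lexx.
have e2k : e2 * k <= e by rewrite -ler_pdivlMr // ge_min lexx orbT.
apply: le_trans e2k; rewrite /k.
have : nm (F t - l) * nm (G t - m) <= e2 * 1 by apply: ler_pM => //; lra.
have : nm l * nm (G t - m) <= nm l * e2 by rewrite ler_wpM2l.
have : nm (F t - l) * nm m <= e2 * nm m by rewrite ler_wpM2r.
by rewrite !mulrDr [e2 * nm l]mulrC; lra.
Qed.

Lemma tendsV F l : l != 0 -> tends F l -> tends (fun t => (F t)^-1) l^-1.
Proof.
move=> nz h e e0; have n0 : 0 < nm l by rewrite nm_gt0.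
pose e2 := Num.min (nm l / 2) (e * nm l ^+ 2 / 2).
have e20 : 0 < e2 by rewrite lt_min !divr_gt0 // mulr_gt0 // exprn_gt0.
have [d [d0 hd]] := h _ e20; exists d; split=> // d' d'0 d'd t Pt.
have k := hd _ d'0 d'd t Pt.
have k1 : nm (F t - l) <= nm l / 2 by apply: le_trans k _; rewrite ge_min lexx.
have k2 : nm (F t - l) <= e * nm l ^+ 2 / 2.
  by apply: le_trans k _; rewrite ge_min lexx orbT.
have k3 : nm l / 2 <= nm (F t).
  have := nmB (F t) (F t - l); rewrite (_ : F t - (F t - l) = l); last by ring.
  lra.
have w0 : F t != 0 by rewrite -nm_gt0; lra.
have -> : (F t)^-1 - l^-1 = - (F t - l) / (F t * l).
  by field; rewrite nz w0.
rewrite nmM nmN nmV nmM ler_pdivrMr ?mulr_gt0 ?nm_gt0 //.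
by apply: le_trans k2 _; rewrite -mulrA ler_pM2l // expr2 mulrAC ler_pM2r.
Qed.

Lemma tendsN F l : tends F l -> tends (fun t => - F t) (- l).
Proof.
move=> h e e0; have [d [d0 hd]] := h e e0; exists d; split=> // d' d'0 d'd t Pt.
by rewrite -opprD nmN; apply: hd Pt.
Qed.

Lemma tendsB F G l m : tends F l -> tends G m -> tends (fun t => F t - G t) (l - m).
Proof. by move=> h1 h2; apply: tendsD => //; apply: tendsN. Qed.

Lemma tendsJ F l : tends F l -> tends (fun t => (F t)^*) l^*.
Proof.
move=> h e e0; have [d [d0 hd]] := h e e0; exists d; split=> // d' d'0 d'd t Pt.
by rewrite -rmorphB nmJ; apply: hd Pt.
Qed.

Lemma tends_sum (I : eqType) (s : seq I) (F : I -> T -> C) (l : I -> C) :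
  (forall i, i \in s -> tends (F i) (l i)) ->
  tends (fun t => \sum_(i <- s) F i t) (\sum_(i <- s) l i).
Proof.
elim: s => [|i s IH] h.
  by rewrite big_nil; apply: (tends_ext _ (tends_cst 0)) => t; rewrite big_nil.
rewrite big_cons.
apply: (@tends_ext (fun t => F i t + \sum_(j <- s) F j t)) => [t|].
  by rewrite big_cons.
apply: tendsD; first by apply: h; rewrite inE eqxx.
by apply: IH => j hj; apply: h; rewrite inE hj orbT.
Qed.

(** In [R[i]] the relation [0 <= l] also says that [l] is real, so real and imaginary parts are both
    controlled. *)
Lemma tends_ge0 F l : tends F l -> (forall d, 0 < d -> exists2 t, P d t & 0 <= F t) ->
  0 <= l.
Proof.
move=> h hP.
have key e : 0 < e -> `|complex.Im l| <= e /\ - e <= complex.Re l.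
  move=> e0; have [d [d0 hd]] := h e e0; have [t Pt] := hP d d0.
  have := hd d d0 (lexx d) t Pt; case: (F t) => x y h1; rewrite lecE /= => /andP[/eqP y0 x0].
  have := nm_Re ((x +i* y)%C - l); have := nm_Im ((x +i* y)%C - l).
  rewrite y0 in h1 *; case: l {h hd} h1 => p q /= h1.
  rewrite sub0r normrN ler_norml => k1.
  by rewrite ler_norml => /andP[? ?]; move: k1 => /andP[? ?]; rewrite ler_norml; split; [apply/andP; split|]; lra.
rewrite lecE /=; apply/andP; split.
  rewrite -normr_eq0 eq_le normr_ge0 andbT; apply/ler_addgt0Pr => e /key[].
  by rewrite add0r.
by apply/ler_addgt0Pr => e /key[_]; lra.
Qed.

Lemma tends_ker (z w u v : T -> C) (z0 w0 u0 v0 : C) : nm z0 < 1 -> nm w0 < 1 ->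
  tends z z0 -> tends w w0 -> tends u u0 -> tends v v0 ->
  tends (fun t => (1 - u t * (v t)^*) / (1 - z t * (w t)^*))
    ((1 - u0 * v0^*) / (1 - z0 * w0^*)).
Proof.
move=> zD wD hz hw hu hv; apply: tendsM.
  by apply: tendsB; [apply: tends_cst|apply: tendsM => //; apply: tendsJ].
apply: tendsV; first exact: nm_lt1_neq0.
by apply: tendsB; [apply: tends_cst|apply: tendsM => //; apply: tendsJ].
Qed.

Lemma tends_all (I : finType) (F : I -> T -> C) (l : I -> C) :
  (forall i, tends (F i) (l i)) -> forall e : R, 0 < e -> exists d : R, 0 < d /\
  forall d', 0 < d' -> d' <= d -> forall t, P d' t -> forall i, nm (F i t - l i) <= e.
Proof.
move=> h e e0.
suff [d [d0 hd]] : exists d : R, 0 < d /\ forall d', 0 < d' -> d' <= d -> forall t, P d' t ->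
    forall i, i \in enum I -> nm (F i t - l i) <= e.
  by exists d; split=> // d' d'0 d'd t Pt i; apply: (hd d') => //; rewrite mem_enum.
elim: (enum I) => [|i s [d [d0 hd]]]; first by exists 1; split=> // *.
have [d' [d'0 hd']] := h i e e0.
exists (Num.min d d'); split; first by rewrite lt_min d0.
move=> x x0; rewrite le_min => /andP[x1 x2] t Pt j; rewrite inE => /orP[/eqP ->|].
  exact: hd' x0 x2 t Pt.
exact: hd x0 x1 t Pt j.
Qed.

Lemma tends_extP F G l :
  (forall d t, 0 < d -> P d t -> F t = G t) -> tends F l -> tends G l.
Proof.
move=> e hF e' e'0; have [d [d0 hd]] := hF e' e'0; exists d; split=> // d' d'0 d'd t Pt.
by rewrite -(e d' t d'0 Pt); apply: hd Pt.
Qed.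

Lemma tends_bdd0 F G (B : R) :
  (forall d t, 0 < d -> P d t -> nm (F t) <= B) -> tends G 0 ->
  tends (fun t => F t * G t) 0.
Proof.
move=> hB hG e e0; pose b := `|B| + 1.
have b0 : 0 < b by rewrite /b; have := normr_ge0 B; lra.
have [|d [d0 hd]] := hG (e / b); first by rewrite divr_gt0.
exists d; split=> // d' d'0 d'd t Pt; have := hd d' d'0 d'd t Pt; rewrite !subr0 nmM.
rewrite ler_pdivlMr // mulrC; apply: le_trans; rewrite ler_wpM2r ?nm_ge0 //.
apply: le_trans (hB d' t d'0 Pt) _; rewrite /b.
by have := ler_norm B; lra.
Qed.

End Limits.

(** * Goursat's theorem and primitives *)

Section Goursat.
Variable R : realType.
Local Notation C := R[i].
Implicit Types (H F : C -> C) (a b c z w : C) (u : nat -> C).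

Definition cv u (l : C) := forall e : R, 0 < e -> exists N, forall n, (N <= n)%N ->
  nm (u n - l) <= e.

Definition cont_at H z := forall e : R, 0 < e -> exists d : R, 0 < d /\
  forall w, nm w < 1 -> nm (w - z) < d -> nm (H w - H z) <= e.

Definition deriv_at H z (L : C) := forall e : R, 0 < e -> exists d : R, 0 < d /\
  forall w, nm w < 1 -> nm (w - z) < d ->
    nm (H w - H z - L * (w - z)) <= e * nm (w - z).

Lemma analyticE H :
  analytic_on_D H <-> forall z, nm z < 1 -> exists L, deriv_at H z L.
Proof.
have eqv z L : (forall e : R, 0 < e -> exists d : R, 0 < d /\
    forall w, inD w -> `|w - z| < (d%:C)%C ->
    `|H w - H z - L * (w - z)| <= (e%:C)%C * `|w - z|) <-> deriv_at H z L.
  split=> h e e0; have [d [d0 hd]] := h e e0; exists d; split=> // w.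
    move=> /inDE Dw; have := hd w Dw.
    by rewrite !nmE ltcR -rmorphM /= lecR.
  by move=> /inDE Dw; rewrite !nmE ltcR -rmorphM /= lecR; apply: hd.
split=> h z zD.
  by have /h[L hL] := (inDE z).2 zD; exists L; apply/eqv.
by have /h[L hL] := (inDE z).1 zD; exists L; apply/eqv.
Qed.

Lemma deriv_cont H z L : deriv_at H z L -> cont_at H z.
Proof.
move=> h e e0; have [d [d0 hd]] := h 1 ltr01.
pose k := nm L + 1; have k0 : 0 < k by rewrite /k; have := nm_ge0 L; lra.
exists (Num.min d (e / k)); split; first by rewrite lt_min d0 divr_gt0.
move=> w wD; rewrite lt_min => /andP[/(hd w wD) h1 h2].
have -> : H w - H z = (H w - H z - L * (w - z)) + L * (w - z) by ring.
apply: le_trans (nmD _ _) _; rewrite nmM.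
by move: h2; rewrite ltr_pdivlMr // /k => h2; nra.
Qed.

Lemma cv_unique u l l' : cv u l -> cv u l' -> l = l'.
Proof.
move=> h h'; apply/eqP; rewrite -subr_eq0 -nm_eq0 eq_le nm_ge0 andbT.
apply/ler_addgt0Pr => e e0; rewrite add0r.
have [|N hN] := h (e / 2); first by lra.
have [|M hM] := h' (e / 2); first by lra.
have := hN _ (leq_maxl N M); have := hM _ (leq_maxr N M) => h1 h2.
by apply: le_trans (nm_triang _ (u (maxn N M)) _) _; rewrite nmBC; lra.
Qed.

Lemma cvD u v l l' : cv u l -> cv v l' -> cv (fun n => u n + v n) (l + l').
Proof.
move=> h h' e e0.
have [|N hN] := h (e / 2); first by lra.
have [|M hM] := h' (e / 2); first by lra.
exists (maxn N M) => n; rewrite geq_max => /andP[/hN h1 /hM h2].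
have -> : u n + v n - (l + l') = (u n - l) + (v n - l') by ring.
by apply: le_trans (nmD _ _) _; lra.
Qed.

Lemma cvN u l : cv u l -> cv (fun n => - u n) (- l).
Proof.
by move=> h e /h[N hN]; exists N => n /hN; rewrite -opprD nmN.
Qed.

Lemma cvS u l : cv u l <-> cv (fun n => u n.+1) l.
Proof.
split=> h e /h[N hN]; first by exists N => n /leqW; apply: hN.
by exists N.+1 => -[//|n]; apply: hN.
Qed.

Lemma cv_bound u l c (M : R) : (forall n, nm (u n - c) <= M) -> cv u l ->
  nm (l - c) <= M.
Proof.
move=> hb hu; apply/ler_addgt0Pr => e /hu[N hN].
have := hN _ (leqnn N); have := hb N => h1 h2.
by apply: le_trans (nm_triang _ (u N) _) _; rewrite [X in X + _]nmBC; lra.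
Qed.

(** Bisection argument shared by the convergence of [dy], Goursat's triangles and the boxes of
    [disc_attains_max]: a bad object survives at every scale, close to one limit point. *)
Lemma nested_limit (T : Type) (Bad : T -> Prop) (pt : T -> C) (sz : T -> R) (t0 : T) :
  (forall t, Bad t -> exists t', [/\ Bad t', sz t' = sz t / 2 &
     nm (pt t' - pt t) <= sz t]) -> Bad t0 ->
  exists l, forall n, exists t, [/\ Bad t, sz t = sz t0 / 2 ^+ n &
     nm (pt t - l) <= 2 * sz t0 / 2 ^+ n].
Proof.
move=> hB B0.
have /choice[f hf] : forall t, exists t', Bad t -> [/\ Bad t', sz t' = sz t / 2 &
     nm (pt t' - pt t) <= sz t].
  move=> t; have [/hB[t' ht']|nb] := pselect (Bad t); first by exists t'.
  by exists t.
pose v n := iter n f t0.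
have vB n : Bad (v n) by elim: n => [//|n /hf[]].
have vs n : sz (v n) = sz t0 / 2 ^+ n.
  elim: n => [|n IH]; first by rewrite expr0 divr1.
  by have [_ -> _] := hf _ (vB n); rewrite IH exprSr invfM mulrA.
have [|l hl] := @half_cauchy R (fun n => pt (v n)) (sz t0).
  by move=> n; have [_ _ h] := hf _ (vB n); rewrite -vs.
by exists l => n; exists (v n).
Qed.

Definition mid a b : C := (a + b) / 2.

(* Midpoint sum of the integral of H over [a, b], cut into 2^n equal pieces. *)
Fixpoint dy H n a b : C :=
  if n is k.+1 then dy H k a (mid a b) + dy H k (mid a b) b
  else H (mid a b) * (b - a).

Lemma midC a b : mid a b = mid b a.
Proof. by rewrite /mid addrC. Qed.

Lemma nm2 : nm (2 : C) = 2.
Proof. by apply: complexI; rewrite -nmE normr_nat rmorph_nat. Qed.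

Lemma mid_ball z (r : R) a b : nm (a - z) <= r -> nm (b - z) <= r ->
  nm (mid a b - z) <= r.
Proof.
move=> ha hb.
have -> : mid a b - z = ((a - z) + (b - z)) / 2 by rewrite /mid; field.
rewrite nmM nmV nm2 ler_pdivrMr //; apply: le_trans (nmD _ _) _; lra.
Qed.

Lemma mid_disc a b : nm a < 1 -> nm b < 1 -> nm (mid a b) < 1.
Proof.
move=> ha hb; rewrite /mid nmM nmV nm2 ltr_pdivrMr //.
by apply: le_lt_trans (nmD _ _) _; lra.
Qed.

Lemma dy_anti H n a b : dy H n b a = - dy H n a b.
Proof.
elim: n a b => [|n IH] a b /=; first by rewrite midC; ring.
by rewrite (midC b a) (IH (mid a b) b) (IH a (mid a b)); ring.
Qed.

Lemma half_dist a b : nm (mid a b - a) = nm (b - a) / 2.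
Proof.
have -> : mid a b - a = (b - a) / 2 by rewrite /mid; field.
by rewrite nmM nmV nm2.
Qed.

Lemma half_dist_r a b : nm (b - mid a b) = nm (b - a) / 2.
Proof.
have -> : b - mid a b = (b - a) / 2 by rewrite /mid; field.
by rewrite nmM nmV nm2.
Qed.

(* The midpoint rule is exact on affine functions. *)
Lemma dy_approx H (P : set C) (al be : C) (eta : R) :
  (forall a b, P a -> P b -> P (mid a b)) ->
  (forall z, P z -> nm (H z - (al + be * z)) <= eta) ->
  forall n a b, P a -> P b ->
  nm (dy H n a b - ((al * b + be * b ^+ 2 / 2) - (al * a + be * a ^+ 2 / 2)))
    <= eta * nm (b - a).
Proof.
move=> Pm hH; elim=> [|n IH] a b Pa Pb /=.
  have -> : H (mid a b) * (b - a) -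
      (al * b + be * b ^+ 2 / 2 - (al * a + be * a ^+ 2 / 2)) =
      (H (mid a b) - (al + be * mid a b)) * (b - a).
    by rewrite /mid; field.
  by rewrite nmM ler_wpM2r ?nm_ge0 //; apply: hH; apply: Pm.
set m := mid a b; have Pmm : P m by apply: Pm.
have h1 := IH a m Pa Pmm; have h2 := IH m b Pmm Pb.
have -> : dy H n a m + dy H n m b -
    (al * b + be * b ^+ 2 / 2 - (al * a + be * a ^+ 2 / 2)) =
  (dy H n a m - (al * m + be * m ^+ 2 / 2 - (al * a + be * a ^+ 2 / 2))) +
  (dy H n m b - (al * b + be * b ^+ 2 / 2 - (al * m + be * m ^+ 2 / 2))) by ring.
apply: le_trans (nmD _ _) _.
by move: h1 h2; rewrite half_dist half_dist_r; lra.
Qed.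

Lemma dy_const H (P : set C) (al : C) (eta : R) :
  (forall a b, P a -> P b -> P (mid a b)) ->
  (forall z, P z -> nm (H z - al) <= eta) ->
  forall n a b, P a -> P b ->
  nm (dy H n a b - al * (b - a)) <= eta * nm (b - a).
Proof.
move=> Pm hH n a b Pa Pb.
have -> : al * (b - a) = al * b + 0 * b ^+ 2 / 2 - (al * a + 0 * a ^+ 2 / 2) by ring.
by apply: (dy_approx (P := P)) => // z /hH; rewrite mul0r addr0.
Qed.

(** Bisection replaces uniform continuity: segments on which the sums are not Cauchy would shrink to
    a point, near which [H] is almost constant and all sums agree. *)
Lemma dy_converges H a b : (forall z, nm z < 1 -> cont_at H z) ->
  nm a < 1 -> nm b < 1 -> exists l, cv (fun n => dy H n a b) l.
Proof.
move=> Hc aD bD; apply: cauchy_limit => e0 e0_gt0.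
(* The tolerance is proportional to length, so it adds up under halving; the 1 keeps the denominator
   positive when [a = b]. *)
pose e := e0 / (nm (b - a) + 1).
have ba0 := nm_ge0 (b - a).
have e_gt0 : 0 < e by rewrite divr_gt0 //; lra.
pose good (p : C * C) := exists N, forall n m, (N <= n)%N -> (N <= m)%N ->
  nm (dy H n p.1 p.2 - dy H m p.1 p.2) <= e * nm (p.2 - p.1).
suff [N hN] : good (a, b).
  exists N => n m hn hm; apply: le_trans (hN n m hn hm) _ => /=.
  by rewrite /e mulrAC ler_pdivrMr; nra.
apply: contrapT => nG.
pose r := Num.max (nm a) (nm b).
pose Bad (p : C * C) := [/\ ~ good p, nm p.1 <= r & nm p.2 <= r].
have [] := @nested_limit (C * C) Bad fst (fun p => nm (p.2 - p.1)) (a, b).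
- move=> [x y] [/= nG' hx hy].
  have hm : nm (mid x y) <= r by have := @mid_ball 0 r x y; rewrite !subr0; apply.
  have [G1|nG1] := pselect (good (x, mid x y)); last first.
    exists (x, mid x y); split=> //=; first by rewrite half_dist.
    by rewrite subrr nm0 nm_ge0.
  have [G2|nG2] := pselect (good (mid x y, y)); last first.
    exists (mid x y, y); split=> //=; first by rewrite half_dist_r.
    by rewrite half_dist; have := nm_ge0 (y - x); lra.
  case: nG'; move: G1 G2 => [N hN] [M hM]; exists (maxn N M).+1 => -[//|n] -[//|m].
  rewrite !ltnS !geq_max => /andP[n1 n2] /andP[m1 m2] /=.
  have := hN n m n1 m1; have := hM n m n2 m2; rewrite /= half_dist half_dist_r.
  move=> h1 h2.
  have -> : dy H n x (mid x y) + dy H n (mid x y) y -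
      (dy H m x (mid x y) + dy H m (mid x y) y) =
      (dy H n x (mid x y) - dy H m x (mid x y)) +
      (dy H n (mid x y) y - dy H m (mid x y) y) by ring.
  by apply: le_trans (nmD _ _) _; lra.
- by split=> //=; rewrite le_max lexx ?orbT.
move=> l hl.
have rlt : r < 1 by rewrite gt_max aD.
have lD : nm l <= r.
  apply/ler_addgt0Pr => d d0.
  have [N hN] := @half_pow_small _ (2 * nm (b - a)) _ d0.
  have [p [[_ h1 _] _ h2]] := hl N; have /= := hN N (leqnn N) => h3.
  have -> : l = p.1 - (p.1 - l) by ring.
  by apply: le_trans (nmB _ _) _; move: h2 => /= h2; lra.
have [||d [d0 hd]] := Hc l _ (e / 2); [by lra|by lra|].
have [N hN] := @half_pow_small _ (3 * nm (b - a)) _ d0.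
have [p [[nGp h1 h1'] h2 h3]] := hl N; have := hN N (leqnn N) => h4.
case: nGp; exists 0%N => n m _ _.
pose P z := nm z <= r /\ nm (z - l) < d.
have Pm x y : P x -> P y -> P (mid x y).
  move=> [x1 x2] [y1 y2]; split.
    by have := @mid_ball 0 r x y; rewrite !subr0; apply.
  have h : nm (mid x y - l) <= Num.max (nm (x - l)) (nm (y - l)).
    by apply: mid_ball; rewrite le_max lexx ?orbT.
  by apply: le_lt_trans h _; rewrite gt_max x2.
have HP z : P z -> nm (H z - H l) <= e / 2 by move=> [z1 z2]; apply: hd => //; lra.
move: h2 h3 => /= h2 h3; have p0 := nm_ge0 (p.2 - p.1).
have s0 : 0 <= nm (b - a) / 2 ^+ N by rewrite divr_ge0 // exprn_ge0.
have h4' : 3 * (nm (b - a) / 2 ^+ N) < d by rewrite mulrA.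
have h3' : nm (p.1 - l) <= 2 * (nm (b - a) / 2 ^+ N) by rewrite mulrA.
have P1 : P p.1 by split=> //; lra.
have P2 : P p.2.
  split=> //; have -> : p.2 - l = (p.2 - p.1) + (p.1 - l) by ring.
  by apply: le_lt_trans (nmD _ _) _; lra.
have k1 := dy_const Pm HP n P1 P2; have k2 := dy_const Pm HP m P1 P2.
apply: le_trans (nm_triang _ (H l * (p.2 - p.1)) _) _.
by rewrite [X in _ + X]nmBC; lra.
Qed.

(** The integral of [H] along the straight segment from [a] to [b]; the default 0 is taken if the
    sums do not converge. *)
Definition dyint H a b : C := xget 0 [set l | cv (fun n => dy H n a b) l].

Lemma dyint_cv H a b : (forall z, nm z < 1 -> cont_at H z) ->
  nm a < 1 -> nm b < 1 -> cv (fun n => dy H n a b) (dyint H a b).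
Proof.
move=> Hc aD bD; have [l hl] := dy_converges Hc aD bD.
by rewrite /dyint; case: xgetP => [x -> //|/(_ l)].
Qed.

(** Additivity at the midpoint is immediate from the dyadic form of [dy], and it is all that the
    subdivision of triangles needs. *)
Lemma dyint_mid H a b : (forall z, nm z < 1 -> cont_at H z) ->
  nm a < 1 -> nm b < 1 ->
  dyint H a b = dyint H a (mid a b) + dyint H (mid a b) b.
Proof.
move=> Hc aD bD; have mD := mid_disc aD bD.
apply: (cv_unique ((cvS _ _).1 (dyint_cv Hc aD bD))).
exact: cvD (dyint_cv Hc aD mD) (dyint_cv Hc mD bD).
Qed.

Lemma dyint_anti H a b : (forall z, nm z < 1 -> cont_at H z) ->
  nm a < 1 -> nm b < 1 -> dyint H b a = - dyint H a b.
Proof.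
move=> Hc aD bD; apply: (cv_unique (dyint_cv Hc bD aD)).
have -> : (fun n => dy H n b a) = (fun n => - dy H n a b).
  by apply/funext => n; rewrite dy_anti.
exact: cvN (dyint_cv Hc aD bD).
Qed.

Lemma dyint_approx H (P : set C) (al be : C) (eta : R) a b :
  (forall z, nm z < 1 -> cont_at H z) -> nm a < 1 -> nm b < 1 ->
  (forall a b, P a -> P b -> P (mid a b)) ->
  (forall z, P z -> nm (H z - (al + be * z)) <= eta) -> P a -> P b ->
  nm (dyint H a b - ((al * b + be * b ^+ 2 / 2) - (al * a + be * a ^+ 2 / 2)))
    <= eta * nm (b - a).
Proof.
move=> Hc aD bD Pm hP Pa Pb; apply: (cv_bound _ (dyint_cv Hc aD bD)) => n.
exact: (dy_approx Pm hP).
Qed.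

End Goursat.

(** * Goursat's theorem for triangles *)

Section Primitive.
Variable R : realType.
Local Notation C := R[i].
Implicit Types (H F G : C -> C) (a b c z w : C).

Definition tri H a b c := dyint H a b + dyint H b c + dyint H c a.

Lemma tri_split H a b c : (forall z, nm z < 1 -> cont_at H z) ->
  nm a < 1 -> nm b < 1 -> nm c < 1 ->
  tri H a b c = tri H a (mid a b) (mid c a) + tri H (mid a b) b (mid b c)
    + tri H (mid c a) (mid b c) c + tri H (mid a b) (mid b c) (mid c a).
Proof.
move=> Hc aD bD cD; rewrite /tri.
have m1 := mid_disc aD bD; have m2 := mid_disc bD cD; have m3 := mid_disc cD aD.
rewrite (dyint_mid Hc aD bD) (dyint_mid Hc bD cD) (dyint_mid Hc cD aD).
rewrite (dyint_anti Hc m1 m2) (dyint_anti Hc m2 m3) (dyint_anti Hc m3 m1).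
ring.
Qed.

Lemma disc_ball (r : R) a b : nm a <= r -> nm b <= r -> nm (mid a b) <= r.
Proof. by have := @mid_ball R 0 r a b; rewrite !subr0. Qed.

Lemma mid_mid a b c (s : R) : nm (b - c) <= s -> nm (mid b a - mid a c) <= s / 2.
Proof.
move=> h; have -> : mid b a - mid a c = (b - c) / 2 by rewrite /mid; field.
by rewrite nmM nmV nm2 ler_pM2r // invr_gt0.
Qed.

Lemma mid_end a b (s : R) : nm (b - a) <= s -> nm (mid a b - a) <= s / 2.
Proof. by move=> h; rewrite half_dist ler_pM2r // invr_gt0. Qed.

Lemma goursat H a b c : (forall z, nm z < 1 -> exists L, deriv_at H z L) ->
  nm a < 1 -> nm b < 1 -> nm c < 1 -> tri H a b c = 0.
Proof.
move=> Hd aD bD cD.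
have Hc z : nm z < 1 -> cont_at H z by move=> /Hd[L /deriv_cont].
apply/eqP; rewrite -nm_eq0 eq_le nm_ge0 andbT; apply/negP => /negP; rewrite -ltNge.
move=> t_gt0.
pose s0 := nm (b - a) + nm (c - b) + nm (a - c) + 1.
have s1 := nm_ge0 (b - a); have s2 := nm_ge0 (c - b); have s3 := nm_ge0 (a - c).
have s0_gt0 : 0 < s0 by rewrite /s0; lra.
pose de := nm (tri H a b c) / s0 ^+ 2.
have de_gt0 : 0 < de by rewrite divr_gt0 // exprn_gt0.
pose r := Num.max (nm a) (Num.max (nm b) (nm c)).
have rlt : r < 1 by rewrite !gt_max aD bD.
(* One of the four half-size triangles carries at least a quarter of the integral, and [s ^+ 2]
   drops by the factor 4 as well, so badness is inherited. *)
pose Bad (t : C * C * C * R) := let: (x, y, v, s) := t in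
  [/\ nm x <= r, nm y <= r & nm v <= r] /\
  [/\ nm (y - x) <= s, nm (v - y) <= s, nm (x - v) <= s, 0 < s &
   de * s ^+ 2 <= nm (tri H x y v)].
have [] := @nested_limit R (C * C * C * R) Bad (fun t => t.1.1.1) snd (a, b, c, s0).
- move=> [[[x y] v] s] [[xr yr vr] [h1 h2 h3 s_gt0 ht]].
  have ax : nm x < 1 by lra.
  have ay : nm y < 1 by lra.
  have av : nm v < 1 by lra.
  have r1 := disc_ball xr yr; have r2 := disc_ball yr vr; have r3 := disc_ball vr xr.
  have hs : 0 < s / 2 by lra.
  have q1 : nm (mid x y - x) <= s / 2 by apply: mid_end.
  have q2 : nm (mid y v - y) <= s / 2 by apply: mid_end.
  have q3 : nm (mid v x - v) <= s / 2 by apply: mid_end.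
  have q1' : nm (y - mid x y) <= s / 2 by rewrite nmBC midC mid_end // nmBC.
  have q2' : nm (v - mid y v) <= s / 2 by rewrite nmBC midC mid_end // nmBC.
  have q3' : nm (x - mid v x) <= s / 2 by rewrite nmBC midC mid_end // nmBC.
  have q4 : nm (mid v x - mid x y) <= s / 2 by apply: mid_mid.
  have q5 : nm (mid x y - mid y v) <= s / 2 by apply: mid_mid.
  have q6 : nm (mid y v - mid v x) <= s / 2 by apply: mid_mid.
  have e4 : de * (s / 2) ^+ 2 = de * s ^+ 2 / 4 by field.
  have spl : nm (tri H x y v) <= nm (tri H x (mid x y) (mid v x)) +
     nm (tri H (mid x y) y (mid y v)) + nm (tri H (mid v x) (mid y v) v) +
     nm (tri H (mid x y) (mid y v) (mid v x)).
    rewrite (tri_split Hc ax ay av).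
    apply: le_trans (nmD _ _) _; rewrite lerD2r.
    apply: le_trans (nmD _ _) _; rewrite lerD2r; exact: nmD.
  have [c1|c1] := leP (de * (s / 2) ^+ 2) (nm (tri H x (mid x y) (mid v x))).
    exists (x, mid x y, mid v x, s / 2); split=> //=.
    by rewrite subrr nm0 ltW.
  have [c2|c2] := leP (de * (s / 2) ^+ 2) (nm (tri H (mid x y) y (mid y v))).
    exists (mid x y, y, mid y v, s / 2); split=> //=; lra.
  have [c3|c3] := leP (de * (s / 2) ^+ 2) (nm (tri H (mid v x) (mid y v) v)).
    exists (mid v x, mid y v, v, s / 2); split=> //=; rewrite nmBC; lra.
  exists (mid x y, mid y v, mid v x, s / 2); split=> //=; last by lra.
  split; first by split.
  split=> //; try by rewrite nmBC.
  by rewrite e4 in c1 c2 c3 *; lra.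
- split; first by rewrite !le_max !lexx !orbT.
  split=> //; rewrite ?/s0; try lra.
  by rewrite /de divfK // lt0r_neq0 // exprn_gt0.
move=> l hl.
have lD : nm l <= r.
  apply/ler_addgt0Pr => d d0.
  have [N hN] := @half_pow_small _ (2 * s0) _ d0.
  have [[[[x y] v] s] [[[h1 _ _] _] _ h2]] := hl N; have /= := hN N (leqnn N) => h3.
  have -> : l = x - (x - l) by ring.
  by apply: le_trans (nmB _ _) _; move: h2 => /= h2; lra.
have [|L hL] := Hd l; first by lra.
(* Points of the triangle lie within [3 * s] of [l] and its sides have length at most [s]; three
   sides cost [3 * (de / 18) * (3 * s) * s], half of the lower bound [de * s ^+ 2]. *)
have [|d [d0 hd]] := hL (de / 18); first by lra.
have [N hN] := @half_pow_small _ (3 * s0) _ d0.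
have [[[[x y] v] s]] := hl N; rewrite /= -mulrA.
move=> [[[xr yr vr] [h1 h2 h3 s_gt0 ht]] hs hx]; have := hN N (leqnn N).
rewrite -mulrA -hs => hd3; rewrite -hs in hx.
have ax : nm x < 1 by lra.
have ay : nm y < 1 by lra.
have av : nm v < 1 by lra.
pose P z := nm z <= r /\ nm (z - l) <= 3 * s.
have Pm p q : P p -> P q -> P (mid p q).
  by move=> [? ?] [? ?]; split; [apply: disc_ball|apply: mid_ball].
have Px : P x by split=> //; lra.
have Py : P y.
  split=> //; have -> : y - l = (y - x) + (x - l) by ring.
  by apply: le_trans (nmD _ _) _; lra.
have Pv : P v.
  split=> //; have -> : v - l = (v - x) + (x - l) by ring.
  by apply: le_trans (nmD _ _) _; rewrite [X in X + _]nmBC; lra.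
have HP z : P z -> nm (H z - ((H l - L * l) + L * z)) <= de / 18 * (3 * s).
  move=> [z1 z2].
  have -> : H z - (H l - L * l + L * z) = H z - H l - L * (z - l) by ring.
  apply: le_trans (hd z _ _) _; [lra|lra|].
  by rewrite ler_wpM2l // ltW //; lra.
have k1 := dyint_approx Hc ax ay Pm HP Px Py.
have k2 := dyint_approx Hc ay av Pm HP Py Pv.
have k3 := dyint_approx Hc av ax Pm HP Pv Px.
have ds : 0 < de * s ^+ 2 by rewrite mulr_gt0 // exprn_gt0.
suff : nm (tri H x y v) <= de / 18 * (3 * s) * s * 3.
  have -> : de / 18 * (3 * s) * s * 3 = de * s ^+ 2 / 2 by field.
  lra.
pose B z := (H l - L * l) * z + L * z ^+ 2 / 2.
rewrite -!/(B _) in k1 k2 k3.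
have -> : tri H x y v = (dyint H x y - (B y - B x)) + (dyint H y v - (B v - B y))
   + (dyint H v x - (B x - B v)) by rewrite /tri; ring.
have mono q : nm q <= s -> de / 18 * (3 * s) * nm q <= de / 18 * (3 * s) * s.
  by move=> h; rewrite ler_wpM2l // mulr_ge0 //; lra.
have := mono _ h1; have := mono _ h2; have := mono _ h3 => o1 o2 o3.
apply: le_trans (nmD _ _) _.
have := nmD (dyint H x y - (B y - B x)) (dyint H y v - (B v - B y)).
by lra.
Qed.

End Primitive.

(** * Primitives and second differences *)

Section Primitive.
Variable R : realType.
Local Notation C := R[i].
Implicit Types (H F G : C -> C) (a b c z w : C).

Definition prim H z := dyint H 0 z.

Lemma nm0_lt1 : nm (0 : C) < 1.
Proof. by rewrite nm0. Qed.

Lemma primB H a b : (forall z, nm z < 1 -> exists L, deriv_at H z L) ->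
  nm a < 1 -> nm b < 1 -> prim H b - prim H a = dyint H a b.
Proof.
move=> Hd aD bD; have := goursat Hd nm0_lt1 aD bD.
have Hc z : nm z < 1 -> cont_at H z by move=> /Hd[L /deriv_cont].
rewrite /tri (dyint_anti Hc nm0_lt1 bD) /prim => h.
have -> : dyint H 0 b = dyint H 0 a + dyint H a b.
  by apply/eqP; rewrite eq_sym -subr_eq0; apply/eqP.
by ring.
Qed.

Lemma prim_deriv H z : (forall z, nm z < 1 -> exists L, deriv_at H z L) ->
  nm z < 1 -> deriv_at (prim H) z (H z).
Proof.
move=> Hd zD e e0.
have Hc x : nm x < 1 -> cont_at H x by move=> /Hd[L /deriv_cont].
have [d [d0 hd]] := Hc z zD e e0; exists d; split=> // w wD wd.
rewrite primB //.
pose P x := nm x < 1 /\ nm (x - z) <= nm (w - z).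
have Pm p q : P p -> P q -> P (mid p q).
  by move=> [? ?] [? ?]; split; [apply: mid_disc|apply: mid_ball].
have HP x : P x -> nm (H x - (H z + 0 * x)) <= e.
  by move=> [x1 x2]; rewrite mul0r addr0; apply: hd => //; lra.
have Pz : P z by split=> //; rewrite subrr nm0 nm_ge0.
have Pw : P w by split.
have := dyint_approx Hc zD wD Pm HP Pz Pw.
by congr (nm (_ - _) <= _); ring.
Qed.

(** Integrating the first-order expansion of [prim H] along a segment raises its order by one. The
    second order is what [taylor2_max] works with. *)
Lemma prim2_taylor H z : (forall z, nm z < 1 -> exists L, deriv_at H z L) ->
  nm z < 1 -> forall e : R, 0 < e -> exists d : R, 0 < d /\
  forall w, nm w < 1 -> nm (w - z) < d ->
  nm (prim (prim H) w - prim (prim H) z - prim H z * (w - z)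
      - H z / 2 * (w - z) ^+ 2) <= e * nm (w - z) ^+ 2.
Proof.
move=> Hd zD e e0.
have Fd x : nm x < 1 -> exists L, deriv_at (prim H) x L.
  by move=> xD; exists (H x); apply: prim_deriv.
have Fc x : nm x < 1 -> cont_at (prim H) x by move=> /Fd[L /deriv_cont].
have [d [d0 hd]] := prim_deriv Hd zD e0; exists d; split=> // w wD wd.
rewrite primB //.
pose P x := nm x < 1 /\ nm (x - z) <= nm (w - z).
have Pm p q : P p -> P q -> P (mid p q).
  by move=> [? ?] [? ?]; split; [apply: mid_disc|apply: mid_ball].
have HP x : P x -> nm (prim H x - ((prim H z - H z * z) + H z * x)) <= e * nm (w - z).
  move=> [x1 x2].
  have -> : prim H x - (prim H z - H z * z + H z * x) =
     prim H x - prim H z - H z * (x - z) by ring.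
  apply: le_trans (hd x x1 _) _; first by lra.
  by rewrite ler_wpM2l // ltW.
have Pz : P z by split=> //; rewrite subrr nm0 nm_ge0.
have Pw : P w by split.
have := dyint_approx Fc zD wD Pm HP Pz Pw.
rewrite (_ : e * nm (w - z) * nm (w - z) = e * nm (w - z) ^+ 2); last by ring.
by congr (nm _ <= _); field.
Qed.

Definition diff2 G t z := G (z + t + t) - G (z + t) - (G (z + t) - G z).

Lemma dy_shift F n a b t :
  dy F n (a + t) (b + t) - dy F n a b = dy (fun s => F (s + t) - F s) n a b.
Proof.
have hm p q : mid (p + t) (q + t) = mid p q + t by rewrite /mid; field.
elim: n a b => [|n IH] a b /=; first by rewrite hm; ring.
by rewrite hm -!IH; ring.
Qed.

(** The second difference is an iterated integral of [H] over points at distance at most [2 * nm t]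
    from [z], hence [t ^+ 2] times an average of [H]. *)
Lemma diff2_approx H z t c (eta : R) :
  (forall z, nm z < 1 -> exists L, deriv_at H z L) -> nm z + 2 * nm t < 1 ->
  (forall x, nm (x - z) <= 2 * nm t -> nm (H x - c) <= eta) ->
  nm (diff2 (prim (prim H)) t z - c * t ^+ 2) <= eta * nm t ^+ 2.
Proof.
move=> Hd hzt hH.
have Hc x : nm x < 1 -> cont_at H x by move=> /Hd[L /deriv_cont].
have Fd x : nm x < 1 -> exists L, deriv_at (prim H) x L.
  by move=> xD; exists (H x); apply: prim_deriv.
have Fc x : nm x < 1 -> cont_at (prim H) x by move=> /Fd[L /deriv_cont].
have z0 := nm_ge0 z; have t0 := nm_ge0 t.
have tD k x : nm (x - z) <= k -> k <= 2 * nm t -> nm x < 1.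
  move=> h1 h2; have -> : x = z + (x - z) by ring.
  by apply: le_lt_trans (nmD _ _) _; lra.
have zt : nm (z + t - z) = nm t by congr nm; ring.
have ztt : nm (z + t + t - z) <= 2 * nm t.
  have -> : z + t + t - z = t + t by ring.
  by apply: le_trans (nmD _ _) _; lra.
have zz : nm (z - z) <= 0 by rewrite subrr nm0.
have zD : nm z < 1 by lra.
have ztD : nm (z + t) < 1 by apply: (tD (nm t)); lra.
have zttD : nm (z + t + t) < 1 by apply: (tD (2 * nm t)).
pose P x := nm (x - z) <= nm t.
have Pm p q : P p -> P q -> P (mid p q) by apply: mid_ball.
have HP s : P s -> nm (prim H (s + t) - prim H s - c * t) <= eta * nm t.
  rewrite /P => Ps; have st : nm (s + t - z) <= 2 * nm t.
    have -> : s + t - z = (s - z) + t by ring.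
    by apply: le_trans (nmD _ _) _; lra.
  have sD : nm s < 1 by apply: (tD (nm t)) => //; lra.
  have stD : nm (s + t) < 1 by apply: (tD (2 * nm t)).
  rewrite primB //.
  pose P2 x := nm (x - z) <= 2 * nm t.
  have P2m p q : P2 p -> P2 q -> P2 (mid p q) by apply: mid_ball.
  have HP2 x : P2 x -> nm (H x - (c + 0 * x)) <= eta.
    by rewrite mul0r addr0; apply: hH.
  have P2s : P2 s by rewrite /P2; lra.
  have := dyint_approx Hc sD stD P2m HP2 P2s st.
  rewrite (_ : s + t - s = t); last by ring.
  by congr (nm (_ - _) <= _); ring.
rewrite /diff2 !primB //.
(* By [dy_shift] the outer integral runs over increments of [prim H], which [HP] controls. *)
have cvF : cv (fun n => dy (fun s => prim H (s + t) - prim H s) n z (z + t))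
    (dyint (prim H) (z + t) (z + t + t) - dyint (prim H) z (z + t)).
  have -> : (fun n => dy (fun s => prim H (s + t) - prim H s) n z (z + t)) =
    (fun n => dy (prim H) n (z + t) (z + t + t) + - dy (prim H) n z (z + t)).
    by apply/funext => n; rewrite -dy_shift.
  by apply: cvD; [apply: dyint_cv|apply/cvN/dyint_cv].
apply: (cv_bound _ cvF) => n.
have Pz : P z by rewrite /P subrr nm0.
have Pzt : P (z + t) by rewrite /P zt.
have := dy_const Pm HP n Pz Pzt.
rewrite (_ : z + t - z = t); last by ring.
by rewrite (_ : eta * nm t * nm t = eta * nm t ^+ 2) 1?(_ : c * t * t = c * t ^+ 2) //; ring.
Qed.

End Primitive.

(** * The maximum principle *)

Section MaximumPrinciple.
Variable R : realType.
Local Notation C := R[i].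
Implicit Types (H F G : C -> C) (a b c z w : C).

Definition box c (s : R) z :=
  `|complex.Re z - complex.Re c| <= s /\ `|complex.Im z - complex.Im c| <= s.

Lemma box_nm c (s : R) z : box c s z -> nm (z - c) <= 2 * s.
Proof.
move=> [h1 h2]; apply: le_trans (nm_ReIm _) _.
by case: z c h1 h2 => [? ?] [? ?] /=; lra.
Qed.

Lemma box_split c (s : R) z : box c s z -> exists c', [/\ box c' (s / 2) z,
  nm (c' - c) <= s & c' \in [:: c + ((s / 2) +i* (s / 2))%C; c + ((s / 2) +i* (- (s / 2)))%C;
    c + ((- (s / 2)) +i* (s / 2))%C; c + ((- (s / 2)) +i* (- (s / 2)))%C]].
Proof.
case: c z => [p q] [x y] [/= h1 h2].
have s0 : 0 <= s by apply: le_trans h1; rewrite normr_ge0.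
have key (u v : R) : `|u| <= s / 2 -> `|v| <= s / 2 ->
    nm ((p +i* q)%C + (u +i* v)%C - (p +i* q)%C) <= s.
  move=> hu hv; apply: le_trans (nm_ReIm _) _ => /=.
  rewrite (_ : p + u - p = u); last by ring.
  by rewrite (_ : q + v - q = v); [lra | ring].
have n1 : `|s / 2| <= s / 2 by rewrite ger0_norm //; lra.
have n2 : `|- (s / 2)| <= s / 2 by rewrite normrN.
move: h1 h2; rewrite !ler_norml => /andP[h1 h1'] /andP[h2 h2'].
have [c1|c1] := leP p x; have [c2|c2] := leP q y.
- exists ((p +i* q) + (s / 2 +i* (s / 2)))%C; rewrite !inE eqxx ?orbT; split=> //.
    by split=> /=; rewrite ler_norml; apply/andP; split; lra.
  exact: key.
- exists ((p +i* q) + (s / 2 +i* (- (s / 2))))%C; rewrite !inE eqxx ?orbT; split=> //.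
    by split=> /=; rewrite ler_norml; apply/andP; split; lra.
  exact: key.
- exists ((p +i* q) + ((- (s / 2)) +i* (s / 2)))%C; rewrite !inE eqxx ?orbT; split=> //.
    by split=> /=; rewrite ler_norml; apply/andP; split; lra.
  exact: key.
- exists ((p +i* q) + ((- (s / 2)) +i* (- (s / 2))))%C; rewrite !inE eqxx ?orbT; split=> //.
    by split=> /=; rewrite ler_norml; apply/andP; split; lra.
  exact: key.
Qed.

(** If each of finitely many boxes is beaten by some point of [K], the best of these points beats
    them all. Hence one of the four quarters of a box must keep values as large as any. *)
Lemma seq_not_all_max (T : eqType) (B : T -> C -> Prop) (K : set C) (u : C -> R)
  (s : seq T) : (exists z, K z) ->
  (forall t, t \in s -> exists z, K z /\ forall z', K z' -> B t z' -> u z' < u z) ->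
  exists z, K z /\ forall t z', t \in s -> K z' -> B t z' -> u z' < u z.
Proof.
move=> [z0 Kz0]; elim: s => [|t s IH] h; first by exists z0.
have [|z [Kz hz]] := IH; first by move=> t' ht'; apply: h; rewrite inE ht' orbT.
have [|z1 [Kz1 hz1]] := h t; first by rewrite inE eqxx.
have [le|lt] := leP (u z) (u z1).
  exists z1; split=> // t' z'; rewrite inE => /orP[/eqP-> |ht'] Kz' Bz'; first exact: hz1.
  exact: lt_le_trans (hz _ _ ht' Kz' Bz') le.
exists z; split=> // t' z'; rewrite inE => /orP[/eqP-> |ht'] Kz' Bz'; last exact: hz Bz'.
exact: lt_trans (hz1 _ Kz' Bz') lt.
Qed.

(* Nested boxes, each containing a value of u at least as large as any given one. *)
Lemma disc_attains_max (r : R) (u : C -> R) : 0 <= r ->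
  (forall z, nm z <= r -> forall e : R, 0 < e -> exists d : R, 0 < d /\
     forall w, nm w <= r -> nm (w - z) < d -> u w <= u z + e) ->
  exists z, nm z <= r /\ forall w, nm w <= r -> u w <= u z.
Proof.
move=> r0 hu; pose K := [set z : C | nm z <= r].
pose s0 := r + 1.
pose Bad (t : C * R) := 0 < t.2 /\
  forall z, K z -> exists z', [/\ K z', box t.1 t.2 z' & u z <= u z'].
have [] := @nested_limit R (C * R) Bad fst snd (0, s0).
- move=> [c s] [/= s_gt0 hB].
  apply: contrapT => hn.
  pose ch := [:: c + ((s / 2) +i* (s / 2))%C; c + ((s / 2) +i* (- (s / 2)))%C;
    c + ((- (s / 2)) +i* (s / 2))%C; c + ((- (s / 2)) +i* (- (s / 2)))%C].
  have [] := @seq_not_all_max _ (fun c' z' => box c' (s / 2) z' /\ nm (c' - c) <= s)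
    K u ch.
  + by exists 0; rewrite /K /= nm0.
  + move=> c' hc'; apply: contrapT => hn'.
    apply: hn; exists (c', s / 2) => /=.
    have hcc : nm (c' - c) <= s.
      apply: contrapT => hcc; apply: hn'; exists 0; split; first by rewrite /K /= nm0.
      by move=> z' _ [_ /hcc].
    split=> //; split=> /=; first by lra.
    move=> z Kz; apply: contrapT => hz; apply: hn'; exists z; split=> // z' Kz' [Bz' _].
    by rewrite ltNge; apply/negP => le; apply: hz; exists z'.
  + move=> z [Kz hz]; have [z' [Kz' Bz' le]] := hB z Kz.
    have [c' [h1 h2 h3]] := box_split Bz'.
    by have := hz c' z' h3 Kz' (conj h1 h2); rewrite ltNge le.
- split=> /=; first by rewrite /s0; lra.
  move=> z Kz; exists z; split=> //.
  have h1 := nm_Re z; have h2 := nm_Im z; move: Kz; rewrite /K /= => Kz.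
  by split; rewrite /= subr0 /s0; lra.
move=> l hl; have s0_gt0 : 0 < s0 by rewrite /s0; lra.
have near d : 0 < d -> forall z, K z -> exists z', [/\ K z', nm (z' - l) < d & u z <= u z'].
  move=> d0 z Kz; have [N hN] := @half_pow_small _ (4 * s0) _ d0.
  have [[c s] [[/= s_gt0 hB] hs hc]] := hl N.
  have [z' [Kz' /box_nm Bz' le]] := hB z Kz; exists z'; split=> //.
  have := hN N (leqnn N); rewrite -mulrA -hs => h4.
  move: hc; rewrite -mulrA -hs => hc.
  by apply: le_lt_trans (nm_triang _ c _) _; lra.
exists l; split.
  apply/ler_addgt0Pr => d d0.
  have K0 : K 0 by rewrite /K /= nm0.
  have [z' [Kz' hz' _]] := near d d0 0 K0.
  have -> : l = z' - (z' - l) by ring.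
  by apply: le_trans (nmB _ _) _; move: Kz'; rewrite /K /=; lra.
move=> w Kw; apply/ler_addgt0Pr => e e0.
have lr : nm l <= r.
  apply/ler_addgt0Pr => d d0.
  have [z' [Kz' hz' _]] := near d d0 w Kw.
  have -> : l = z' - (z' - l) by ring.
  by apply: le_trans (nmB _ _) _; move: Kz'; rewrite /K /=; lra.
have [d [d0 hd]] := hu l lr e e0.
have [z' [Kz' hz' le]] := near d d0 w Kw.
exact: le_trans le (hd z' Kz' hz').
Qed.

Definition taylor2 G z := exists L1 L2 : C, forall e : R, 0 < e ->
  exists d : R, 0 < d /\ forall w, nm (w - z) < d ->
  nm (G w - G z - L1 * (w - z) - L2 * (w - z) ^+ 2) <= e * nm (w - z) ^+ 2.

Lemma taylor2_cont G z : taylor2 G z -> forall e : R, 0 < e -> exists d : R, 0 < d /\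
  forall w, nm (w - z) < d -> nm (G w - G z) <= e.
Proof.
move=> [L1 [L2 h]] e e0; have [d [d0 hd]] := h 1 ltr01.
pose k := nm L1 + nm L2 + 1.
have p1 := nm_ge0 L1; have p2 := nm_ge0 L2.
have k0 : 0 < k by rewrite /k; lra.
exists (Num.min d (Num.min 1 (e / k))); split; first by rewrite !lt_min d0 ltr01 divr_gt0.
move=> w; rewrite !lt_min => /and3P[/hd h1 h2 h3].
have -> : G w - G z = (G w - G z - L1 * (w - z) - L2 * (w - z) ^+ 2) +
  (L1 * (w - z) + L2 * (w - z) ^+ 2) by ring.
apply: le_trans (nmD _ _) _.
have := nmD (L1 * (w - z)) (L2 * (w - z) ^+ 2); rewrite (nmM L1) (nmM L2) nmX.
move: h3; rewrite ltr_pdivlMr // => h3.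
set x := nm (w - z) in h1 h2 h3 *; have x0 : 0 <= x := nm_ge0 _.
have x2 : x ^+ 2 <= x by rewrite expr2 ler_piMl // ltW.
have : nm L2 * x ^+ 2 <= nm L2 * x by rewrite ler_wpM2l.
have : x * k = nm L1 * x + nm L2 * x + x by rewrite /k; ring.
by rewrite mul1r in h1; lra.
Qed.

Lemma Re_le_nm z : complex.Re z <= nm z.
Proof. exact: le_trans (ler_norm _) (nm_Re z). Qed.

Lemma ReD z w : complex.Re (z + w) = complex.Re z + complex.Re w.
Proof. by case: z w => [? ?] [? ?]. Qed.

(* Averaging over z + rho i^k shows that Re (zeta G) + eta |z|^2 has no interior maximum. *)
Lemma taylor2_max (r r1 M : R) G : 0 <= r -> r1 <= r ->
  (forall z, nm z <= r -> taylor2 G z) ->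
  (forall z, r1 <= nm z -> nm z <= r -> nm (G z) <= M) ->
  forall z, nm z <= r -> nm (G z) <= M.
Proof.
move=> r0 r1r hG hM z0 hz0.
rewrite leNgt; apply/negP => lt.
have g0 : 0 < nm (G z0).
  have := hM ((r%:C)%C : C); rewrite nm_real ger0_norm // => /(_ r1r (lexx r)).
  by have := nm_ge0 (G ((r%:C)%C : C)); lra.
pose ze := (G z0)^* / (((nm (G z0))%:C)%C : C).
have nze : nm ze = 1.
  by rewrite nmM nmV nmJ nm_real ger0_norm ?divff ?gt_eqF // ltW.
have zeG : ze * G z0 = ((nm (G z0))%:C)%C.
  rewrite mulrAC [_ * G z0]mulrC mulJ_nm rmorphXn /= expr2 mulfK //.
  by rewrite -nmE normr_eq0 -nm_eq0 gt_eqF.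
(* Small enough that adding [eta * nm z ^+ 2] cannot move the maximum into the collar where [M] is
   the bound. *)
pose eta := (nm (G z0) - M) / (2 * (r ^+ 2 + 1)).
have r20 : 0 <= r ^+ 2 by rewrite exprn_ge0.
have eta_gt0 : 0 < eta by rewrite divr_gt0 // ?subr_gt0 //; lra.
have etar : eta * r ^+ 2 < nm (G z0) - M.
  rewrite /eta mulrAC ltr_pdivrMr; last by lra.
  by rewrite ltr_pM2l ?subr_gt0 //; lra.
pose u z := complex.Re (ze * G z) + eta * nm z ^+ 2.
have [|zs [zsr hmax]] := @disc_attains_max r u r0.
  move=> z zr e e0.
  have [|d [d0 hd]] := taylor2_cont (hG z zr) (e := e / 2); first by lra.
  pose d' := e / 2 / (eta * (2 * r) + 1).
  have er : 0 <= eta * (2 * r) by rewrite mulr_ge0 //; lra.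
  have d'0 : 0 < d' by rewrite !divr_gt0 //; lra.
  exists (Num.min d d'); split; first by rewrite lt_min d0.
  move=> w wr; rewrite lt_min => /andP[/hd h1 h2].
  have h3 : complex.Re (ze * G w) - complex.Re (ze * G z) <= e / 2.
    have -> : complex.Re (ze * G w) - complex.Re (ze * G z) = complex.Re (ze * (G w - G z)).
      have -> : ze * (G w - G z) = ze * G w - ze * G z by ring.
      by case: (ze * G w) (ze * G z) => [? ?] [? ?].
    by apply: le_trans (Re_le_nm _) _; rewrite nmM nze mul1r.
  have h4 : nm w - nm z <= nm (w - z).
    have := nmD (w - z) z; rewrite (_ : w - z + z = w); last by ring.
    lra.
  move: h2; rewrite /d' ltr_pdivlMr; last by lra.
  set x := nm (w - z) in h4 *; have x0 : 0 <= x := nm_ge0 _ => h2.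
  have nz := nm_ge0 z; have nw := nm_ge0 w.
  have h5 : nm w ^+ 2 - nm z ^+ 2 <= x * (2 * r).
    rewrite subr_sqr; apply: le_trans (_ : x * (nm w + nm z) <= _).
      by rewrite ler_wpM2r //; lra.
    by rewrite ler_wpM2l //; lra.
  have h6 : eta * (nm w ^+ 2 - nm z ^+ 2) <= eta * (x * (2 * r)).
    by rewrite ler_pM2l.
  rewrite /u; have : x * (eta * (2 * r) + 1) = eta * (x * (2 * r)) + x by ring.
  rewrite mulrBr in h6; lra.
have nzs := nm_ge0 zs; have nz0 := nm_ge0 z0.
have uz0 : nm (G z0) <= u zs.
  apply: le_trans (hmax z0 hz0); rewrite /u zeG /=.
  by rewrite lerDl; apply: mulr_ge0; [exact: ltW|exact: exprn_ge0].
have zsr1 : nm zs < r1.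
  rewrite ltNge; apply/negP => le; have := hM zs le zsr => h1.
  have h2 : complex.Re (ze * G zs) <= M.
    by apply: le_trans (Re_le_nm _) _; rewrite nmM nze mul1r.
  have : eta * nm zs ^+ 2 <= eta * r ^+ 2.
    by rewrite ler_pM2l // ler_pXn2r ?nnegrE.
  by move: uz0; rewrite /u; lra.
have [L1 [L2 hT]] := hG zs zsr.
have [|d [d0 hd]] := hT (eta / 2); first by lra.
pose rho := Num.min (d / 2) ((r - nm zs) / 2).
have rho_gt0 : 0 < rho by rewrite lt_min; apply/andP; split; lra.
have rho_d : rho < d.
  by apply: le_lt_trans (_ : d / 2 < _); [rewrite ge_min lexx|lra].
have rho_r : nm zs + rho <= r.
  have : rho <= (r - nm zs) / 2 by rewrite ge_min lexx orbT.
  lra.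
have pt v : nm v = rho -> complex.Re (ze * (G zs + L1 * v + L2 * v ^+ 2))
    + eta * nm (zs + v) ^+ 2 - eta / 2 * rho ^+ 2 <= u zs.
  move=> nv; have := hd (zs + v).
  rewrite (_ : zs + v - zs = v); last by ring.
  rewrite nv => /(_ rho_d) h1.
  have /hmax : nm (zs + v) <= r by apply: le_trans (nmD _ _) _; rewrite nv.
  rewrite /u => h2.
  have h3 : complex.Re (ze * (G zs + L1 * v + L2 * v ^+ 2)) <=
      complex.Re (ze * G (zs + v)) + eta / 2 * rho ^+ 2.
    have -> : ze * (G zs + L1 * v + L2 * v ^+ 2) = ze * G (zs + v) +
      - (ze * (G (zs + v) - G zs - L1 * v - L2 * v ^+ 2)) by ring.
    rewrite ReD lerD2l; apply: le_trans (Re_le_nm _) _.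
    by rewrite nmN nmM nze mul1r.
  lra.
pose v : C := ((rho%:C)%C : C); pose vi : C := v * ('i)%C.
have nv : nm v = rho by rewrite nm_real ger0_norm // ltW.
have nvi : nm vi = rho.
  rewrite nmM nv (_ : nm ('i)%C = 1) ?mulr1 //.
  by rewrite /nm normc_def /= expr0n add0r expr1n sqrtr1.
have p1 := pt v nv; have p2 := pt vi nvi.
have := pt (- v); rewrite nmN => /(_ nv) p3.
have := pt (- vi); rewrite nmN => /(_ nvi) p4.
have vi2 : vi ^+ 2 = - v ^+ 2.
  by rewrite exprMn sqr_i mulrN1.
(* Over the directions 1, i, -1, -i the linear and quadratic terms cancel. The term in [eta] gains
   [4 * (eta * rho ^+ 2)], and the four Taylor errors cost only half of that. *)
have sumRe : complex.Re (ze * (G zs + L1 * v + L2 * v ^+ 2)) +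
   complex.Re (ze * (G zs + L1 * vi + L2 * vi ^+ 2)) +
   complex.Re (ze * (G zs + L1 * (- v) + L2 * (- v) ^+ 2)) +
   complex.Re (ze * (G zs + L1 * (- vi) + L2 * (- vi) ^+ 2)) = 4 * complex.Re (ze * G zs).
  rewrite -!ReD !sqrrN vi2.
  have -> : ze * (G zs + L1 * v + L2 * v ^+ 2) + ze * (G zs + L1 * vi + L2 * - v ^+ 2) +
     ze * (G zs + L1 * - v + L2 * v ^+ 2) + ze * (G zs + L1 * - vi + L2 * - v ^+ 2) =
     ze * G zs + ze * G zs + ze * G zs + ze * G zs by ring.
  by rewrite !ReD; ring.
have sumN : nm (zs + v) ^+ 2 + nm (zs + vi) ^+ 2 + nm (zs - v) ^+ 2 + nm (zs - vi) ^+ 2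
   = 4 * nm zs ^+ 2 + 4 * rho ^+ 2.
  have key (x y : C) : nm (x + y) ^+ 2 + nm (x - y) ^+ 2 =
      nm x ^+ 2 + nm x ^+ 2 + (nm y ^+ 2 + nm y ^+ 2).
    apply: complexI; rewrite !rmorphD /= -!mulJ_nm.
    by rewrite rmorphB rmorphD /=; ring.
  have k1 := key zs v; have k2 := key zs vi; rewrite nv in k1; rewrite nvi in k2.
  by lra.
move: p1 p2 p3 p4; rewrite /u => p1 p2 p3 p4.
have rr : 0 < eta * rho ^+ 2 by rewrite mulr_gt0 // exprn_gt0.
have s2 : eta * nm (zs + v) ^+ 2 + eta * nm (zs + vi) ^+ 2 + eta * nm (zs - v) ^+ 2 +
  eta * nm (zs - vi) ^+ 2 = 4 * (eta * nm zs ^+ 2) + 4 * (eta * rho ^+ 2).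
  by rewrite -!mulrDr sumN; ring.
have e2 : eta / 2 * rho ^+ 2 = (eta * rho ^+ 2) / 2 by ring.
by rewrite !e2 in p1 p2 p3 p4; lra.
Qed.

End MaximumPrinciple.

(** * Maximum principle and differential calculus in the disk *)

Section Analytic.
Variable R : realType.
Local Notation C := R[i].
Implicit Types (H F G : C -> C) (a b c z w : C).

(* H is the limit of the second difference quotients of its second primitive; these
   obey [taylor2_max] and are averages of H. *)
Lemma max_principle H (r0 M : R) : 0 <= r0 -> r0 < 1 ->
  (forall z, nm z < 1 -> exists L, deriv_at H z L) ->
  (forall z, r0 < nm z -> nm z < 1 -> nm (H z) <= M) ->
  forall z, nm z < 1 -> nm (H z) <= M.
Proof.
move=> r00 r01 Hd hM z0 z0D; apply/ler_addgt0Pr => e e0.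
have [L /deriv_cont Hc] := Hd z0 z0D; have [d [d0 hd]] := Hc e e0.
pose m := Num.max r0 (nm z0).
have m0 : r0 <= m by rewrite le_max lexx.
have mz : nm z0 <= m by rewrite le_max lexx orbT.
have m1 : m < 1 by rewrite gt_max r01.
pose rho := (1 + m) / 2; pose r := (1 + rho) / 2.
have rho1 : rho < 1 by rewrite /rho; lra.
have mrho : m < rho by rewrite /rho; lra.
have rr : rho < r by rewrite /r; lra.
have r1 : r < 1 by rewrite /r; lra.
(* [d / 3] keeps the average at [z0] within [e] of [H z0], [(1 - r) / 3] keeps all evaluation points
   in the disk, and [(rho - m) / 3] keeps those seen from [rho <= nm z] beyond [r0]. *)
pose t0 := Num.min (d / 3) (Num.min ((1 - r) / 3) ((rho - m) / 3)).
have t00 : 0 < t0 by rewrite !lt_min; apply/and3P; split; lra.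
have td : t0 <= d / 3 by rewrite ge_min lexx.
have tr : t0 <= (1 - r) / 3 by rewrite !ge_min lexx orbT.
have tm : t0 <= (rho - m) / 3 by rewrite !ge_min lexx !orbT.
pose t : C := ((t0%:C)%C : C).
have nt : nm t = t0 by rewrite nm_real ger0_norm // ltW.
have tn0 : t ^+ 2 != 0 by rewrite expf_neq0 // -nm_gt0 nt.
pose G := prim (prim H); pose Q z := diff2 G t z / t ^+ 2.
have near c (eta : R) z : nm z + 2 * nm t < 1 ->
    (forall x, nm (x - z) <= 2 * nm t -> nm (H x - c) <= eta) -> nm (Q z - c) <= eta.
  move=> h1 h2; have := diff2_approx Hd h1 h2; rewrite -/G.
  have -> : diff2 G t z - c * t ^+ 2 = (Q z - c) * t ^+ 2.
    by rewrite /Q mulrBl divfK.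
  by rewrite nmM nmX ler_pM2r // exprn_gt0 // nt.
have QM z : rho <= nm z -> nm z <= r -> nm (Q z) <= M.
  move=> z1 z2; rewrite -[Q z]subr0; apply: near; first by rewrite nt; lra.
  move=> x hx; rewrite subr0; apply: hM.
    have := nmD (z - x) x; rewrite subrK nmBC nt in hx *; lra.
  have := nmD (x - z) z; rewrite subrK nt in hx *; lra.
have QT z : nm z <= r -> taylor2 Q z.
  move=> zr.
  have Gt y : nm (y - z) <= 2 * t0 -> taylor2 G y.
    move=> hy; have yD : nm y + t0 <= 1.
      have := nmD (y - z) z; rewrite subrK; lra.
    exists (prim H y), (H y / 2) => e' e'0.
    have [|d' [d'0 hd']] := prim2_taylor (z := y) Hd _ e'0; first by lra.
    exists (Num.min d' t0); split; first by rewrite lt_min d'0.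
    move=> w; rewrite lt_min => /andP[h1 h2]; apply: hd' => //.
    have := nmD (w - y) y; rewrite subrK; lra.
  have [A1 [A2 hA]] : taylor2 G (z + t + t).
    apply: Gt; have -> : z + t + t - z = t + t by ring.
    by apply: le_trans (nmD _ _) _; rewrite nt; lra.
  have [B1 [B2 hB]] : taylor2 G (z + t).
    apply: Gt; have -> : z + t - z = t by ring.
    by rewrite nt; lra.
  have [E1 [E2 hE]] : taylor2 G z by apply: Gt; rewrite subrr nm0; lra.
  exists ((A1 - B1 - (B1 - E1)) / t ^+ 2), ((A2 - B2 - (B2 - E2)) / t ^+ 2) => e' e'0.
  pose e2 := e' * t0 ^+ 2 / 4.
  have e20 : 0 < e2 by rewrite divr_gt0 // mulr_gt0 // exprn_gt0.
  have [dA [dA0 hdA]] := hA _ e20; have [dB [dB0 hdB]] := hB _ e20.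
  have [dE [dE0 hdE]] := hE _ e20.
  exists (Num.min dA (Num.min dB dE)); split; first by rewrite !lt_min dA0 dB0.
  move=> w; rewrite !lt_min => /and3P[wA wB wE].
  have := hdA (w + t + t); have -> : w + t + t - (z + t + t) = w - z by ring.
  move=> /(_ wA) kA.
  have := hdB (w + t); have -> : w + t - (z + t) = w - z by ring.
  move=> /(_ wB) kB; have kE := hdE w wE.
  set TA := nm _ in kA; set TB := nm _ in kB; set TE := nm _ in kE.
  rewrite -[leLHS](mulfK (x := t0 ^+ 2)); last by rewrite expf_neq0 // gt_eqF.
  rewrite ler_pdivrMr ?exprn_gt0 //.
  have t2 : t0 ^+ 2 = nm (t ^+ 2) by rewrite nmX nt.
  rewrite {1}t2 -nmM.
  have -> : (Q w - Q z - (A1 - B1 - (B1 - E1)) / t ^+ 2 * (w - z) -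
     (A2 - B2 - (B2 - E2)) / t ^+ 2 * (w - z) ^+ 2) * t ^+ 2 =
     (G (w + t + t) - G (z + t + t) - A1 * (w - z) - A2 * (w - z) ^+ 2) -
     (G (w + t) - G (z + t) - B1 * (w - z) - B2 * (w - z) ^+ 2) -
     ((G (w + t) - G (z + t) - B1 * (w - z) - B2 * (w - z) ^+ 2) -
     (G w - G z - E1 * (w - z) - E2 * (w - z) ^+ 2)).
    by rewrite /Q /diff2; field; rewrite -nm_gt0 nt.
  apply: le_trans (nmB _ _) _; apply: le_trans (lerD (nmB _ _) (nmB _ _)) _.
  rewrite -/TA -/TB -/TE.
  have -> : e' * nm (w - z) ^+ 2 * t0 ^+ 2 = 4 * (e2 * nm (w - z) ^+ 2).
    by rewrite /e2; field.
  lra.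
have k1 : nm (Q z0) <= M.
  by apply: (taylor2_max (r := r) (r1 := rho)) => //; lra.
have k2 : nm (Q z0 - H z0) <= e.
  apply: near; first by rewrite nt; lra.
  move=> x hx; apply: hd; last by rewrite nt in hx; lra.
  have := nmD (x - z0) z0; rewrite subrK nt in hx *; lra.
have -> : H z0 = Q z0 - (Q z0 - H z0) by ring.
by apply: le_trans (nmB _ _) _; lra.
Qed.

Lemma cont_cst c z : cont_at (fun=> c) z.
Proof. by move=> e e0; exists 1; split=> // w _ _; rewrite subrr nm0 ltW. Qed.

Lemma cont_id z : cont_at id z.
Proof. by move=> e e0; exists e; split=> // w _ /ltW. Qed.

Lemma cont_tends H z :
  cont_at H z <-> tends (fun d w => nm w < 1 /\ nm (w - z) < d) H (H z).
Proof.
split=> h e e0; have [d [d0 hd]] := h e e0; exists d; split=> //.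
  by move=> d' _ d'd w [wD wd]; apply: hd => //; apply: lt_le_trans wd d'd.
by move=> w wD wd; apply: (hd d).
Qed.

Lemma contD H F z : cont_at H z -> cont_at F z -> cont_at (fun w => H w + F w) z.
Proof. by move=> /cont_tends h1 /cont_tends h2; apply/cont_tends; apply: tendsD. Qed.

Lemma contM H F z : cont_at H z -> cont_at F z -> cont_at (fun w => H w * F w) z.
Proof. by move=> /cont_tends h1 /cont_tends h2; apply/cont_tends; apply: tendsM. Qed.

Lemma contV H z : H z != 0 -> cont_at H z -> cont_at (fun w => (H w)^-1) z.
Proof. by move=> nz /cont_tends h; apply/cont_tends; apply: tendsV. Qed.

Lemma contN H z : cont_at H z -> cont_at (fun w => - H w) z.
Proof. by move=> /cont_tends h; apply/cont_tends; apply: tendsN. Qed.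

Lemma contB H F z : cont_at H z -> cont_at F z -> cont_at (fun w => H w - F w) z.
Proof. by move=> h1 h2; apply: contD => //; apply: contN. Qed.

Lemma cont_prod (I : eqType) (s : seq I) (F : I -> C -> C) z :
  (forall i, i \in s -> cont_at (F i) z) -> cont_at (fun w => \prod_(i <- s) F i w) z.
Proof.
elim: s => [|i s IH] h.
  by under [X in cont_at X]funext do rewrite big_nil; apply: cont_cst.
under [X in cont_at X]funext do rewrite big_cons.
apply: contM; first by apply: h; rewrite inE eqxx.
by apply: IH => j hj; apply: h; rewrite inE hj orbT.
Qed.

Lemma cont_ext H F z (d : R) : 0 < d -> nm z < 1 ->
  (forall w, nm w < 1 -> nm (w - z) < d -> H w = F w) -> cont_at F z -> cont_at H z.
Proof.
move=> d0 zD e h e' /h[d' [d'0 hd']]; exists (Num.min d d'); split.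
  by rewrite lt_min d0.
move=> w wD; rewrite lt_min => /andP[w1 w2].
by rewrite !e ?subrr ?nm0 //; apply: hd'.
Qed.

(* Caratheodory's form of differentiability. *)
Definition diff_at H z := exists2 Phi, cont_at Phi z &
  forall w, nm w < 1 -> H w - H z = Phi w * (w - z).

Lemma diff_atP H z : diff_at H z <-> exists L, deriv_at H z L.
Proof.
split=> [[Phi cP hP]|[L hL]].
  exists (Phi z) => e /cP[d [d0 hd]]; exists d; split=> // w wD /(hd w wD) k.
  by rewrite hP // -mulrBl nmM ler_wpM2r ?nm_ge0.
exists (fun w => if w == z then L else (H w - H z) / (w - z)).
  move=> e e0; have [d [d0 hd]] := hL e e0; exists d; split=> // w wD /(hd w wD) k.
  rewrite eqxx; have [_|nz] := eqVneq w z; first by rewrite subrr nm0 ltW.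
  have wz : 0 < nm (w - z) by rewrite nm_gt0 subr_eq0.
  rewrite -(ler_pM2r wz) -nmM mulrBl divfK ?subr_eq0 //.
move=> w wD; have [->|nz] := eqVneq w z; first by rewrite !subrr mulr0.
by rewrite divfK // subr_eq0.
Qed.

Lemma analytic_diff H : analytic_on_D H <-> forall z, nm z < 1 -> diff_at H z.
Proof. by rewrite analyticE; split=> h z /h /diff_atP. Qed.

Lemma diff_cont H z : diff_at H z -> cont_at H z.
Proof. by move=> /diff_atP[L /deriv_cont]. Qed.

Lemma diff_cst c z : diff_at (fun=> c) z.
Proof. by exists (fun=> 0) => [|w _]; [apply: cont_cst|rewrite subrr mul0r]. Qed.

Lemma diff_id z : diff_at id z.
Proof. by exists (fun=> 1) => [|w _]; [apply: cont_cst|rewrite mul1r]. Qed.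

Lemma diffD H F z : diff_at H z -> diff_at F z -> diff_at (fun w => H w + F w) z.
Proof.
move=> [P cP hP] [Q cQ hQ]; exists (fun w => P w + Q w); first exact: contD.
move=> w wD; rewrite mulrDl -hP // -hQ //; ring.
Qed.

Lemma diffN H z : diff_at H z -> diff_at (fun w => - H w) z.
Proof.
move=> [P cP hP]; exists (fun w => - P w); first exact: contN.
by move=> w wD; rewrite mulNr -hP // opprD.
Qed.

Lemma diffB H F z : diff_at H z -> diff_at F z -> diff_at (fun w => H w - F w) z.
Proof. by move=> h1 h2; apply: diffD => //; apply: diffN. Qed.

Lemma diffM H F z : diff_at H z -> diff_at F z -> diff_at (fun w => H w * F w) z.
Proof.
move=> dH [Q cQ hQ]; have [P cP hP] := dH; have cH := diff_cont dH.
exists (fun w => P w * F z + H w * Q w).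
  by apply: contD; apply: contM => //; apply: cont_cst.
move=> w wD; rewrite mulrDl mulrAC -hP // -mulrA -hQ //; ring.
Qed.

(** The identity with [Psi] is available only near [z], where [H w] is nonzero, while [diff_at] asks
    for the whole disk; hence the detour through [deriv_at]. *)
Lemma diffV H z : H z != 0 -> diff_at H z -> diff_at (fun w => (H w)^-1) z.
Proof.
move=> nz dH; have cH := diff_cont dH; have [L hL] := (diff_atP _ _).1 dH.
apply/diff_atP; have [P cP hP] := dH.
have cV := contV nz cH.
have [|d [d0 hd]] := cH (nm (H z) / 2); first by rewrite divr_gt0 // nm_gt0.
pose Psi w := - P w * (H w)^-1 * (H z)^-1.
have cPsi : cont_at Psi z.
  by apply: contM; [apply: contM => //; apply: contN|apply: cont_cst].
exists (Psi z) => e /cPsi[d' [d'0 hd']]; exists (Num.min d d'); split.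
  by rewrite lt_min d0.
move=> w wD; rewrite lt_min => /andP[/(hd w wD) k1 /(hd' w wD) k2].
have w0 : H w != 0.
  have := nmB (H w) (H w - H z); rewrite (_ : H w - (H w - H z) = H z); last by ring.
  by rewrite -nm_gt0; move: nz; rewrite -nm_gt0; lra.
have -> : (H w)^-1 - (H z)^-1 = Psi w * (w - z).
  have -> : Psi w * (w - z) = - (P w * (w - z)) / (H w * H z).
    by rewrite /Psi; field; rewrite nz w0.
  by rewrite -hP //; field; rewrite nz w0.
by rewrite -mulrBl nmM ler_wpM2r ?nm_ge0.
Qed.

Lemma diffX H z n : diff_at H z -> diff_at (fun w => H w ^+ n) z.
Proof.
move=> h; elim: n => [|n IH].
  by under [X in diff_at X]funext do rewrite expr0; apply: diff_cst.
by under [X in diff_at X]funext do rewrite exprS; apply: diffM.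
Qed.

Lemma diff_prod (I : eqType) (s : seq I) (F : I -> C -> C) z :
  (forall i, i \in s -> diff_at (F i) z) -> diff_at (fun w => \prod_(i <- s) F i w) z.
Proof.
elim: s => [|i s IH] h.
  by under [X in diff_at X]funext do rewrite big_nil; apply: diff_cst.
under [X in diff_at X]funext do rewrite big_cons.
apply: diffM; first by apply: h; rewrite inE eqxx.
by apply: IH => j hj; apply: h; rewrite inE hj orbT.
Qed.

(** A factor [w - a] repairs a point of mere continuity; [class_max_principle] treats its
    exceptional points this way. *)
Lemma diff_cont_mul H a : cont_at H a -> diff_at (fun w => (w - a) * H w) a.
Proof.
by move=> cH; exists H => // w _; rewrite subrr mul0r subr0 mulrC.
Qed.

Lemma diff_ext H F z (d : R) : 0 < d -> nm z < 1 ->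
  (forall w, nm w < 1 -> nm (w - z) < d -> H w = F w) -> diff_at F z -> diff_at H z.
Proof.
move=> d0 zD e /diff_atP[L hL]; apply/diff_atP; exists L => e' /hL[d' [d'0 hd']].
exists (Num.min d d'); split; first by rewrite lt_min d0.
move=> w wD; rewrite lt_min => /andP[w1 w2]; rewrite !e //; first exact: hd'.
by rewrite subrr nm0.
Qed.

(** [E] lists points where only continuity is known, as for quotients by a Blaschke factor at its
    zero. *)
Definition class_fun (E : seq C) H := forall z, nm z < 1 ->
  cont_at H z /\ (z \notin E -> diff_at H z).

Lemma exp_unbounded (x B : R) : 1 < x -> exists n, B < x ^+ n.
Proof.
move=> x1; have e0 : 0 < x - 1 by lra.
have bern n : 1 + n%:R * (x - 1) <= x ^+ n.
  elim: n => [|n IH]; first by rewrite mul0r addr0 expr0.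
  rewrite exprS; apply: le_trans (_ : x * (1 + n%:R * (x - 1)) <= _); last first.
    by rewrite ler_wpM2l //; lra.
  have -> : x * (1 + n%:R * (x - 1)) = 1 + n.+1%:R * (x - 1) + n%:R * (x - 1) ^+ 2.
    by rewrite -natr1; ring.
  by rewrite lerDl mulr_ge0 // ?ler0n // exprn_ge0 // ltW.
exists (Num.bound (B / (x - 1))); apply: lt_le_trans (bern _).
have := le_lt_trans (ler_norm _) (archi_boundP (normr_ge0 (B / (x - 1)))).
rewrite ltr_pdivrMr // => h.
suff <- : Num.bound `|B / (x - 1)| = Num.bound (B / (x - 1)) by lra.
by rewrite /Num.bound normr_id.
Qed.

Lemma near_avoid (E : seq C) z (d : R) : 0 < d -> nm z < 1 ->
  exists w, [/\ nm w < 1, nm (w - z) < d & w \notin z :: E].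
Proof.
move=> d0 zD.
pose d' := Num.min d (1 - nm z).
have d'0 : 0 < d' by rewrite lt_min d0 subr_gt0.
(* Starting at 2 keeps the distance strictly below [d']; among [(size E).+2] such points one escapes
   the [(size E).+1] forbidden ones. *)
pose pt (k : nat) : C := z + ((d' / k.+2%:R)%:C)%C.
have pt_inj : injective pt.
  move=> k l /addrI /complexI h.
  have /(congr1 (fun x => x / d')) : d' / k.+2%:R = d' / l.+2%:R by [].
  rewrite ![_ / _ / d']mulrAC divff ?gt_eqF // !mul1r => /invr_inj /eqP.
  by rewrite eqr_nat => /eqP [].
have npt k : nm (pt k - z) < d'.
  rewrite /pt addrAC subrr add0r nm_real ger0_norm; last by rewrite divr_ge0 // ltW.
  by rewrite ltr_pdivrMr ?ltr0n // ltr_pMr // ltr1n.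
have : ~~ all [in z :: E] [seq pt k | k <- iota 0 (size E).+2].
  apply/negP => /allP h.
  have := @uniq_leq_size _ [seq pt k | k <- iota 0 (size E).+2] (z :: E).
  rewrite map_inj_uniq // iota_uniq => /(_ isT h).
  by rewrite size_map size_iota ltnn.
rewrite -has_predC => /hasP[w /mapP[k _ ->] /= hw].
exists (pt k); split=> //.
  have -> : pt k = z + (pt k - z) by ring.
  apply: le_lt_trans (nmD _ _) _; have := npt k; rewrite lt_min => /andP[]; lra.
by have := npt k; rewrite lt_min => /andP[].
Qed.

(* Applied to (prod (z - a)) * h^n, which is analytic everywhere; the n-th root of
   the resulting constant tends to 1. *)
Lemma class_max_principle (E : seq C) H (r0 M : R) : 0 <= r0 -> r0 < 1 -> 0 < M ->
  class_fun E H -> (forall z, r0 < nm z -> nm z < 1 -> nm (H z) <= M) ->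
  forall z, nm z < 1 -> nm (H z) <= M.
Proof.
move=> r00 r01 M0 cH hM.
pose pE w := \prod_(a <- E) (w - a).
have key z : nm z < 1 -> z \notin E -> nm (H z) <= M.
  move=> zD zE; rewrite leNgt; apply/negP => lt.
  have p0 : 0 < nm (pE z).
    rewrite nm_gt0 /pE prodf_seq_neq0; apply/allP => a aE /=.
    by rewrite subr_eq0; apply: contraNneq zE => ->.
  pose bE := \prod_(a <- E) (1 + nm a).
  have bE0 : 0 <= bE by apply: prodr_ge0 => a _; have := nm_ge0 a; lra.
  have pEb w : nm w < 1 -> nm (pE w) <= bE.
    move=> wD; rewrite nm_prod; apply: ler_prod => a _; rewrite nm_ge0 /=.
    by apply: le_trans (nmB _ _) _; lra.
  have bound n : nm (pE z) * nm (H z) ^+ n <= bE * M ^+ n.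
    rewrite -nmX -nmM.
    apply: (@max_principle (fun w => pE w * H w ^+ n) r0 (bE * M ^+ n)) => //.
      move=> w wD; apply/diff_atP; have [cHw dHw] := cH w wD.
      have [wE|wE] := boolP (w \in E); last first.
        apply: diffM; last by apply: diffX; apply: dHw.
        by apply: diff_prod => a _; apply: diffB; [apply: diff_id|apply: diff_cst].
      have -> : (fun x => pE x * H x ^+ n) =
          (fun x => (x - w) * ((\prod_(a <- rem w E) (x - a)) * H x ^+ n)).
        by apply/funext => x; rewrite /pE (perm_big _ (perm_to_rem wE)) big_cons mulrA.
      apply: diff_cont_mul; apply: contM.
        by apply: cont_prod => a _; apply: contB; [apply: cont_id|apply: cont_cst].
      elim: n => [|n IH]; first by under [X in cont_at X]funext do rewrite expr0; apply: cont_cst.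
      by under [X in cont_at X]funext do rewrite exprS; apply: contM.
    move=> w w1 w2; rewrite nmM nmX; apply: ler_pM; rewrite ?nm_ge0 ?exprn_ge0 ?nm_ge0 ?pEb //.
    by apply: lerXn2r; rewrite ?nnegrE ?nm_ge0 ?hM // ltW.
  have [n hn] := @exp_unbounded (nm (H z) / M) (bE / nm (pE z)) ltac:(by rewrite ltr_pdivlMr // mul1r).
  have := bound n; rewrite leNgt => /negP; apply.
  move: hn; rewrite expr_div_n ltr_pdivrMr // mulrAC ltr_pdivlMr ?exprn_gt0 //.
  by rewrite [_ ^+ n * _]mulrC.
move=> z zD; apply/ler_addgt0Pr => e e0.
have [cHz _] := cH z zD; have [d [d0 hd]] := cHz e e0.
have [w [wD wz]] := near_avoid E d0 zD; rewrite inE negb_or => /andP[_ wE].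
have := hd w wD wz; have := key w wD wE => h1 h2.
have -> : H z = H w - (H w - H z) by ring.
by apply: le_trans (nmB _ _) _; lra.
Qed.

End Analytic.

(** * Pick kernels on finite combinations of points *)

Section Forms.
Variable R : realType.
Local Notation C := R[i].
Implicit Types (K : C -> C -> C) (l m : seq (C * C)) (f g : C -> C) (z w : C).

(* A list of pairs (c, z) stands for the formal combination of the c k_z, where k_z is
   the kernel function at z; [tw g] is the diagonal operator k_z |-> g(z) k_z. *)
Definition bf K l m : C := \sum_(p <- l) \sum_(q <- m) p.1 * q.1^* * K p.2 q.2.

Definition scl (c : C) l : seq (C * C) := [seq (c * p.1, p.2) | p <- l].

Definition tw g l : seq (C * C) := [seq (p.1 * g p.2, p.2) | p <- l].

Definition pts l : seq C := [seq p.2 | p <- l].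

Lemma bf_catl K l l' m : bf K (l ++ l') m = bf K l m + bf K l' m.
Proof. by rewrite /bf big_cat. Qed.

Lemma bf_catr K l m m' : bf K l (m ++ m') = bf K l m + bf K l m'.
Proof. by rewrite /bf -big_split /=; apply: eq_bigr => p _; rewrite big_cat. Qed.

Lemma bf_scll K c l m : bf K (scl c l) m = c * bf K l m.
Proof.
rewrite /bf big_map mulr_sumr; apply: eq_bigr => p _ /=.
by rewrite mulr_sumr; apply: eq_bigr => q _; rewrite !mulrA.
Qed.

Lemma bf_sclr K c l m : bf K l (scl c m) = c^* * bf K l m.
Proof.
rewrite /bf mulr_sumr; apply: eq_bigr => p _; rewrite big_map mulr_sumr.
by apply: eq_bigr => q _ /=; rewrite rmorphM /=; ring.
Qed.

Lemma bf_conj K l m : (forall z w, K w z = (K z w)^*) -> bf K m l = (bf K l m)^*.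
Proof.
move=> hK; rewrite /bf rmorph_sum exchange_big /=; apply: eq_bigr => p _.
rewrite rmorph_sum; apply: eq_bigr => q _ /=.
by rewrite (hK p.2 q.2) !rmorphM /= conjCK; ring.
Qed.

Lemma bf_ext K K' l m :
  (forall z w, z \in pts l -> w \in pts m -> K z w = K' z w) -> bf K l m = bf K' l m.
Proof.
move=> h; rewrite /bf big_seq [RHS]big_seq; apply: eq_bigr => p pl.
rewrite big_seq [RHS]big_seq; apply: eq_bigr => q qm.
by rewrite h //; apply: map_f.
Qed.

Lemma bf_tw K g l m : bf K (tw g l) (tw g m) = bf (fun z w => g z * (g w)^* * K z w) l m.
Proof.
rewrite /bf big_map; apply: eq_bigr => p _; rewrite big_map; apply: eq_bigr => q _ /=.
by rewrite rmorphM /=; ring.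
Qed.

Lemma bf_add K K' l m : bf (fun z w => K z w + K' z w) l m = bf K l m + bf K' l m.
Proof.
rewrite /bf -big_split; apply: eq_bigr => p _ /=; rewrite -big_split.
by apply: eq_bigr => q _ /=; rewrite mulrDr.
Qed.

Lemma bf_scale K c l m : bf (fun z w => c * K z w) l m = c * bf K l m.
Proof.
rewrite /bf mulr_sumr; apply: eq_bigr => p _; rewrite mulr_sumr.
by apply: eq_bigr => q _; ring.
Qed.

Lemma bf_rank1 g l m : bf (fun z w => g z * (g w)^*) l m =
  (\sum_(p <- l) p.1 * g p.2) * (\sum_(p <- m) p.1 * g p.2)^*.
Proof.
rewrite /bf mulr_suml; apply: eq_bigr => p _; rewrite rmorph_sum mulr_sumr.
by apply: eq_bigr => q _; rewrite rmorphM /=; ring.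
Qed.

Lemma mem_pts_tw g l z : (z \in pts (tw g l)) = (z \in pts l).
Proof. by rewrite /pts -map_comp. Qed.

Lemma mem_pts_scl c l z : (z \in pts (scl c l)) = (z \in pts l).
Proof. by rewrite /pts -map_comp. Qed.

Lemma mem_pts_cat l m z : (z \in pts (l ++ m)) = (z \in pts l) || (z \in pts m).
Proof. by rewrite /pts map_cat mem_cat. Qed.

Definition ker f z w : C := (1 - f z * (f w)^*) / (1 - z * w^*).

Lemma kerC f z w : ker f w z = (ker f z w)^*.
Proof.
rewrite /ker rmorphM fmorphV !rmorphB !rmorphM /= rmorph1 !conjCK.
by rewrite [f w * _]mulrC [w * _]mulrC.
Qed.

Lemma cauchy_schwarz_numbers (a b d : C) : 0 <= a -> 0 <= d ->
  (forall x y : C, 0 <= x * x^* * a + x * y^* * b + y * x^* * b^* + y * y^* * d) ->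
  b * b^* <= a * d.
Proof.
move=> a0 d0 h.
have ar := geC0_conj a0; have dr := geC0_conj d0.
have [d00|dn] := eqVneq d 0.
  have [->|bn] := eqVneq b 0; first by rewrite mul0r mulr_ge0.
  (* With [d = 0] the form is affine in [y] up to conjugation; this test vector gives -|b|^4 (a +
     2), which is negative since [b] is nonzero. *)
  have := h (b * b^*) (- (a + 1) * b).
  rewrite d00 !mulr0 addr0 !rmorphM rmorphN rmorphD /= rmorph1 ar conjCK.
  have -> : b * b^* * (b^* * b) * a + b * b^* * (- (a + 1) * b^*) * b +
    - (a + 1) * b * (b^* * b) * b^* = - ((b * b^*) ^+ 2 * (a + 2)) by ring.
  rewrite oppr_ge0 => h'.
  have : 0 < (b * b^*) ^+ 2 * (a + 2).
    by rewrite mulr_gt0 ?exprn_gt0 ?mul_conjC_gt0 // ltr_wpDl // ltr0n.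
  by move=> /lt_le_trans -/(_ _ h'); rewrite ltxx.
have := h d (- b); rewrite !rmorphN /= dr.
have -> : d * d * a + d * - b^* * b + - b * d * b^* + - b * - b^* * d =
  d * (a * d - b * b^*) by ring.
by rewrite pmulr_rge0 ?subr_ge0 // lt_def dn.
Qed.

End Forms.

(** * Schur's algorithm *)

Section SchurAlgorithm.
Variable R : realType.
Local Notation C := R[i].
Implicit Types (K : C -> C -> C) (l m : seq (C * C)) (f g S : C -> C) (a z w : C).

Definition bl a z : C := (z - a) / (1 - z * a^*).

Lemma mobius_id z w :
  nm (1 - z * w^*) ^+ 2 - nm (z - w) ^+ 2 = (1 - nm z ^+ 2) * (1 - nm w ^+ 2).
Proof.
apply: complexI; rewrite [RHS]rmorphM !rmorphB /= -!mulJ_nm rmorph1.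
by rewrite !rmorphB rmorphM /= rmorph1 conjCK; ring.
Qed.

Lemma nmB_le1 z : 1 - nm z <= nm (1 - z).
Proof. by have := nmD (1 - z) z; rewrite subrK nm1; lra. Qed.

Lemma mobius_le z w : nm z <= 1 -> nm w <= 1 -> nm (z - w) <= nm (1 - z * w^*).
Proof.
move=> z1 w1; rewrite -(@ler_pXn2r _ 2) ?nnegrE ?nm_ge0 // -subr_ge0 mobius_id.
by rewrite mulr_ge0 // subr_ge0 expr_le1 ?nm_ge0.
Qed.

Lemma den_gt0 a z : nm a < 1 -> nm z < 1 -> 0 < nm (1 - z * a^*).
Proof. by move=> aD zD; rewrite nm_gt0 nm_lt1_neq0. Qed.

Lemma nm_bl a z : nm (bl a z) = nm (z - a) / nm (1 - z * a^*).
Proof. by rewrite nmM nmV. Qed.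

Lemma bl_eq0 a z : nm a < 1 -> nm z < 1 -> (bl a z == 0) = (z == a).
Proof.
move=> aD zD; rewrite mulf_eq0 invr_eq0 (negbTE (nm_lt1_neq0 zD aD)) orbF.
by rewrite subr_eq0.
Qed.

(** |b_a| tends to 1 at the circle, so division by [bl a] costs an arbitrarily small factor in a
    maximum principle. *)
Lemma bl_boundary a (M : R) : nm a < 1 -> 1 < M -> exists r0, [/\ 0 <= r0, r0 < 1 &
  forall z, r0 < nm z -> nm z < 1 -> 1 <= M * nm (bl a z)].
Proof.
move=> aD M1; have a0 := nm_ge0 a.
pose k := (1 - M^-1 ^+ 2) * (1 - nm a) ^+ 2.
have Mi : 0 < M^-1 by rewrite invr_gt0; lra.
have Mi1 : M^-1 < 1 by rewrite invf_lt1 //; lra.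
have k0 : 0 < k.
  by rewrite mulr_gt0 ?exprn_gt0 ?subr_gt0 // expr_lt1 // ltW.
exists (Num.max 0 (1 - k / 2)); split.
- by rewrite le_max lexx.
- by rewrite gt_max ltr01; lra.
move=> z; rewrite gt_max => /andP[z0 zk] zD.
have dp := den_gt0 aD zD.
have d1 : 1 - nm a <= nm (1 - z * a^*).
  have := nmB_le1 (z * a^*); rewrite nmM nmJ.
  have : nm z * nm a <= 1 * nm a by rewrite ler_wpM2r // ltW.
  lra.
have d2 : (1 - nm a) ^+ 2 <= nm (1 - z * a^*) ^+ 2.
  by rewrite ler_pXn2r // ?nnegrE; lra.
suff h : M^-1 <= nm (bl a z).
  by rewrite -(ler_pM2l Mi) mulrA mulVf ?mul1r ?mulr1 // gt_eqF //; lra.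
rewrite -(@ler_pXn2r _ 2) ?nnegrE ?nm_ge0 ?(ltW Mi) // nm_bl expr_div_n.
rewrite ler_pdivlMr ?exprn_gt0 //.
have := mobius_id z a.
set N := nm (1 - z * a^*) ^+ 2 in d2 *; set D := nm (z - a) ^+ 2.
have h1 : (1 - nm z ^+ 2) * (1 - nm a ^+ 2) <= k.
  have h2 : 1 - nm a ^+ 2 <= 1 by rewrite gerBl exprn_ge0.
  have h3 : 0 <= 1 - nm z ^+ 2 by rewrite subr_ge0 expr_le1 ?nm_ge0 // ltW.
  have h4 : 1 - nm z ^+ 2 <= k by nra.
  by apply: le_trans (_ : (1 - nm z ^+ 2) * 1 <= _); [rewrite ler_wpM2l|rewrite mulr1].
have h5 : k <= (1 - M^-1 ^+ 2) * N.
  by rewrite ler_wpM2l // subr_ge0 expr_le1 // ltW.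
by move=> h6; rewrite mulrBl mul1r in h5; lra.
Qed.

(* phi * stepg f z1 = f - f z1 says that phi is the Schur transform of f at z1, with
   all denominators cleared. *)
Definition stepg f z1 x := (1 - f x * (f z1)^*) * bl z1 x.

(** The first term is the rank-one part of the kernel carried by the node [z1]; the Schur complement
    left over is the kernel of the Schur transform, weighted by [stepg]. *)
Lemma schur_step f phi z1 z w : nm z1 < 1 -> nm z < 1 -> nm w < 1 ->
  1 - f z1 * (f z1)^* != 0 ->
  phi z * stepg f z1 z = f z - f z1 -> phi w * stepg f z1 w = f w - f z1 ->
  ker f z w = (ker f z1 z1)^-1 * (ker f z z1 * (ker f w z1)^*) +
    (1 - f z1 * (f z1)^*)^-1 * (stepg f z1 z * (stepg f z1 w)^* * ker phi z w).
Proof.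
move=> z1D zD wD n1 hz hw.
have -> : stepg f z1 z * (stepg f z1 w)^* * ker phi z w =
  (stepg f z1 z * (stepg f z1 w)^* - (f z - f z1) * (f w - f z1)^*) / (1 - z * w^*).
  by rewrite -hz -hw [(phi w * _)^*]rmorphM /= /ker; ring.
have a1 := nm_lt1_neq0 zD wD; have a2 := nm_lt1_neq0 zD z1D.
have a3 := nm_lt1_neq0 z1D wD; have a4 := nm_lt1_neq0 z1D z1D.
rewrite -(kerC f w z1) /ker /stepg /bl !rmorphM !fmorphV !rmorphB !rmorphM /= !rmorph1 !conjCK.
rewrite [w^* * z1]mulrC.
by field; rewrite a1 a2 a3 a4 n1.
Qed.

Lemma schur_step_bf f phi z1 l m : nm z1 < 1 ->
  1 - f z1 * (f z1)^* != 0 ->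
  (forall z, z \in pts l -> nm z < 1 /\ phi z * stepg f z1 z = f z - f z1) ->
  (forall z, z \in pts m -> nm z < 1 /\ phi z * stepg f z1 z = f z - f z1) ->
  bf (ker f) l m = (ker f z1 z1)^-1 *
      ((\sum_(p <- l) p.1 * ker f p.2 z1) * (\sum_(p <- m) p.1 * ker f p.2 z1)^*)
    + (1 - f z1 * (f z1)^*)^-1 * bf (ker phi) (tw (stepg f z1) l) (tw (stepg f z1) m).
Proof.
move=> z1D n1 hl hm; rewrite bf_tw -(bf_rank1 (fun x => ker f x z1)) -!bf_scale -bf_add.
apply: bf_ext => z w zl wm; have [zD hz] := hl z zl; have [wD hw] := hm w wm.
exact: schur_step.
Qed.

Definition mv (tau : C -> C) l : seq (C * C) := [seq (p.1, tau p.2) | p <- l].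

(** Both the points and the function may vary: [schur_psd] varies the function, [hindmarsh] and
    [NS_closure] vary the points. *)
Lemma tends_bf (T : Type) (P : R -> T -> Prop) (tau f : T -> C -> C) S l m :
  (forall z, z \in pts l ++ pts m -> [/\ nm z < 1, tends P (fun t => tau t z) z &
     tends P (fun t => f t (tau t z)) (S z)]) ->
  tends P (fun t => bf (ker (f t)) (mv (tau t) l) (mv (tau t) m)) (bf (ker S) l m).
Proof.
move=> h.
apply: (@tends_ext _ _ _ (fun t => \sum_(p <- l) \sum_(q <- m)
   p.1 * q.1^* * ker (f t) (tau t p.2) (tau t q.2))).
  move=> t; rewrite /bf big_map; apply: eq_bigr => p _.
  by rewrite big_map.
apply: tends_sum => p pl; apply: tends_sum => q qm.
have [pD p1 p2] : [/\ nm p.2 < 1, tends P (fun t => tau t p.2) p.2 &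
     tends P (fun t => f t (tau t p.2)) (S p.2)].
  by apply: h; rewrite mem_cat map_f.
have [qD q1 q2] : [/\ nm q.2 < 1, tends P (fun t => tau t q.2) q.2 &
     tends P (fun t => f t (tau t q.2)) (S q.2)].
  by apply: h; rewrite mem_cat (map_f _ qm) orbT.
by apply: tendsM; [apply: tends_cst|apply: tends_ker].
Qed.

Lemma mv_id l : mv id l = l.
Proof. by rewrite /mv -[RHS]map_id; apply: eq_map => -[]. Qed.

Lemma bf_filter0 K (A : pred C) l m : (forall p, p \in l -> ~~ A p.2 -> p.1 = 0) ->
  bf K l m = bf K [seq p <- l | A p.2] m.
Proof.
move=> h; rewrite /bf [in RHS]big_filter [RHS]big_mkcond big_seq [RHS]big_seq /=.
apply: eq_bigr => p pl; case: ifP => // /negbT /(h p pl) ->.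
by rewrite big1 // => q _; rewrite !mul0r.
Qed.

Lemma cont_eq_off S phi z z1 : z != z1 -> nm z < 1 ->
  (forall w, nm w < 1 -> w != z1 -> S w = phi w) ->
  exists d : R, 0 < d /\ forall w, nm w < 1 -> nm (w - z) < d -> S w = phi w.
Proof.
move=> zz zD h; exists (nm (z - z1)); split; first by rewrite nm_gt0 subr_eq0.
move=> w wD hw; apply: h => //; apply: contraTneq hw => ->.
by rewrite nmBC ltxx.
Qed.

(* Schur's algorithm at z1; the class of functions with finitely many points of
   mere continuity is stable under it. *)
Lemma schur_quotient (E : seq C) S z1 : class_fun E S ->
  (forall z, nm z < 1 -> nm (S z) < 1) -> nm z1 < 1 -> z1 \notin E ->
  exists phi, [/\ class_fun (z1 :: E) phi,
    forall z, nm z < 1 -> nm (phi z) <= 1 &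
    forall z, nm z < 1 -> phi z * stepg S z1 z = S z - S z1].
Proof.
move=> cS S1 z1D z1E.
have [cz1 dz1] := cS z1 z1D; have [Phi cPhi hPhi] := dz1 z1E.
pose phi x := Phi x * (1 - x * z1^*) / (1 - S x * (S z1)^*).
have den z : nm z < 1 -> 1 - S z * (S z1)^* != 0 by move=> zD; apply: nm_lt1_neq0; apply: S1.
have hphi z : nm z < 1 -> phi z * stepg S z1 z = S z - S z1.
  move=> zD; rewrite hPhi // /phi /stepg /bl.
  by field; rewrite den // nm_lt1_neq0.
have Phi_off w : nm w < 1 -> w != z1 -> Phi w = (S w - S z1) / (w - z1).
  by move=> wD wz; rewrite hPhi // mulfK // subr_eq0.
have cl : class_fun (z1 :: E) phi.
  move=> z zD; have [cSz dSz] := cS z zD.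
  have dden : z \notin E -> diff_at (fun x => (1 - S x * (S z1)^*)^-1) z.
    move=> zE; apply: diffV; first exact: den.
    by apply: diffB; [apply: diff_cst|apply: diffM; [apply: dSz|apply: diff_cst]].
  have cden : cont_at (fun x => (1 - S x * (S z1)^*)^-1) z.
    apply: contV; first exact: den.
    by apply: contB; [apply: cont_cst|apply: contM => //; apply: cont_cst].
  have dlin : diff_at (fun x => 1 - x * z1^*) z.
    by apply: diffB; [apply: diff_cst|apply: diffM; [apply: diff_id|apply: diff_cst]].
  have dz : z != z1 -> diff_at (fun w => (w - z1)^-1) z.
    move=> zz; apply: diffV; first by rewrite subr_eq0.
    by apply: diffB; [apply: diff_id|apply: diff_cst].
  split.
    apply: contM => //; apply: contM; last exact: diff_cont.
    have [->//|zz] := eqVneq z z1.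
    have [d [d0 hd]] := cont_eq_off zz zD Phi_off.
    apply: (cont_ext d0 zD hd); apply: contM; last exact/diff_cont/dz.
    by apply: contB => //; apply: cont_cst.
  rewrite inE negb_or => /andP[zz zE].
  apply: diffM; last exact: dden.
  apply: diffM => //; have [d [d0 hd]] := cont_eq_off zz zD Phi_off.
  apply: (diff_ext d0 zD hd); apply: diffM; last exact: dz.
  by apply: diffB; [apply: dSz|apply: diff_cst].
exists phi; split=> // z zD; apply/ler_addgt0Pr => e e0.
have M1 : 1 < 1 + e by lra.
have [r0 [r00 r01 hr]] := bl_boundary z1D M1.
apply: (class_max_principle r00 r01 _ cl _ zD); first by lra.
move=> w w0 wD; have h2 := hr w w0 wD.
have h1 : nm (phi w) * (nm (1 - S w * (S z1)^*) * nm (bl z1 w)) = nm (S w - S z1).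
  by rewrite -!nmM -(hphi w wD).
have h3 := mobius_le (ltW (S1 w wD)) (ltW (S1 z1 z1D)); rewrite -h1 in h3.
have p1 : 0 < nm (1 - S w * (S z1)^*) by rewrite nm_gt0 den.
have h4 : nm (phi w) * nm (bl z1 w) <= 1.
  by rewrite -(ler_pM2l p1) mulr1 mulrCA.
have p2 : 0 < nm (bl z1 w).
  by rewrite lt_neqAle nm_ge0 andbT eq_sym; apply: contraTneq h2 => ->; rewrite mulr0 ler10.
by rewrite -(ler_pM2r p2); apply: le_trans h4 _.
Qed.

(** Induction on a list [s] containing the points of [l], for all [E] and [S] at once: each Schur
    step splits off a nonnegative rank-one form and uses up one point. *)
Lemma schur_psd (E : seq C) S l : class_fun E S ->
  (forall z, nm z < 1 -> nm (S z) <= 1) ->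
  (forall z, z \in pts l -> nm z < 1 /\ z \notin E) -> 0 <= bf (ker S) l l.
Proof.
move: (pts l) {-2}l (fun z => id : z \in pts l -> z \in pts l) => s {}l.
elim: s E S l => [|z1 s IH] E S l sub cS S1 lD.
  by case: l sub lD => [_ _|p l /(_ p.2)]; [rewrite /bf big_nil|rewrite inE eqxx => /(_ isT)].
have [z1l|z1l] := boolP (z1 \in pts l); last first.
  apply: (IH E S l) => // z zl; have := sub z zl; rewrite inE.
  by case: eqP zl z1l => [-> ->|].
have [z1D z1E] := lD z1 z1l.
(* [schur_quotient] wants values strictly inside the disk; scale by [r < 1] and let [r] tend to
   1. *)
pose Sr (r : R) z := ((r%:C)%C : C) * S z.
suff key r : 0 < r -> r < 1 -> 0 <= bf (ker (Sr r)) l l.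
  pose P d (r : R) := [/\ 0 < r, r < 1 & 1 - d < r].
  apply: (@tends_ge0 _ _ P (fun r => bf (ker (Sr r)) l l)).
    have := @tends_bf _ P (fun _ => id) Sr S l l; rewrite mv_id; apply.
    move=> z; rewrite mem_cat orbb => zl; have [zD _] := lD z zl.
    split=> //; first exact: tends_cst.
    rewrite /Sr -[S z in X in tends _ _ X]mul1r; apply: tendsM; last exact: tends_cst.
    move=> e e0; exists e; split=> // d' d'0 d'e r [r0 r1 hr].
    have -> : ((r%:C)%C : C) - 1 = ((r - 1)%:C)%C by rewrite rmorphB rmorph1.
    rewrite nm_real ler_norml.
    by apply/andP; split; lra.
  move=> d d0; have [d1|d1] := leP 1 d.
    by exists (2^-1); [split; lra|apply: key; lra].
  by exists (1 - d / 2); [split; lra|apply: key; lra].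
move=> r0 r1.
have cSr : class_fun E (Sr r).
  move=> z zD; have [c d] := cS z zD; split.
    by apply: contM => //; apply: cont_cst.
  by move=> /d dz; apply: diffM => //; apply: diff_cst.
have Sr1 z : nm z < 1 -> nm (Sr r z) < 1.
  move=> /S1 h; rewrite nmM nm_real ger0_norm ?ltW //; have := nm_ge0 (S z); nra.
have [phi [cphi phi1 hphi]] := schur_quotient cSr Sr1 z1D z1E.
have n1 := nm_lt1_neq0 (Sr1 _ z1D) (Sr1 _ z1D).
rewrite (schur_step_bf z1D n1 (phi := phi)); first last.
- by move=> z /lD[zD _]; split=> //; apply: hphi.
- by move=> z /lD[zD _]; split=> //; apply: hphi.
have nn x : nm x < 1 -> 0 < 1 - x * x^*.
  move=> xD; rewrite subr_gt0 mulJ_nm -[1]/((1%:C)%C) ltcR expr_lt1 ?nm_ge0 //.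
apply: addr_ge0.
  apply: mulr_ge0; last by rewrite mul_conjC_ge0.
  by rewrite invr_ge0 /ker divr_ge0 // ltW // nn // Sr1.
apply: mulr_ge0; first by rewrite invr_ge0 ltW // nn // Sr1.
set l' := tw _ _.
have h0 p : p \in l' -> ~~ (p.2 != z1) -> p.1 = 0.
  move=> /mapP[q ql ->] /=; rewrite negbK => /eqP ->.
  by rewrite /stepg /bl subrr !mul0r !mulr0.
have hf : bf (ker phi) l' l' =
   bf (ker phi) [seq p <- l' | p.2 != z1] [seq p <- l' | p.2 != z1].
  rewrite (bf_filter0 _ (A := fun x => x != z1)) //.
  rewrite [LHS](bf_conj _ _ (kerC phi)) (bf_filter0 _ (A := fun x => x != z1)) //.
  by rewrite -(bf_conj _ _ (kerC phi)).
have mem z : z \in pts [seq p <- l' | p.2 != z1] -> z != z1 /\ z \in pts l.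
  move=> /mapP[p]; rewrite mem_filter => /andP[pz pl] ->; split=> //.
  by rewrite -(mem_pts_tw (stepg (Sr r) z1)) map_f.
rewrite hf; apply: (IH (z1 :: E)) => //.
  by move=> z /mem[zz /sub]; rewrite inE (negbTE zz).
by move=> z /mem[zz /lD[zD zE]]; split=> //; rewrite inE negb_or zz.
Qed.

End SchurAlgorithm.

(** * Hindmarsh's theorem *)

Section Hindmarsh.
Variable R : realType.
Local Notation C := R[i].
Implicit Types (K : C -> C -> C) (f g S phi : C -> C) (a z w x y : C).
Implicit Types X Y : set C.

(** The form in which discreteness of the complement is used: every point of the disk, removed or
    not, has a punctured neighbourhood inside [X]. *)
Definition codisc X := (forall z, X z -> nm z < 1) /\
  forall a, nm a < 1 -> exists r : R, 0 < r /\ forall w, w != a -> nm (w - a) < r -> X w.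

Definition psdn n X g := forall l, (size l <= n)%N -> (forall z, z \in pts l -> X z) ->
  0 <= bf (ker g) l l.

Lemma normc_le1 z : (`|z| <= 1) = (nm z <= 1).
Proof. by rewrite nmE -(lecR (nm z) 1). Qed.

Lemma discrete_codisc (L : set C) : discrete_set L ->
  codisc [set z | nm z < 1 /\ ~ L z].
Proof.
move=> [_ _ hL]; split=> [z []//|a aD].
apply: contrapT => hn; apply: (hL a (iffRL (inDE a) aD)) => r r0.
apply: contrapT => hw; apply: hn.
exists (Num.min r (1 - nm a)); split; first by rewrite lt_min r0 subr_gt0.
move=> w wa; rewrite lt_min => /andP[h1 h2]; split.
  have := nmD (w - a) a; rewrite subrK; lra.
by move=> Lw; apply: hw; exists w; rewrite wa nmE ltcR.
Qed.

Lemma codisc_disc : codisc [set z : C | nm z < 1].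
Proof.
split=> // a aD; exists (1 - nm a); split; first by rewrite subr_gt0.
move=> w _ h /=; have := nmD (w - a) a; rewrite subrK; lra.
Qed.

Lemma codisc_remove X (E : seq C) : codisc X -> codisc [set z | X z /\ z \notin E].
Proof.
move=> [XD hX]; split=> [z [/XD]//|a aD].
elim: E => [|b E [r [r0 hr]]].
  by have [r [r0 hr]] := hX a aD; exists r; split=> // w wa wr; split=> //; apply: hr.
have [->|ba] := eqVneq b a.
  exists r; split=> // w wa wr; have [Xw wE] := hr w wa wr.
  by split=> //; rewrite inE negb_or wa.
have b0 : 0 < nm (b - a) by rewrite nm_gt0 subr_eq0.
exists (Num.min r (nm (b - a))); split; first by rewrite lt_min r0.
move=> w wa; rewrite lt_min => /andP[w1 w2]; have [Xw wE] := hr w wa w1.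
by split=> //; rewrite inE negb_or wE andbT; apply: contraTneq w2 => ->; rewrite ltxx.
Qed.

Lemma codisc_near X a (d : R) : codisc X -> nm a < 1 -> 0 < d ->
  exists w, [/\ X w, w != a & nm (w - a) < d].
Proof.
move=> [_ hX] aD d0; have [r [r0 hr]] := hX a aD.
have [|w [_ h1]] := @near_avoid R [::] a (Num.min d r) _ aD; first by rewrite lt_min d0.
rewrite inE; move: h1; rewrite lt_min => /andP[h1 h2] wa.
by exists w; split=> //; apply: hr.
Qed.

Lemma bf2 K (p q : C * C) : bf K [:: p; q] [:: p; q] =
  p.1 * p.1^* * K p.2 p.2 + p.1 * q.1^* * K p.2 q.2 +
  q.1 * p.1^* * K q.2 p.2 + q.1 * q.1^* * K q.2 q.2.
Proof. by rewrite /bf !big_cons !big_nil; ring. Qed.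

Lemma ker_diag f z : ker f z z = (((1 - nm (f z) ^+ 2) / (1 - nm z ^+ 2))%:C)%C.
Proof. by rewrite /ker !mulJ_nm [RHS]rmorphM fmorphV !rmorphB /= rmorph1. Qed.

Lemma psdn_le1 n X g z : psdn n.+1 X g -> X z -> nm z < 1 -> nm (g z) <= 1.
Proof.
move=> h Xz zD; have := h [:: (1, z)].
rewrite /bf !big_seq1 /= rmorph1 !mul1r => -/(_ isT) H.
have : 0 <= ker g z z by apply: H => w; rewrite inE => /eqP ->.
rewrite ker_diag ler0c pmulr_lge0 ?invr_gt0; last first.
  by rewrite subr_gt0 expr_lt1 // nm_ge0.
by rewrite subr_ge0 expr_le1 // nm_ge0.
Qed.

Lemma psdn_det n X g x y : psdn n.+2 X g -> X x -> X y -> nm x < 1 -> nm y < 1 ->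
  ker g x y * (ker g x y)^* <= ker g x x * ker g y y.
Proof.
move=> h Xx Xy xD yD.
have diag z : X z -> nm z < 1 -> 0 <= ker g z z.
  move=> Xz zD; rewrite ker_diag ler0c divr_ge0 // subr_ge0 expr_le1 ?nm_ge0 //.
    exact: psdn_le1 h Xz zD.
  exact: ltW.
apply: cauchy_schwarz_numbers; [exact: diag|exact: diag|].
move=> a b; have := h [:: (a, x); (b, y)] isT; rewrite bf2 /= -(kerC g x y); apply.
by move=> z; rewrite !inE => /orP[] /eqP ->.
Qed.

(** [mobius_id] turns the two-point determinant into the Schwarz-Pick inequality; with denominators
    cleared it covers unimodular values too. *)
Lemma schwarz_pick n X g x y : psdn n.+2 X g -> X x -> X y -> nm x < 1 -> nm y < 1 ->
  nm (g y - g x) * nm (1 - y * x^*) <= nm (1 - g y * (g x)^*) * nm (y - x).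
Proof.
move=> h Xx Xy xD yD; have := psdn_det h Xy Xx yD xD.
rewrite mulJ_nm !ker_diag -rmorphM lecR /= /ker nmM nmV.
have N := mobius_id (g y) (g x); have D := mobius_id y x.
have dp : 0 < (1 - nm y ^+ 2) * (1 - nm x ^+ 2).
  by rewrite mulr_gt0 // subr_gt0 expr_lt1 // nm_ge0.
have np : 0 < nm (1 - y * x^*) by apply: den_gt0.
rewrite mulf_div -N -D expr_div_n ler_pdivrMr ?exprn_gt0 //.
rewrite mulrAC ler_pdivlMr ?D // -D => h1.
rewrite -(@ler_pXn2r _ 2) ?nnegrE ?mulr_ge0 ?nm_ge0 // !exprMn.
by move: h1; nra.
Qed.

Lemma schwarz_lip n X g x y : psdn n.+2 X g -> X x -> X y -> nm x < 1 -> nm y < 1 ->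
  nm (g y - g x) * (1 - nm x) <= 2 * nm (y - x).
Proof.
move=> h Xx Xy xD yD; have k := schwarz_pick h Xx Xy xD yD.
have gx := psdn_le1 h Xx xD; have gy := psdn_le1 h Xy yD.
apply: le_trans (_ : nm (g y - g x) * nm (1 - y * x^*) <= _).
  rewrite ler_wpM2l ?nm_ge0 //; have := nmB_le1 (y * x^*); rewrite nmM nmJ.
  by have := nm_ge0 x; nra.
apply: le_trans k _; rewrite ler_wpM2r ?nm_ge0 //.
apply: le_trans (nmB _ _) _; rewrite nm1 nmM nmJ.
by have := nm_ge0 (g x); have := nm_ge0 (g y); nra.
Qed.

Lemma lip_limit Y phi a : nm a < 1 -> (forall z, Y z -> nm z < 1) ->
  (forall d : R, 0 < d -> exists w, [/\ Y w & nm (w - a) < d]) ->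
  (forall x y, Y x -> Y y -> nm (phi y - phi x) * (1 - nm x) <= 2 * nm (y - x)) ->
  exists l, forall e : R, 0 < e -> exists d : R, 0 < d /\ forall w, Y w ->
     nm (w - a) < d -> nm (phi w - l) <= e.
Proof.
move=> aD YD acc lip; apply: cauchy_limit_at => // e e0.
pose d := Num.min ((1 - nm a) / 2) (e * (1 - nm a) / 8).
have d0 : 0 < d.
  by rewrite lt_min !divr_gt0 ?subr_gt0 // ?mulr_gt0 ?subr_gt0.
exists d; split=> // w v Yw Yv; rewrite !lt_min => /andP[w1 w2] /andP[v1 v2].
have k1 := lip v w Yv Yw.
have k2 : (1 - nm a) / 2 <= 1 - nm v by have := nmD (v - a) a; rewrite subrK; lra.
have k3 : nm (w - v) <= e * (1 - nm a) / 4.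
  by apply: le_trans (nm_triang _ a _) _; rewrite [X in _ + X]nmBC; lra.
have p : 0 < (1 - nm a) / 2 by rewrite divr_gt0 // subr_gt0.
rewrite -(ler_pM2r p).
apply: le_trans (_ : nm (phi w - phi v) * (1 - nm v) <= _).
  by rewrite ler_wpM2l ?nm_ge0.
by lra.
Qed.

(* A 3-point condition on S is a 2-point condition on its Schur transform at z1, which is
   therefore Lipschitz near z1: this is the differentiability of S at z1. *)
Lemma hindmarsh_disc S : psdn 3 [set z | nm z < 1] S -> schur S.
Proof.
move=> h; have S1 z : nm z < 1 -> nm (S z) <= 1 by move=> zD; apply: (psdn_le1 h).
split; last by move=> z /inDE /S1; rewrite normc_le1.
apply/analytic_diff => z1 z1D.
(* At modulus one the diagonal entry vanishes, so Cauchy-Schwarz kills [ker S w z1] for all [w], and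
   [S] is constant. *)
have [e1|n1] := eqVneq (nm (S z1)) 1.
  apply: (@diff_ext _ _ (fun=> S z1) _ 1) => //; last exact: diff_cst.
  move=> w wD _; have := schwarz_pick h z1D wD z1D wD.
  have := psdn_det h wD z1D wD z1D.
  rewrite [ker S z1 z1]ker_diag e1 expr1n subrr mul0r mulr0 => k _.
  have : ker S w z1 * (ker S w z1)^* == 0 by rewrite eq_le k mul_conjC_ge0.
  rewrite mul_conjC_eq0 mulf_eq0 invr_eq0 (negbTE (nm_lt1_neq0 wD z1D)) orbF.
  rewrite subr_eq0 => /eqP k1.
  have k2 : S z1 * (S z1)^* = 1 by rewrite mulJ_nm e1 expr1n.
  have n0 : (S z1)^* != 0 by apply: contra_eq_neq k2 => ->; rewrite mulr0 eq_sym oner_eq0.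
  by apply: (mulIf n0); rewrite k2.
have sz1 : nm (S z1) < 1 by rewrite lt_neqAle n1 S1.
have den z : nm z < 1 -> 1 - S z * (S z1)^* != 0.
  move=> zD; rewrite subr_eq0; apply/eqP => /(congr1 (@nm R)); rewrite nm1 nmM nmJ.
  by have := S1 z zD; have := nm_ge0 (S z); have := nm_ge0 (S z1); nra.
have d1 : 1 - S z1 * (S z1)^* != 0 by apply: den.
have lip x y : nm x < 1 -> nm y < 1 -> nm (S y - S x) * (1 - nm x) <= 2 * nm (y - x).
  by move=> xD yD; apply: (schwarz_lip h).
have cS : cont_at S z1.
  move=> e e0; exists (e * (1 - nm z1) / 2); split.
    by rewrite divr_gt0 // mulr_gt0 // subr_gt0.
  move=> w wD hw; have := lip z1 w z1D wD => k.
  have p : 0 < 1 - nm z1 by rewrite subr_gt0.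
  by rewrite -(ler_pM2r p); lra.
pose phi z := (S z - S z1) / stepg S z1 z.
pose Y := [set z : C | nm z < 1 /\ z != z1].
have g0 z : Y z -> stepg S z1 z != 0.
  by move=> [zD zz]; rewrite mulf_neq0 ?den // bl_eq0.
have K1 : 0 < ker S z1 z1.
  rewrite ker_diag -[0]/((0%:C)%C) ltcR divr_gt0 // subr_gt0 expr_lt1 ?nm_ge0 //.
have h2 : psdn 2 Y phi.
  move=> l sl lY.
  pose l1 := tw (fun z => (stepg S z1 z)^-1) l.
  (* This weight at [z1] makes the combination orthogonal to the node, so the rank-one term of
     [schur_step_bf] disappears. *)
  pose c := - (\sum_(p <- l1) p.1 * ker S p.2 z1) / ker S z1 z1.
  pose l2 := (c, z1) :: l1.
  have l2D z : z \in pts l2 -> nm z < 1.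
    by rewrite inE => /orP[/eqP->//|]; rewrite mem_pts_tw => /lY[].
  have : 0 <= bf (ker S) l2 l2.
    by apply: h => //; rewrite /= size_map ltnS.
  have hphi z : z \in pts l2 -> nm z < 1 /\ phi z * stepg S z1 z = S z - S z1.
    rewrite inE => /orP[/eqP->|].
      by split=> //; rewrite /stepg /bl !subrr !mul0r !mulr0.
    by rewrite mem_pts_tw => /lY Yz; split; [case: Yz|rewrite divfK // g0].
  rewrite (schur_step_bf z1D d1 hphi hphi).
  have -> : \sum_(p <- l2) p.1 * ker S p.2 z1 = 0.
    by rewrite big_cons /= /c divfK ?addNr // gt_eqF.
  rewrite mul0r mulr0 add0r pmulr_rge0; last first.
    by rewrite invr_gt0 mulJ_nm subr_gt0 -[1]/((1%:C)%C) ltcR expr_lt1 ?nm_ge0.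
  suff -> : bf (ker phi) (tw (stepg S z1) l2) (tw (stepg S z1) l2) = bf (ker phi) l l by [].
  have t0 : stepg S z1 z1 = 0 by rewrite /stepg /bl subrr mul0r mulr0.
  have el : tw (stepg S z1) l1 = l.
    rewrite /tw -map_comp -[RHS]map_id; apply/eq_in_map => -[al z] hz /=.
    by rewrite divfK // g0 //; apply: lY; apply: (map_f snd hz).
  rewrite [tw _ l2]/= -/(tw _ l1) el t0 mulr0 -cat1s bf_catl !bf_catr.
  have z0 m : bf (ker phi) [:: (0, z1)] m = 0.
    by rewrite /bf big_seq1 big1 // => q _; rewrite !mul0r.
  by rewrite !z0 (bf_conj _ _ (kerC phi)) z0 rmorph0 !add0r.
have [l hl] : exists l, forall e : R, 0 < e -> exists d : R, 0 < d /\ forall w, Y w ->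
     nm (w - z1) < d -> nm (phi w - l) <= e.
  apply: lip_limit => //; first by move=> z [].
    move=> d d0; have [w [w1 w2 w3]] := near_avoid [::] d0 z1D.
    by exists w; split=> //; split=> //; rewrite inE in w3.
  by move=> x y Yx Yy; apply: (schwarz_lip h2) => //; [case: Yx|case: Yy].
pose ph w := if w == z1 then l else phi w.
have cph : cont_at ph z1.
  move=> e e0; have [d [d0 hd]] := hl e e0; exists d; split=> // w wD wd.
  rewrite /ph eqxx; have [_|wz] := eqVneq w z1; first by rewrite subrr nm0 ltW.
  exact: hd.
exists (fun w => ph w * (1 - S w * (S z1)^*) / (1 - w * z1^*)).
  apply: contM.
    apply: contM => //; apply: contB; first exact: cont_cst.
    by apply: contM => //; apply: cont_cst.
  apply: contV; first exact: nm_lt1_neq0.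
  apply: contB; first exact: cont_cst.
  by apply: contM; [apply: cont_id|apply: cont_cst].
move=> w wD; have [->|wz] := eqVneq w z1; first by rewrite !subrr mulr0.
rewrite /ph (negbTE wz) /phi /stepg /bl.
by field; rewrite den // nm_lt1_neq0 //= subr_eq0 wz.
Qed.

(** Two-point positivity makes [g] locally Lipschitz, so it extends continuously to the disk;
    three-point positivity passes to the limit, and the disk case applies. *)
Lemma hindmarsh X g : codisc X -> psdn 3 X g ->
  exists S, schur S /\ forall z, X z -> S z = g z.
Proof.
move=> cX h; have [XD _] := cX.
have lim a : nm a < 1 -> exists l, forall e : R, 0 < e -> exists d : R, 0 < d /\
    forall w, X w -> nm (w - a) < d -> nm (g w - l) <= e.
  move=> aD; apply: lip_limit => //.
    by move=> d d0; have [w [? ? ?]] := codisc_near cX aD d0; exists w.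
  by move=> x y Xx Xy; apply: (schwarz_lip h) => //; apply: XD.
have /choice[S hS] : forall a, exists l, nm a < 1 -> forall e : R, 0 < e ->
    exists d : R, 0 < d /\ forall w, X w -> nm (w - a) < d -> nm (g w - l) <= e.
  move=> a; have [aD|aD] := boolP (nm a < 1); last by exists 0.
  by have [l hl] := lim a aD; exists l.
exists S; split; last first.
  move=> z Xz; apply/eqP; rewrite eq_sym -subr_eq0 -nm_eq0 eq_le nm_ge0 andbT.
  apply/ler_addgt0Pr => e e0; rewrite add0r.
  have [d [d0 hd]] := hS z (XD z Xz) e e0.
  by apply: hd => //; rewrite subrr nm0.
apply: hindmarsh_disc => l sl lD.
pose P (d : R) (tau : C -> C) := forall z, nm z < 1 ->
  [/\ X (tau z), nm (tau z - z) <= d & nm (g (tau z) - S z) <= d].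
apply: (@tends_ge0 _ _ P (fun tau => bf (ker g) (mv tau l) (mv tau l))).
  apply: (@tends_bf _ _ P (fun tau => tau) (fun _ => g) S).
  move=> z; rewrite mem_cat orbb => /lD zD; split=> //.
    move=> e e0; exists e; split=> // d d0 de tau /(_ z zD)[_ k _].
    exact: le_trans k de.
  move=> e e0; exists e; split=> // d d0 de tau /(_ z zD)[_ _ k].
  exact: le_trans k de.
move=> d d0.
have /choice[tau htau] : forall z, exists x, nm z < 1 ->
    [/\ X x, nm (x - z) <= d & nm (g x - S z) <= d].
  move=> z; have [zD|zD] := boolP (nm z < 1); last by exists 0.
  have [d' [d'0 hd']] := hS z zD d d0.
  have [|w [Xw _]] := @codisc_near X z (Num.min d d') cX zD; first by rewrite lt_min d0.
  rewrite lt_min => /andP[w1 w2]; exists w; split=> //; first exact: ltW.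
  exact: hd'.
exists tau => //; apply: h; first by rewrite size_map.
move=> z /mapP[p /mapP[q ql ->] ->] /=.
by have [] := htau q.2 (lD _ (map_f snd ql)).
Qed.

Lemma schur_ker_ge0 S l : schur S -> (forall z, z \in pts l -> nm z < 1) ->
  0 <= bf (ker S) l l.
Proof.
move=> [aS bS] lD; apply: (@schur_psd _ [::]).
- by move=> z zD; have d := (analytic_diff S).1 aS z zD; split=> [|_//]; apply: diff_cont.
- by move=> z /inDE /bS; rewrite normc_le1.
by move=> z /lD.
Qed.

(** Positivity off [E] yields a Schur function through Hindmarsh's theorem, and continuity
    identifies it with [S] on [E] as well. *)
Lemma class_schur (E : seq C) S : class_fun E S ->
  (forall z, nm z < 1 -> nm (S z) <= 1) -> schur S.
Proof.
move=> cS S1; pose X := [set z : C | nm z < 1 /\ z \notin E].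
have cX : codisc X := codisc_remove E codisc_disc.
have hX : psdn 3 X S by move=> l _ lX; apply: schur_psd cS S1 lX.
have [S' [[aS' bS'] eS']] := hindmarsh cX hX.
have aS'd := (analytic_diff S').1 aS'.
have eqS z : nm z < 1 -> S z = S' z.
  move=> zD; apply/eqP; rewrite -subr_eq0 -nm_eq0 eq_le nm_ge0 andbT.
  apply/ler_addgt0Pr => e e0; rewrite add0r.
  have cc : cont_at (fun w => S w - S' w) z.
    by apply: contB; [have [] := cS z zD|apply: diff_cont; apply: aS'd].
  have [d [d0 hd]] := cc e e0; have [w [Xw _ wz]] := codisc_near cX zD d0.
  have := hd w (proj1 Xw) wz; rewrite (eS' w Xw) subrr sub0r nmN.
  by [].
split; last by move=> z /inDE /S1; rewrite normc_le1.
apply/analytic_diff => z zD; apply: (@diff_ext _ _ S' _ 1) => //; last exact: aS'd.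
by move=> w wD _; apply: eqS.
Qed.

End Hindmarsh.

(** * Negative squares *)

Section NegativeSquares.
Variable R : realType.
Local Notation C := R[i].
Local Open Scope sesquilinear_scope.

Definition hq n (M : 'M[C]_n) (c : 'rV[C]_n) : C :=
  \sum_i \sum_j c 0 i * (c 0 j)^* * M i j.

Definition negdef n (M : 'M[C]_n) := forall c : 'rV[C]_n, c != 0 -> hq M c < 0.

Definition herm n (M : 'M[C]_n) := forall i j, M j i = (M i j)^*.

Lemma row_neq0 n (c : 'rV[C]_n) : c != 0 -> exists j, c 0 j != 0.
Proof.
move=> c0; apply/existsP; apply: contraNT c0 => /existsPn h.
by apply/eqP/rowP => j; rewrite mxE; apply/eqP; rewrite -[_ == _]negbK; apply: h.
Qed.

Lemma realc_lt0 (x : R) : ((x%:C)%C < 0 :> C) = (x < 0).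
Proof. by rewrite -(ltcR x 0). Qed.

Lemma hqE n (M : 'M[C]_n) c : hq M c = (c *m M *m c^t*) 0 0.
Proof.
rewrite /hq mxE exchange_big /=; apply: eq_bigr => j _.
rewrite !mxE mulr_suml; apply: eq_bigr => i _; ring.
Qed.

Lemma hq_congr k n (Y : 'M[C]_(k, n)) (P : 'M[C]_n) c :
  hq (Y *m P *m Y^t*) c = hq P (c *m Y).
Proof. by rewrite !hqE trmx_mul map_mxM !mulmxA. Qed.

Lemma hq_real n (P : 'M[C]_n) c : herm P -> hq P c \is Num.real.
Proof.
move=> hP; apply/CrealP; rewrite /hq rmorph_sum exchange_big /=; apply: eq_bigr => i _.
rewrite rmorph_sum; apply: eq_bigr => j _ /=.
by rewrite !rmorphM /= conjCK (hP i j); ring.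
Qed.

Lemma hq_diag n (d : 'rV[C]_n) c : hq (diag_mx d) c = \sum_i d 0 i * (c 0 i * (c 0 i)^*).
Proof.
rewrite /hq; apply: eq_bigr => i _; rewrite (bigD1 i) //= big1 ?addr0 => [|j ji].
  by rewrite mxE eqxx mulr1n mulrC.
by rewrite mxE eq_sym (negbTE ji) mulr0n mulr0.
Qed.

Lemma roots_multE (p : {poly C}) : p = lead_coef p *: \prod_(z <- roots_mult p) ('X - z%:P).
Proof. by rewrite /roots_mult; case: closed_field_poly_normal. Qed.

Lemma roots_mult_prod (s : seq C) :
  perm_eq (roots_mult (\prod_(z <- s) ('X - z%:P))) s.
Proof.
apply: prod_XsubC_eq.
have := roots_multE (\prod_(z <- s) ('X - z%:P)).
by rewrite lead_coef_prod_XsubC scale1r => <-.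
Qed.

Lemma char_poly_similar n (B U D : 'M[C]_n) : B *m U = 1%:M ->
  char_poly (B *m D *m U) = char_poly D.
Proof.
move=> BU; have UB : U *m B = 1%:M by apply: mulmx1C.
rewrite /char_poly.
have -> : char_poly_mx (B *m D *m U) =
   map_mx polyC B *m char_poly_mx D *m map_mx polyC U.
  rewrite /char_poly_mx !map_mxM mulmxBr mulmxBl; congr (_ - _).
  by rewrite scalar_mxC -mulmxA -map_mxM BU map_mx1 mulmx1.
rewrite !det_mulmx mulrAC -det_mulmx -map_mxM BU map_mx1 det1 mul1r.
by [].
Qed.

(** The spectral theorem in the only form needed: [d] lists the eigenvalues, and of the unitary [B]
    only invertibility and preservation of lengths are recorded. *)
Lemma spectral_pack n (P : 'M[C]_n) : herm P ->
  exists (B : 'M[C]_n) (d : 'I_n -> R), [/\ B \in unitmx,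
    forall x, hq P x = ((\sum_i d i * nm ((x *m B) 0 i) ^+ 2)%:C)%C,
    forall x : 'rV[C]_n, \sum_i nm ((x *m B) 0 i) ^+ 2 = \sum_i nm (x 0 i) ^+ 2 &
    sq_minus P = #|[pred i | d i < 0]|].
Proof.
move=> hP.
have hP' : P \is hermsymmx.
  by apply/is_hermitianmxP; rewrite expr0 scale1r; apply/matrixP => i j; rewrite !mxE -hP.
have /hermitian_normalmx /orthomx_spectralP PE := hP'.
have dr := hermitian_spectral_diag_real hP'.
set U := spectralmx P in PE; set sp := spectral_diag P in PE dr.
have Uu : U \is unitarymx := spectral_unitarymx P.
rewrite invmx_unitary // in PE.
have UB : U *m U^t* = 1%:M by apply/unitarymxP.
have BU : U^t* *m U = 1%:M by apply: mulmx1C.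
pose d i := complex.Re (sp 0 i).
have dE i : sp 0 i = ((d i)%:C)%C.
  by rewrite /d RRe_real //; move/mxOverP: dr; apply.
exists (U^t*), d; split.
- by rewrite -invmx_unitary // unitmx_inv unitarymx_unit.
- move=> x; have -> : hq P x = hq (diag_mx sp) (x *m U^t*).
    rewrite -hq_congr trmxCK -PE //.
  rewrite hq_diag rmorph_sum; apply: eq_bigr => i _ /=.
  by rewrite dE mulJ_nm [RHS]rmorphM.
- move=> x; apply: complexI; rewrite !rmorph_sum /=.
  transitivity (hq 1%:M (x *m U^t*)).
    rewrite -diag_const_mx hq_diag; apply: eq_bigr => i _.
    by rewrite [const_mx _ _ _]mxE mul1r mulJ_nm.
  rewrite -hq_congr mulmx1 trmxCK BU -diag_const_mx hq_diag; apply: eq_bigr => i _.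
  by rewrite mxE mul1r mulJ_nm.
have chE : char_poly P = \prod_(z <- [seq sp 0 i | i <- enum 'I_n]) ('X - z%:P).
  rewrite PE char_poly_similar // char_poly_trig ?diag_mx_is_trig // big_map.
  by rewrite big_enum; apply: eq_bigr => i _; rewrite mxE eqxx mulr1n.
rewrite /sq_minus chE.
have /permP -> := roots_mult_prod [seq sp 0 i | i <- enum 'I_n].
rewrite count_map -size_filter cardE enumT -/(enum _).
rewrite /enum_mem size_filter size_filter; apply: eq_count => i /=.
by rewrite dE realc_lt0.
Qed.

(** A negative subspace of dimension greater than [m] would meet the kernel of [E], on which the
    form is nonnegative. *)
Lemma nonneg_codim n m k (P : 'M[C]_n) (E : 'M[C]_(n, m)) (Y : 'M[C]_(k, n)) :
  (forall x : 'rV[C]_n, x *m E = 0 -> 0 <= hq P x) -> negdef (Y *m P *m Y^t*) ->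
  (k <= m)%N.
Proof.
move=> hE hY; rewrite leqNgt; apply/negP => mk.
have : kermx (Y *m E) != 0.
  rewrite -mxrank_eq0 mxrank_ker -lt0n subn_gt0.
  exact: leq_ltn_trans (rank_leq_col _) mk.
move=> /rowV0Pn[c /sub_kermxP ck c0].
have := hY c c0; rewrite hq_congr; have := hE (c *m Y).
by rewrite -mulmxA ck => /(_ erefl) /le_lt_trans h /h; rewrite ltxx.
Qed.

Lemma sq_minus_ge n k (P : 'M[C]_n) (Y : 'M[C]_(k, n)) : herm P ->
  negdef (Y *m P *m Y^t*) -> (k <= sq_minus P)%N.
Proof.
move=> hP hY; have [B [d [_ qP _ ->]]] := spectral_pack hP.
pose A := [pred i | d i < 0].
(* Its columns are the eigencoordinates with negative eigenvalue; where they vanish, the form is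
   nonnegative. *)
pose E := colsub (fun j : 'I_#|A| => enum_val j) B.
apply: (nonneg_codim (E := E) _ hY) => x xE; rewrite qP ler0c; apply: sumr_ge0 => i _.
have [di|di] := leP 0 (d i); first by rewrite mulr_ge0 // exprn_ge0 // nm_ge0.
have iA : i \in A by [].
have -> : (x *m B) 0 i = 0.
  have /rowP /(_ (enum_rank_in iA i)) := xE; rewrite !mxE => {2}<-.
  by apply: eq_bigr => j _; rewrite mxE enum_rankK_in.
by rewrite nm0 expr0n mulr0.
Qed.

Lemma sq_minus_attained n (P : 'M[C]_n) : herm P ->
  exists Y : 'M[C]_(sq_minus P, n), negdef (Y *m P *m Y^t*).
Proof.
move=> hP; have [B [d [Bu qP _ ->]]] := spectral_pack hP.
pose A := [pred i | d i < 0].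
exists (rowsub (fun j : 'I_#|A| => enum_val j) (invmx B)) => c c0.
rewrite hq_congr qP realc_lt0.
set x := c *m _.
have xB i : (x *m B) 0 i = \sum_(j : 'I_#|A|) c 0 j * (enum_val j == i)%:R.
  rewrite /x -mulmxA mul_rowsub_mx mulVmx // mxE; apply: eq_bigr => j _.
  by rewrite !mxE.
have xBv (j : 'I_#|A|) : (x *m B) 0 (enum_val j) = c 0 j.
  rewrite xB (bigD1 j) //= eqxx mulr1 big1 ?addr0 // => l lj.
  by rewrite (inj_eq enum_val_inj) (negbTE lj) mulr0.
have le0 i : d i * nm ((x *m B) 0 i) ^+ 2 <= 0.
  have [di|di] := leP 0 (d i); last first.
    by rewrite mulr_le0_ge0 ?exprn_ge0 ?nm_ge0 // ltW.
  rewrite xB big1 ?nm0 ?expr0n ?mulr0 // => j _.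
  case: eqP => [e|_]; last by rewrite mulr0.
  by have := enum_valP j; rewrite inE e ltNge di.
have [j cj] := row_neq0 c0.
rewrite (bigD1 (enum_val j)) //= -[ltRHS]addr0 ltr_leD //; last by apply: sumr_le0.
rewrite xBv nmulr_rlt0 ?exprn_gt0 ?nm_gt0 //.
exact: (enum_valP j).
Qed.

Lemma negdef_open n (M0 : 'M[C]_n) : herm M0 -> negdef M0 ->
  exists de : R, 0 < de /\ forall M : 'M[C]_n, herm M ->
    (forall i j, nm (M i j - M0 i j) <= de) -> negdef M.
Proof.
move=> hM0 nM0; have [B [d [Bu qP Biso _]]] := spectral_pack hM0.
have dneg i : d i < 0.
  pose x : 'rV[C]_n := delta_mx 0 i *m invmx B.
  have x0 : x != 0.
    apply/eqP => /(congr1 (mulmx^~ B)); rewrite mulmxKV // mul0mx => /rowP /(_ i).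
    by rewrite !mxE !eqxx => /eqP; rewrite oner_eq0.
  have := nM0 x x0; rewrite qP mulmxKV // realc_lt0 (bigD1 i) //= big1 ?addr0.
    by rewrite mxE !eqxx nm1 expr1n mulr1.
  by move=> j ji; rewrite mxE eqxx (negbTE ji) nm0 expr0n mulr0.
have [la [la0 hla]] : exists la : R, 0 < la /\ forall i, d i <= - la.
  suff [la [la0 h]] : exists la : R, 0 < la /\ forall i, i \in enum 'I_n -> d i <= - la.
    by exists la; split=> // i; apply: h; rewrite mem_enum.
  elim: (enum _) => [|i s [la [la0 h]]]; first by exists 1; split.
  exists (Num.min la (- d i)); split; first by rewrite lt_min la0 oppr_gt0 dneg.
  move=> j; rewrite inE lerNr ge_min => /orP[/eqP ->|/h]; first by rewrite lexx orbT.
  by rewrite lerNr => ->.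
(* An entrywise error [de] changes the form by at most [de * n%:R * s], hence by at most half of the
   gap [la * s]; [n.+1] avoids dividing by zero for [n = 0]. *)
pose de := la / (2 * n.+1%:R).
have n0 : (0 : R) < n.+1%:R by rewrite ltr0n.
have de0 : 0 < de by rewrite divr_gt0 // mulr_gt0.
exists de; split=> // M hM near c c0.
pose s := \sum_i nm (c 0 i) ^+ 2.
have s0 : 0 < s.
  have [j cj] := row_neq0 c0.
  rewrite /s (bigD1 j) //= ltr_pwDl ?exprn_gt0 ?nm_gt0 //.
  by apply: sumr_ge0 => i _; rewrite exprn_ge0 // nm_ge0.
have k1 : complex.Re (hq M0 c) <= - la * s.
  rewrite qP /= /s -Biso mulr_sumr; apply: ler_sum => i _.
  by rewrite ler_wpM2r // exprn_ge0 // nm_ge0.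
have k2 : nm (hq M c - hq M0 c) <= de * (n%:R * s).
  have -> : hq M c - hq M0 c = \sum_i \sum_j c 0 i * (c 0 j)^* * (M i j - M0 i j).
    rewrite /hq -sumrB; apply: eq_bigr => i _; rewrite -sumrB; apply: eq_bigr => j _.
    by rewrite mulrBr.
  apply: le_trans (nm_sum _ _ _) _.
  apply: le_trans (_ : \sum_i \sum_(j < n) de * ((nm (c 0 i) ^+ 2 + nm (c 0 j) ^+ 2) / 2) <= _).
    apply: ler_sum => i _; apply: le_trans (nm_sum _ _ _) _; apply: ler_sum => j _.
    rewrite !nmM nmJ [de * _]mulrC; apply: ler_pM; rewrite ?mulr_ge0 ?nm_ge0 //.
    by have := sqr_ge0 (nm (c 0 i) - nm (c 0 j)); nra.
  rewrite le_eqVlt; apply/orP; left; apply/eqP.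
  under eq_bigr do rewrite -mulr_sumr -mulr_suml.
  rewrite -mulr_sumr -mulr_suml; congr (_ * _).
  under eq_bigr do rewrite big_split /= sumr_const card_ord.
  rewrite big_split /= sumrMnl sumr_const card_ord -/s -mulr_natl -mulr_natl.
  by field.
have k3 : de * (n%:R * s) <= la * s / 2.
  have nn : (n%:R : R) <= n.+1%:R by rewrite ler_nat.
  have -> : de * (n%:R * s) = la * s / 2 * (n%:R / n.+1%:R).
    rewrite /de invfM; set N := n.+1%:R^-1; ring.
  rewrite -[leRHS]mulr1 ler_wpM2l ?ler_pdivrMr ?mul1r //.
  by rewrite divr_ge0 // mulr_ge0 // ltW.
have hr := hq_real c hM.
rewrite -(RRe_real hr) realc_lt0.
have -> : hq M c = hq M0 c + (hq M c - hq M0 c) by ring.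
rewrite ReD; have := Re_le_nm (hq M c - hq M0 c).
have : 0 < la * s by rewrite mulr_gt0.
by rewrite mulNr in k1; lra.
Qed.

End NegativeSquares.

(** * Negative systems of combinations and the singular step *)

Section NegativeSystems.
Variable R : realType.
Local Notation C := R[i].
Local Open Scope sesquilinear_scope.
Implicit Types (K : C -> C -> C) (x l m : seq (C * C)) (f g : C -> C) (a z w : C).
Implicit Types X : set C.

Definition gram K k (y : 'I_k -> seq (C * C)) : 'M[C]_k := \matrix_(i, j) bf K (y i) (y j).

(** Gram matrices instead of eigenvalue counts: no enumeration of distinct nodes is fixed, so
    systems can be extended, moved and reweighted freely. *)
Definition negsys f X k := exists y : 'I_k -> seq (C * C),
  (forall i z, z \in pts (y i) -> X z) /\ negdef (gram (ker f) y).

(* NS bounds the number of negative squares of f on X; the points of a system need not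
   be distinct. *)
Definition NS f X (kappa : nat) := forall k, negsys f X k -> (k <= kappa)%N.

Lemma gram_herm f k (y : 'I_k -> seq (C * C)) : herm (gram (ker f) y).
Proof. by move=> i j; rewrite !mxE; apply: bf_conj (kerC f). Qed.

Lemma pick_herm f n (z : 'I_n -> C) : herm (pick_matrix f z).
Proof. by move=> i j; rewrite !mxE; apply: kerC. Qed.

Lemma negsys_of_sq f X n (z : 'I_n -> C) : (forall i, X (z i)) ->
  negsys f X (sq_minus (pick_matrix f z)).
Proof.
move=> Xz; have [Y nY] := sq_minus_attained (pick_herm f z).
exists (fun i => [seq (Y i j, z j) | j <- enum 'I_n]); split.
  by move=> i w /mapP[p /mapP[j _ ->] ->]; apply: Xz.
suff -> : gram (ker f) (fun i => [seq (Y i j, z j) | j <- enum 'I_n]) =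
   Y *m pick_matrix f z *m Y^t* by [].
apply/matrixP => i j; rewrite !mxE /bf big_map big_enum /=.
rewrite [RHS](eq_bigr (fun s => \sum_r Y i r * (Y j s)^* * ker f (z r) (z s))); last first.
  move=> s _; rewrite !mxE mulr_suml; apply: eq_bigr => r _.
  by rewrite ?mxE /ker; ring.
rewrite [RHS]exchange_big /=; apply: eq_bigr => r _.
by rewrite big_map big_enum.
Qed.

Definition coef l z : C := \sum_(p <- l | p.2 == z) p.1.

Lemma sum_coef l (s : seq C) (F : C -> C) : uniq s -> {subset pts l <= s} ->
  \sum_(p <- l) p.1 * F p.2 = \sum_(i < size s) coef l s`_i * F s`_i.
Proof.
move=> us sub.
rewrite -(big_mkord xpredT (fun i => coef l s`_i * F s`_i)).
rewrite -(big_nth 0 xpredT (fun z => coef l z * F z)).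
rewrite [RHS](eq_bigr (fun z => \sum_(p <- l) if p.2 == z then p.1 * F p.2 else 0)); last first.
  move=> z _; rewrite /coef mulr_suml -big_mkcond; apply: eq_bigr => p /eqP -> //.
rewrite exchange_big /= big_seq [RHS]big_seq; apply: eq_bigr => p pl.
have ps : p.2 \in s by apply/sub/map_f.
rewrite -big_mkcond -big_filter (eq_filter (a2 := pred1 p.2)) => [|z]; last exact: eq_sym.
by rewrite filter_pred1_uniq // big_seq1.
Qed.

Lemma sq_of_negsys f k (y : 'I_k -> seq (C * C)) (s : seq C) : uniq s ->
  (forall i z, z \in pts (y i) -> z \in s) -> negdef (gram (ker f) y) ->
  (k <= sq_minus (pick_matrix f (fun i : 'I_(size s) => (s`_i)%R)))%N.
Proof.
move=> us sub nd; pose Y : 'M[C]_(k, size s) := \matrix_(i, j) coef (y i) s`_j.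
apply: (sq_minus_ge (Y := Y) (pick_herm _ _)).
suff <- : gram (ker f) y = Y *m pick_matrix f (fun i : 'I_(size s) => (s`_i)%R) *m Y^t* by [].
apply/matrixP => i j; rewrite !mxE.
rewrite [RHS](eq_bigr (fun v => \sum_u Y i u * ((Y j v)^* * ker f s`_u s`_v))); last first.
  move=> v _; rewrite !mxE mulr_suml; apply: eq_bigr => u _.
  by rewrite ?mxE /ker; ring.
rewrite [RHS]exchange_big /= /bf.
transitivity (\sum_(p <- y i) p.1 * \sum_(q <- y j) q.1^* * ker f p.2 q.2).
  by apply: eq_bigr => p _; rewrite mulr_sumr; apply: eq_bigr => q _; rewrite -mulrA.
rewrite (sum_coef (fun z => \sum_(q <- y j) q.1^* * ker f z q.2) us); last exact: sub.
apply: eq_bigr => u _; rewrite -mulr_sumr !mxE; congr (_ * _).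
rewrite -[LHS]conjCK rmorph_sum /=.
transitivity ((\sum_(q <- y j) q.1 * (ker f s`_u q.2)^*)^*).
  by congr (_^*); apply: eq_bigr => q _; rewrite rmorphM /= conjCK.
rewrite (sum_coef (fun z => (ker f s`_u z)^*) us); last exact: sub.
by rewrite rmorph_sum; apply: eq_bigr => v _ /=; rewrite rmorphM /= conjCK mxE.
Qed.

(** Subtracting multiples of [x] makes the old vectors orthogonal to [x]; their new Gram matrix is
    the Schur complement, and negative definiteness is open. As [x] may depend on [de], the
    complement needs to approach [M0] only approximately. *)
Lemma negsys_extend f X k (y : 'I_k -> seq (C * C)) (M0 : 'M[C]_k) :
  (forall i z, z \in pts (y i) -> X z) -> herm M0 -> negdef M0 ->
  (forall de : R, 0 < de -> exists x, [/\ forall z, z \in pts x -> X z,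
     bf (ker f) x x < 0 & forall i j, nm (bf (ker f) (y i) (y j) -
       bf (ker f) (y i) x * bf (ker f) x (y j) / bf (ker f) x x - M0 i j) <= de]) ->
  negsys f X k.+1.
Proof.
move=> yX hM0 nM0 hx.
have [de [de0 hde]] := negdef_open hM0 nM0.
have [x [xX x0 near]] := hx de de0.
set Q := bf (ker f) in x0 near; have xn : Q x x != 0 by rewrite lt_eqF.
have xr : (Q x x)^* = Q x x by rewrite -(bf_conj _ _ (kerC f)).
pose be i := - (Q (y i) x / Q x x).
pose yy i := y i ++ scl (be i) x.
pose y' (i : 'I_k.+1) := if unlift ord0 i is Some j then yy j else x.
have y'0 : y' ord0 = x by rewrite /y' unlift_none.
have y'S j : y' (lift ord0 j) = yy j by rewrite /y' liftK.
have orth i : Q (yy i) x = 0.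
  by rewrite /yy /Q bf_catl bf_scll -/Q /be mulNr divfK // subrr.
have orth' i : Q x (yy i) = 0 by rewrite /Q (bf_conj _ _ (kerC f)) -/Q orth rmorph0.
have Qyy i j : Q (yy i) (yy j) = Q (y i) (y j) - Q (y i) x * Q x (y j) / Q x x.
  rewrite {2}/yy /Q bf_catr bf_sclr -/Q orth mulr0 addr0 /yy /Q bf_catl bf_scll -/Q.
  by rewrite /be; ring.
pose S := \matrix_(i, j) Q (yy i) (yy j) : 'M[C]_k.
have nS : negdef S.
  apply: hde; first by move=> i j; rewrite !mxE; apply: bf_conj (kerC f).
  by move=> i j; rewrite mxE Qyy.
exists y'; split.
  move=> i z; rewrite /y'; case: unliftP => [j _|_]; last exact: xX.
  by rewrite /yy mem_pts_cat mem_pts_scl => /orP[/yX|/xX].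
move=> c c0; pose c' := \row_j c 0 (lift ord0 j) : 'rV[C]_k.
have -> : hq (gram (ker f) y') c = c 0 ord0 * (c 0 ord0)^* * Q x x + hq S c'.
  rewrite /hq big_ord_recl big_ord_recl !mxE y'0 -/Q big1 ?addr0 => [|j _]; last first.
    by rewrite mxE y'0 y'S -/Q orth' mulr0.
  congr (_ + _); apply: eq_bigr => i _; rewrite big_ord_recl mxE y'S y'0 -/Q orth mulr0 add0r.
  by apply: eq_bigr => j _; rewrite !mxE !y'S.
have [c'0|c'0] := eqVneq c' 0; last first.
  rewrite -[ltRHS]addr0 ler_ltD //; last exact: nS.
  by rewrite mulr_ge0_le0 ?mul_conjC_ge0 // ltW.
have -> : hq S c' = 0.
  by rewrite c'0 /hq big1 // => i _; rewrite big1 // => j _; rewrite mxE !mul0r.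
rewrite addr0 pmulr_rlt0 // mul_conjC_gt0.
apply: contraNneq c0 => c00; apply/eqP/rowP => i; rewrite [RHS]mxE.
have [j ->|->] := unliftP ord0 i; last exact: c00.
by have /rowP /(_ j) := c'0; rewrite !mxE.
Qed.

(** The Szego kernel, written as the kernel of the zero function so that [kerC] and [schur_psd]
    apply to it. *)
Definition sz : C -> C -> C := ker (fun=> 0).

Lemma szE z w : sz z w = (1 - z * w^*)^-1.
Proof. by rewrite /sz /ker mul0r subr0 mul1r. Qed.

Lemma sz_psd l : (forall z, z \in pts l -> nm z < 1) -> 0 <= bf sz l l.
Proof.
move=> h; apply: (@schur_psd _ [::]).
- by move=> z _; split; [apply: cont_cst|move=> _; apply: diff_cst].
- by move=> z _; rewrite nm0.
- by move=> z /h.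
Qed.

Lemma sz_cs l m : (forall z, z \in pts l -> nm z < 1) ->
  (forall z, z \in pts m -> nm z < 1) ->
  nm (bf sz l m) ^+ 2 <= nm (bf sz l l) * nm (bf sz m m).
Proof.
move=> hl hm; have l0 := sz_psd hl; have m0 := sz_psd hm.
rewrite -lecR -mulJ_nm rmorphM /= -!nmE !ger0_norm //.
apply: cauchy_schwarz_numbers => // x y.
have szC : bf sz m l = (bf sz l m)^* := bf_conj l m (kerC _).
have := @sz_psd (scl x l ++ scl y m).
rewrite bf_catl !bf_catr !bf_scll !bf_sclr szC => h.
have -> : x * x^* * bf sz l l + x * y^* * bf sz l m + y * x^* * (bf sz l m)^* +
  y * y^* * bf sz m m = x * (x^* * bf sz l l) + x * (y^* * bf sz l m) +
  (y * (x^* * (bf sz l m)^*) + y * (y^* * bf sz m m)) by ring.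
by apply: h => z; rewrite mem_pts_cat !mem_pts_scl => /orP[/hl|/hm].
Qed.

Lemma ker_sz f l m : bf (ker f) l m = bf sz l m - bf sz (tw f l) (tw f m).
Proof.
rewrite bf_tw -[- _]mulN1r -bf_scale -bf_add; apply: bf_ext => z w _ _.
by rewrite /sz /ker; ring.
Qed.

(* T x - k_a, where T k_z = f(z) k_z. *)
Definition vdiff f a x := tw f x ++ [:: (-1, a)].

Definition kpt a : seq (C * C) := [:: (1, a)].

Definition singular f X a := forall de : R, 0 < de -> exists x,
  [/\ forall z, z \in pts x -> X z, nm (bf sz x x) <= de &
      nm (bf sz (vdiff f a x) (vdiff f a x)) <= de].

Lemma bf_vdiffr K f a l x : bf K l (tw f x) = bf K l (vdiff f a x) + bf K l (kpt a).
Proof.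
rewrite /vdiff bf_catr -addrA [X in _ + X](_ : _ = 0) ?addr0 //.
rewrite /bf -big_split big1 // => p _ /=; rewrite !big_seq1 /= rmorphN rmorph1.
by ring.
Qed.

Lemma bf_vdiffl K f a l x : bf K (tw f x) l = bf K (vdiff f a x) l + bf K (kpt a) l.
Proof.
rewrite /vdiff bf_catl -addrA [X in _ + X](_ : _ = 0) ?addr0 //.
rewrite /bf !big_seq1 -big_split big1 // => p _ /=; ring.
Qed.

(** The Szego kernel times [1 - bl a z * (bl a w)^*] has rank one: it is 1 - |a|^2 times a product
    of kernel values at [a]. *)
Lemma ker_mul_bl f a l m : nm a < 1 -> (forall z, z \in pts l ++ pts m -> nm z < 1) ->
  bf (ker (fun z => bl a z * f z)) l m = bf (ker f) l m +
    (1 - a * a^*) * (bf sz (tw f l) (kpt a) * (bf sz (tw f m) (kpt a))^*).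
Proof.
move=> aD hD.
have e l' : bf sz (tw f l') (kpt a) = \sum_(p <- l') p.1 * (f p.2 * sz p.2 a).
  rewrite /bf big_map; apply: eq_bigr => p _; rewrite big_seq1 /= rmorph1; ring.
rewrite !e -(bf_rank1 (fun z => f z * sz z a)) -bf_scale -bf_add.
apply: bf_ext => z w zl wm.
have zD : nm z < 1 by apply: hD; rewrite mem_cat zl.
have wD : nm w < 1 by apply: hD; rewrite mem_cat wm orbT.
have a1 := nm_lt1_neq0 zD wD; have a2 := nm_lt1_neq0 zD aD.
have a3 := nm_lt1_neq0 aD wD; have a4 := nm_lt1_neq0 aD aD.
rewrite !szE /ker /bl !rmorphM !fmorphV !rmorphB !rmorphM /= !rmorph1 !conjCK.
rewrite [w^* * a]mulrC.
by field; rewrite a1 a2 a3.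
Qed.

(* If some combinations x of kernels tend to 0 while T x tends to the kernel at a,
   passing from b_a f to f gains a negative square. *)
Lemma singular_step f X a k : (forall z, X z -> nm z < 1) -> nm a < 1 ->
  singular f X a -> negsys (fun z => bl a z * f z) X k -> negsys f X k.+1.
Proof.
move=> XD aD hs [y [yX nd]].
apply: (negsys_extend yX (gram_herm _ y) nd) => de de0.
pose P (d : R) x := [/\ forall z, z \in pts x -> X z, nm (bf sz x x) <= d &
      nm (bf sz (vdiff f a x) (vdiff f a x)) <= d].
(* Cauchy-Schwarz: vectors of small Szego norm are almost orthogonal to any fixed [l]. *)
have small (v : seq (C * C) -> seq (C * C)) l : (forall z, z \in pts l -> nm z < 1) ->
    (forall d x, P d x -> (forall z, z \in pts (v x) -> nm z < 1) /\
       nm (bf sz (v x) (v x)) <= d) -> tends P (fun x => bf sz l (v x)) 0.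
  move=> lD hv e e0; pose B := nm (bf sz l l) + 1.
  have B0 : 0 < B by rewrite /B; have := nm_ge0 (bf sz l l); lra.
  exists (e ^+ 2 / B); split; first by rewrite divr_gt0 // exprn_gt0.
  move=> d d0 dB x Px; rewrite subr0; have [vD vd] := hv d x Px.
  have := sz_cs lD vD => cs.
  rewrite -(@ler_pXn2r _ 2) ?nnegrE ?nm_ge0 ?(ltW e0) //; apply: le_trans cs _.
  apply: le_trans (_ : B * (e ^+ 2 / B) <= _); last first.
    by rewrite mulrC divfK // gt_eqF.
  apply: ler_pM; rewrite ?nm_ge0 //; first by rewrite /B lerDl.
  exact: le_trans vd dB.
have PX d x : P d x -> forall z, z \in pts x -> nm z < 1 by move=> [h _ _] z /h /XD.
have PV d x : P d x -> forall z, z \in pts (vdiff f a x) -> nm z < 1.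
  move=> Px z; rewrite mem_pts_cat mem_pts_tw inE => /orP[/(PX d x Px)//|/eqP ->//].
have kD z : z \in pts (kpt a) -> nm z < 1 by rewrite inE => /eqP ->.
have t1 l : (forall z, z \in pts l -> nm z < 1) -> tends P (fun x => bf sz l x) 0.
  by move=> lD; apply: small => // d x Px; split; [apply: PX Px|case: Px].
have t2 l : (forall z, z \in pts l -> nm z < 1) ->
    tends P (fun x => bf sz l (tw f x)) (bf sz l (kpt a)).
  move=> lD; apply: (@tends_ext _ _ _ (fun x => bf sz l (vdiff f a x) + bf sz l (kpt a))).
    by move=> x; rewrite -bf_vdiffr.
  rewrite -[X in tends _ _ X]add0r; apply: tendsD; last exact: tends_cst.
  by apply: small => // d x Px; split; [apply: PV Px|case: Px].
have txx : tends P (fun x => bf sz x x) 0.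
  by move=> e e0; exists e; split=> // d d0 de' x [_ h _]; rewrite subr0; apply: le_trans h de'.
have tvv : tends P (fun x => bf sz (vdiff f a x) (vdiff f a x)) 0.
  by move=> e e0; exists e; split=> // d d0 de' x [_ _ h]; rewrite subr0; apply: le_trans h de'.
have tTT : tends P (fun x => bf sz (tw f x) (tw f x)) (bf sz (kpt a) (kpt a)).
  apply: (@tends_ext _ _ _ (fun x => bf sz (vdiff f a x) (vdiff f a x) +
     (bf sz (kpt a) (vdiff f a x))^* + bf sz (kpt a) (tw f x))).
    move=> x; rewrite -(bf_conj _ _ (kerC _)) -/sz.
    by rewrite -bf_vdiffr -bf_vdiffl.
  rewrite -[X in tends _ _ X]add0r; apply: tendsD; last exact: t2.
  have j0 : (0 : C)^* = 0 by rewrite rmorph0.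
  rewrite -[X in tends _ _ X]addr0; apply: tendsD => //.
  rewrite -[X in tends _ _ X]j0; apply: tendsJ.
  by apply: small => // d x Px; split; [apply: PV Px|case: Px].
pose g := (1 - a * a^*)^-1.
have gE : bf sz (kpt a) (kpt a) = g by rewrite /bf !big_seq1 /= rmorph1 !mul1r szE.
have g0 : 0 < g.
  rewrite invr_gt0 subr_gt0 mulJ_nm -[1]/((1%:C)%C) ltcR expr_lt1 ?nm_ge0 //.
have gn : - g != 0 by rewrite oppr_eq0 gt_eqF.
have qxx : tends P (fun x => bf (ker f) x x) (- g).
  apply: (@tends_ext _ _ _ (fun x => bf sz x x - bf sz (tw f x) (tw f x))).
    by move=> x; rewrite -ker_sz.
  by rewrite -[- g]add0r -gE; apply: tendsB.
pose A i := bf sz (tw f (y i)) (kpt a).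
have yD i z : z \in pts (y i) -> nm z < 1 by move=> /yX /XD.
have qyx i : tends P (fun x => bf (ker f) (y i) x) (- A i).
  apply: (@tends_ext _ _ _ (fun x => bf sz (y i) x - bf sz (tw f (y i)) (tw f x))).
    by move=> x; rewrite -ker_sz.
  rewrite -[- A i]add0r; apply: tendsB; first by apply: t1; apply: yD.
  by apply: t2 => z; rewrite mem_pts_tw; apply: yD.
(* In the limit the Schur complement is Q(y_i, y_j) plus A_i conj(A_j) / g, where g is the squared
   norm of k_a; by [ker_mul_bl] this is the Pick form of b_a f. *)
have qq i j : tends P (fun x => bf (ker f) (y i) (y j) -
    bf (ker f) (y i) x * bf (ker f) x (y j) / bf (ker f) x x -
    gram (ker (fun z => bl a z * f z)) y i j) 0.
  rewrite mxE ker_mul_bl //; last by move=> z; rewrite mem_cat => /orP[/yD|/yD].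
  rewrite -/(A i) -/(A j).
  have -> : (0 : C) = bf (ker f) (y i) (y j) - (- A i) * (- A j)^* / (- g) -
     (bf (ker f) (y i) (y j) + (1 - a * a^*) * (A i * (A j)^*)).
    have -> : 1 - a * a^* = g^-1 by rewrite /g invrK.
    by rewrite rmorphN; field; rewrite gt_eqF.
  apply: tendsB; last exact: tends_cst.
  apply: tendsB; first exact: tends_cst.
  apply: tendsM; last exact: tendsV.
  apply: tendsM => //.
  apply: (@tends_ext _ _ _ (fun x => (bf (ker f) (y j) x)^*)).
    by move=> x; rewrite -(bf_conj _ _ (kerC _)).
  exact: tendsJ.
have [d1 [d10 h1]] : exists d : R, 0 < d /\ forall d', 0 < d' -> d' <= d -> forall x, P d' x ->
    bf (ker f) x x < 0.
  have gR : ((complex.Re g)%:C)%C = g by apply: RRe_real; apply: gtr0_real.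
  have gRe0 : 0 < complex.Re g by rewrite -ltcR gR.
  have [|d [d0 hd]] := qxx (complex.Re g / 2); first by lra.
  exists d; split=> // d' d'0 d'd x Px; have kk := hd d' d'0 d'd x Px.
  have xr : bf (ker f) x x \is Num.real.
    by apply/CrealP; rewrite -(bf_conj _ _ (kerC _)).
  rewrite -(RRe_real xr) realc_lt0.
  have := Re_le_nm (bf (ker f) x x - - g); rewrite opprK ReD in kk *; lra.
have qq' (ij : 'I_k * 'I_k) := qq ij.1 ij.2.
have [d2 [d20 h2]] := tends_all qq' de0.
have [|x Px] := hs (Num.min d1 d2); first by rewrite lt_min d10.
have m0 : 0 < Num.min d1 d2 by rewrite lt_min d10.
exists x; split; first by case: Px.
  by apply: h1 Px => //; rewrite ge_min lexx.
move=> i j; have := h2 _ m0 _ x Px (i, j); rewrite subr0; apply.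
by rewrite ge_min lexx orbT.
Qed.

End NegativeSystems.

Arguments sz {R}.

(** * Poles, jumps and points of non-differentiability *)

Section Singularities.
Variable R : realType.
Local Notation C := R[i].
Implicit Types (K : C -> C -> C) (x l m : seq (C * C)) (f g h : C -> C) (a z w v : C).
Implicit Types X : set C.

Lemma tends_sz (T : Type) (P : R -> T -> Prop) (z w : T -> C) (z0 w0 : C) :
  nm z0 < 1 -> nm w0 < 1 -> tends P z z0 -> tends P w w0 ->
  tends P (fun t => sz (z t) (w t)) (sz z0 w0).
Proof.
by move=> zD wD hz hw; apply: tends_ker => //; apply: tends_cst.
Qed.

Lemma sing_of_tends (T : Type) (P : R -> T -> Prop) (x : T -> seq (C * C)) f X a :
  (forall d : R, 0 < d -> exists t, P d t) ->
  (forall d t, P d t -> forall z, z \in pts (x t) -> X z) ->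
  tends P (fun t => bf sz (x t) (x t)) 0 ->
  tends P (fun t => bf sz (vdiff f a (x t)) (vdiff f a (x t))) 0 -> singular f X a.
Proof.
move=> ne PX h1 h2 de de0.
have [d1 [d10 k1]] := h1 de de0; have [d2 [d20 k2]] := h2 de de0.
have m0 : 0 < Num.min d1 d2 by rewrite lt_min d10.
have [t Pt] := ne _ m0; exists (x t); split; first exact: PX Pt.
  by have := k1 _ m0 _ t Pt; rewrite subr0; apply; rewrite ge_min lexx.
by have := k2 _ m0 _ t Pt; rewrite subr0; apply; rewrite ge_min lexx orbT.
Qed.

Definition lin l (F : C -> C) : C := \sum_(p <- l) p.1 * F p.2.

(** Lists representing the same formal combination pair equally with every [F]; identities between
    combinations thus reduce to [ring] and [field]. *)
Lemma bf_lineq K l l' : (forall F, lin l F = lin l' F) -> bf K l l = bf K l' l'.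
Proof.
move=> e.
have e1 m m' n : (forall F, lin m F = lin m' F) -> bf K m n = bf K m' n.
  have lE q : bf K q n = lin q (fun z => \sum_(p <- n) p.1^* * K z p.2).
    by apply: eq_bigr => p _; rewrite mulr_sumr; apply: eq_bigr => q' _; rewrite -mulrA.
  by move=> h; rewrite !lE.
have e2 m m' n : (forall F, lin m F = lin m' F) -> bf K n m = bf K n m'.
  have rE q : bf K n q = \sum_(p <- n) p.1 * (lin q (fun z => (K p.2 z)^*))^*.
    apply: eq_bigr => p _; rewrite rmorph_sum mulr_sumr; apply: eq_bigr => q' _.
    by rewrite rmorphM /= conjCK mulrA.
  by move=> h; rewrite !rE; apply: eq_bigr => p _; rewrite h.
by rewrite (e1 l l') // (e2 l l').
Qed.

Definition kdiff w v : seq (C * C) := [:: (1, w); (-1, v)].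

Lemma bf_kdiff w v w' v' : bf sz (kdiff w v) (kdiff w' v') =
  sz w w' - sz w v' - sz v w' + sz v v'.
Proof.
by rewrite /bf !big_cons !big_nil /= rmorphN rmorph1; ring.
Qed.

Lemma tends_kdiff (T : Type) (P : R -> T -> Prop) (w v w' v' : T -> C) a : nm a < 1 ->
  tends P w a -> tends P v a -> tends P w' a -> tends P v' a ->
  tends P (fun t => bf sz (kdiff (w t) (v t)) (kdiff (w' t) (v' t))) 0.
Proof.
move=> aD h1 h2 h3 h4.
apply: (@tends_ext _ _ _ (fun t => sz (w t) (w' t) - sz (w t) (v' t) - sz (v t) (w' t) + sz (v t) (v' t))).
  by move=> t; rewrite bf_kdiff.
have -> : (0 : C) = sz a a - sz a a - sz a a + sz a a by ring.
apply: tendsD; last exact: tends_sz.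
apply: tendsB; last exact: tends_sz.
by apply: tendsB; apply: tends_sz.
Qed.

(** Take x = k_w / f(w): it tends to 0 while T x = k_w tends to k_a. *)
Lemma unbounded_singular f X a : nm a < 1 ->
  (forall d M : R, 0 < d -> exists w, [/\ X w, nm (w - a) < d & M < nm (f w)]) ->
  singular f X a.
Proof.
move=> aD hf; pose P (d : R) w := [/\ X w, nm (w - a) < d & d^-1 < nm (f w)].
have tw0 : tends P id a.
  by move=> e e0; exists e; split=> // d d0 de w [_ h _]; apply: ltW; apply: lt_le_trans h de.
have ti : tends P (fun w => (f w)^-1) 0.
  move=> e e0; exists e; split=> // d d0 de w [_ _ h]; rewrite subr0 nmV.
  apply: le_trans de; rewrite invf_ple ?posrE // ?ltW //.
  by apply: lt_trans h; rewrite invr_gt0.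
have fn d w : 0 < d -> P d w -> f w != 0.
  by move=> d0 [_ _ h]; rewrite -nm_gt0; apply: lt_trans h; rewrite invr_gt0.
apply: (@sing_of_tends _ P (fun w => [:: ((f w)^-1, w)])).
- by move=> d d0; apply: hf.
- by move=> d w [Xw _ _] z; rewrite inE => /eqP ->.
- apply: (@tends_ext _ _ _ (fun w => (f w)^-1 * ((f w)^-1)^* * sz w w)).
    by move=> w; rewrite /bf !big_seq1.
  have -> : (0 : C) = 0 * 0^* * sz a a by rewrite !mul0r.
  by apply: tendsM; [apply: tendsM => //; apply: tendsJ|apply: tends_sz].
apply: (@tends_extP _ _ _ (fun w => bf sz (kdiff w a) (kdiff w a))).
  move=> d w d0 Pw; apply: bf_lineq => F.
  by rewrite /lin !big_cons !big_nil /= mulVf // (fn d).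
by apply: (@tends_kdiff _ P id (fun=> a) id (fun=> a) a aD) => //; exact: tends_cst.
Qed.

(** Take x = (k_w - k_v) / (f(w) - f(v)). Then T x = k_w + s (k_w - k_v) with s = f(v) / (f(w) -
    f(v)) bounded, so T x tends to k_a. *)
Lemma jump_singular f X a (M eps : R) : nm a < 1 -> 0 < eps ->
  (exists r : R, 0 < r /\ forall w, X w -> nm (w - a) < r -> nm (f w) <= M) ->
  (forall d : R, 0 < d -> exists w v, [/\ X w, X v, nm (w - a) < d, nm (v - a) < d &
     eps < nm (f w - f v)]) ->
  singular f X a.
Proof.
move=> aD e0 [r [r0 hr]] hf.
pose P (d : R) (t : C * C) := [/\ X t.1, X t.2, nm (t.1 - a) < d, nm (t.2 - a) < d &
     eps < nm (f t.1 - f t.2)] /\ nm (f t.2) <= M.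
have t1 : tends P fst a.
  by move=> e e1; exists e; split=> // d d0 de t [[_ _ h _ _] _]; apply: ltW; apply: lt_le_trans h de.
have t2 : tends P snd a.
  by move=> e e1; exists e; split=> // d d0 de t [[_ _ _ h _] _]; apply: ltW; apply: lt_le_trans h de.
pose De (t : C * C) := f t.1 - f t.2.
have Dn d t : P d t -> De t != 0.
  by move=> [[_ _ _ _ h] _]; rewrite -nm_gt0; apply: lt_trans h.
have Db d t : P d t -> nm (De t)^-1 <= eps^-1.
  move=> Pt; rewrite nmV lef_pV2 ?posrE // ?nm_gt0 ?(Dn d) //.
  by case: Pt => [[_ _ _ _ h] _]; apply: ltW.
apply: (@sing_of_tends _ P (fun t => [:: ((De t)^-1, t.1); (- (De t)^-1, t.2)])).
- move=> d d0; have [|w [v [Xw Xv h1 h2 h3]]] := hf (Num.min d r).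
    by rewrite lt_min d0.
  move: h1 h2; rewrite !lt_min => /andP[h1 h1'] /andP[h2 h2'].
  by exists (w, v); split=> //; apply: hr.
- by move=> d t [[X1 X2 _ _ _] _] z; rewrite !inE => /orP[] /eqP ->.
- apply: (@tends_ext _ _ _ (fun t => ((De t)^-1 * ((De t)^-1)^*) *
     bf sz (kdiff t.1 t.2) (kdiff t.1 t.2))).
    move=> t; rewrite -mulrA -bf_sclr -bf_scll; apply: bf_lineq => F.
    by rewrite /lin !big_cons !big_nil /=; ring.
  apply: (@tends_bdd0 _ _ _ _ _ (eps^-1 * eps^-1)); last exact: (tends_kdiff aD).
  by move=> d t d0 Pt; rewrite nmM nmJ ler_pM ?nm_ge0 ?(Db d).
pose s t := f t.2 / De t.
have sb d t : P d t -> nm (s t) <= M / eps.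
  move=> Pt; rewrite nmM ler_pM ?nm_ge0 ?(Db d) //; by case: Pt.
apply: (@tends_extP _ _ _ (fun t => bf sz (kdiff t.1 a) (kdiff t.1 a) +
   (s t)^* * bf sz (kdiff t.1 a) (kdiff t.1 t.2) +
   s t * (bf sz (kdiff t.1 t.2) (kdiff t.1 a) +
   (s t)^* * bf sz (kdiff t.1 t.2) (kdiff t.1 t.2)))).
  move=> d t d0 Pt; have De0 := Dn d t Pt.
  rewrite -2!bf_sclr -2!bf_catr -bf_scll -bf_catl.
  apply: bf_lineq => F; rewrite /lin !big_cons !big_nil /= /s.
  have -> : (De t)^-1 * f t.1 = 1 + f t.2 / De t 
    by rewrite (_ : f t.1 = De t + f t.2); [field|rewrite /De; ring].
  by ring.
have -> : (0 : C) = 0 + 0 + 0 by ring.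
apply: tendsD.
  apply: tendsD.
    by apply: (@tends_kdiff _ P fst (fun=> a) fst (fun=> a) a aD) => //; exact: tends_cst.
  apply: (@tends_bdd0 _ _ _ _ _ (M / eps)).
    by move=> d t d0 Pt; rewrite nmJ (sb d).
  by apply: (@tends_kdiff _ P fst (fun=> a) fst snd a aD) => //; exact: tends_cst.
apply: (@tends_bdd0 _ _ _ _ _ (M / eps)); first by move=> d t d0 Pt; apply: (sb d).
rewrite -[X in tends _ _ X]addr0; apply: tendsD.
  by apply: (@tends_kdiff _ P fst snd fst (fun=> a) a aD) => //; exact: tends_cst.
apply: (@tends_bdd0 _ _ _ _ _ (M / eps)).
  by move=> d t d0 Pt; rewrite nmJ (sb d).
by apply: (tends_kdiff aD).
Qed.

(* Difference quotients (k_w - k_a) / (w - a) and their inner products, which extend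
   continuously to w = v = a. *)
Definition kap a w : seq (C * C) := scl (w - a)^-1 (kdiff w a).

Definition kk a w v : C := (1 - w * a * v^* * a^*) /
  ((1 - w * v^*) * (1 - w * a^*) * (1 - a * v^*) * (1 - a * a^*)).

Lemma bf_kap a w v : nm a < 1 -> nm w < 1 -> nm v < 1 -> w != a -> v != a ->
  bf sz (kap a w) (kap a v) = kk a w v.
Proof.
move=> aD wD vD wa va; rewrite bf_scll bf_sclr bf_kdiff !szE /kk fmorphV rmorphB /=.
have a1 := nm_lt1_neq0 wD vD; have a2 := nm_lt1_neq0 wD aD.
have a3 := nm_lt1_neq0 aD vD; have a4 := nm_lt1_neq0 aD aD.
have b1 : w - a != 0 by rewrite subr_eq0.
have b2 : v^* - a^* != 0 by rewrite -rmorphB conjC_eq0 subr_eq0.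
by field; rewrite a1 a2 a3 a4 b1 b2.
Qed.

Lemma tends_kk (T : Type) (P : R -> T -> Prop) (w v : T -> C) a : nm a < 1 ->
  tends P w a -> tends P v a -> tends P (fun t => kk a (w t) (v t)) (kk a a a).
Proof.
move=> aD hw hv; have a4 := nm_lt1_neq0 aD aD.
have tc c : tends P (fun=> c) c by apply: tends_cst.
have tv : tends P (fun t => (v t)^*) a^* by apply: tendsJ.
apply: tendsM.
  by apply: tendsB => //; do 3?[apply: tendsM => //].
apply: tendsV; first by rewrite !mulf_neq0.
by apply: tendsM => //; apply: tendsM; [apply: tendsM|]; apply: tendsB => //; apply: tendsM.
Qed.

(** Take x = (k_w - k_a) / (h(w) - h(a)). With ta = (w - a) / (h(w) - h(a)) tending to 0, both x and
    T x - k_a are vanishing multiples of [kap a w], whose norm stays bounded. *)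
Lemma steep_singular h a : nm a < 1 ->
  (forall d M : R, 0 < d -> exists w, [/\ nm w < 1, w != a, nm (w - a) < d &
     M * nm (w - a) < nm (h w - h a)]) ->
  singular h [set z | nm z < 1] a.
Proof.
move=> aD hf; pose P (d : R) w := [/\ nm w < 1, w != a, nm (w - a) < d &
  d^-1 * nm (w - a) < nm (h w - h a)].
have tw0 : tends P id a.
  by move=> e e0; exists e; split=> // d d0 de w [_ _ h1 _]; apply: ltW; apply: lt_le_trans h1 de.
pose De w := h w - h a.
have Dn d w : 0 < d -> P d w -> De w != 0.
  move=> d0 [_ _ _ k]; rewrite -nm_gt0; apply: le_lt_trans k.
  by rewrite mulr_ge0 ?nm_ge0 // invr_ge0 ltW.
pose ta w := (w - a) / De w.
have tta : tends P ta 0.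
  move=> e e0; exists e; split=> // d d0 de w Pw; rewrite subr0 nmM nmV.
  have k0 := Dn d w d0 Pw; case: Pw => _ _ _ k.
  apply: le_trans de; rewrite ler_pdivrMr ?nm_gt0 // -ler_pdivrMl //.
  exact: ltW.
have tkk := tends_kk aD tw0 tw0.
apply: (@sing_of_tends _ P (fun w => [:: ((De w)^-1, w); (- (De w)^-1, a)])).
- by move=> d d0; apply: hf.
- by move=> d w [wD _ _ _] z; rewrite !inE => /orP[] /eqP ->.
- apply: (@tends_extP _ _ _ (fun w => ta w * ((ta w)^* * kk a w w))).
    move=> d w d0 Pw; have k0 := Dn d w d0 Pw; case: Pw => wD wa _ _.
    rewrite -bf_kap // -bf_sclr -bf_scll; apply: bf_lineq => F.
    have wa0 : w - a != 0 by rewrite subr_eq0.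
    rewrite /lin !big_cons !big_nil /= /ta.
    by field; rewrite wa0 k0.
  have -> : (0 : C) = 0 * (0^* * kk a a a) by rewrite mul0r.
  by apply: tendsM => //; apply: tendsM => //; apply: tendsJ.
pose c w := (w - a) + h a * ta w.
have tc : tends P c 0.
  rewrite -[X in tends _ _ X](_ : (a - a) + h a * 0 = 0); last by ring.
  apply: tendsD; first by apply: tendsB => //; apply: tends_cst.
  by apply: tendsM => //; apply: tends_cst.
apply: (@tends_extP _ _ _ (fun w => c w * ((c w)^* * kk a w w))).
  move=> d w d0 Pw; have k0 := Dn d w d0 Pw; case: Pw => wD wa _ _.
  rewrite -bf_kap // -bf_sclr -bf_scll; apply: bf_lineq => F.
  have wa0 : w - a != 0 by rewrite subr_eq0.
  rewrite /lin !big_cons !big_nil /= /c /ta.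
  have -> : h w = De w + h a by rewrite /De; ring.
  by field; rewrite wa0 k0.
have -> : (0 : C) = 0 * (0^* * kk a a a) by rewrite mul0r.
by apply: tendsM => //; apply: tendsM => //; apply: tendsJ.
Qed.

(** T maps [kap a w] to h(w) [kap a w] plus the difference quotient times k_a. For two points divide
    the difference by the gap [De] of the quotients: the coefficient of k_a becomes 1 and the rest
    tends to 0. *)
Lemma kink_singular h a (eps : R) : nm a < 1 -> 0 < eps -> cont_at h a ->
  (forall d : R, 0 < d -> exists w v, [/\ nm w < 1 /\ w != a, nm v < 1 /\ v != a,
     nm (w - a) < d, nm (v - a) < d &
     eps < nm ((h w - h a) / (w - a) - (h v - h a) / (v - a))]) ->
  singular h [set z | nm z < 1] a.
Proof.
move=> aD e0 ch hf.
pose De (t : C * C) := (h t.1 - h a) / (t.1 - a) - (h t.2 - h a) / (t.2 - a).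
pose P (d : R) (t : C * C) := [/\ nm t.1 < 1 /\ t.1 != a, nm t.2 < 1 /\ t.2 != a,
  nm (t.1 - a) < d, nm (t.2 - a) < d & eps < nm (De t)].
have t1 : tends P fst a.
  by move=> e e1; exists e; split=> // d d0 de t [_ _ h1 _ _]; apply: ltW; apply: lt_le_trans h1 de.
have t2 : tends P snd a.
  by move=> e e1; exists e; split=> // d d0 de t [_ _ _ h1 _]; apply: ltW; apply: lt_le_trans h1 de.
have th1 : tends P (fun t => h t.1) (h a).
  move=> e e1; have [d [d0 hd]] := ch e e1; exists d; split=> // d' d'0 d'd t [[w1 _] _ h1 _ _].
  by apply: hd => //; apply: lt_le_trans h1 d'd.
have th2 : tends P (fun t => h t.2) (h a).
  move=> e e1; have [d [d0 hd]] := ch e e1; exists d; split=> // d' d'0 d'd t [_ [w1 _] _ h1 _].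
  by apply: hd => //; apply: lt_le_trans h1 d'd.
have Dn d t : P d t -> De t != 0.
  by move=> [_ _ _ _ k]; rewrite -nm_gt0; apply: lt_trans k.
have Db d t : P d t -> nm ((De t)^-1 * ((De t)^-1)^*) <= eps^-1 * eps^-1.
  move=> Pt; have k : nm (De t)^-1 <= eps^-1.
    rewrite nmV lef_pV2 ?posrE // ?nm_gt0 ?(Dn d) //.
    by case: Pt => _ _ _ _ k; apply: ltW.
  by rewrite nmM nmJ ler_pM ?nm_ge0.
(* Both [kap] vectors approach the same limit, so coefficients with opposite limits cancel. *)
have t0 (c1 c2 : C * C -> C) c : tends P c1 c -> tends P c2 (- c) ->
    tends P (fun t => bf sz (scl (c1 t) (kap a t.1) ++ scl (c2 t) (kap a t.2))
      (scl (c1 t) (kap a t.1) ++ scl (c2 t) (kap a t.2))) 0.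
  move=> h1 h2.
  apply: (@tends_extP _ _ _ (fun t => c1 t * ((c1 t)^* * kk a t.1 t.1) +
     c1 t * ((c2 t)^* * kk a t.1 t.2) + (c2 t * ((c1 t)^* * kk a t.2 t.1) +
     c2 t * ((c2 t)^* * kk a t.2 t.2)))).
    move=> d t d0 [[wD wa] [vD va] _ _ _].
    by rewrite bf_catl !bf_catr !(bf_scll _ (c1 t)) !(bf_scll _ (c2 t)) !(bf_sclr _ (c1 t)) !(bf_sclr _ (c2 t)) !bf_kap.
  have -> : (0 : C) = c * (c^* * kk a a a) + c * ((- c)^* * kk a a a) +
    (- c * (c^* * kk a a a) + - c * ((- c)^* * kk a a a)) by rewrite rmorphN; ring.
  by do 2?apply: tendsD; apply: tendsM => //; apply: tendsM; try exact: tendsJ; apply: tends_kk.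
pose x t := scl (De t)^-1 (scl 1 (kap a t.1) ++ scl (-1) (kap a t.2)).
apply: (@sing_of_tends _ P x).
- by move=> d d0; have [w [v hwv]] := hf d d0; exists (w, v).
- move=> d t [[wD _] [vD _] _ _ _] z; rewrite mem_pts_scl mem_pts_cat !mem_pts_scl !inE.
  by move=> /orP[] /orP[] /eqP ->.
- apply: (@tends_ext _ _ _ (fun t => ((De t)^-1 * ((De t)^-1)^*) *
     bf sz (scl 1 (kap a t.1) ++ scl (-1) (kap a t.2))
      (scl 1 (kap a t.1) ++ scl (-1) (kap a t.2)))).
    by move=> t; rewrite -mulrA -bf_sclr -bf_scll.
  apply: (@tends_bdd0 _ _ _ _ _ (eps^-1 * eps^-1)); first by move=> d t _; apply: Db.
  by apply: (t0 (fun=> 1) (fun=> -1) 1); apply: tends_cst.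
apply: (@tends_extP _ _ _ (fun t => ((De t)^-1 * ((De t)^-1)^*) *
     bf sz (scl (h t.1) (kap a t.1) ++ scl (- h t.2) (kap a t.2))
      (scl (h t.1) (kap a t.1) ++ scl (- h t.2) (kap a t.2)))).
  move=> d t d0 Pt; have k0 := Dn d t Pt; case: Pt => [[wD wa] [vD va] _ _ _].
  rewrite -mulrA -bf_sclr -bf_scll; apply: bf_lineq => F.
  have wa0 : t.1 - a != 0 by rewrite subr_eq0.
  have va0 : t.2 - a != 0 by rewrite subr_eq0.
  rewrite /x /lin !big_cons !big_nil /=.
  have -> : h t.1 = (De t + (h t.2 - h a) / (t.2 - a)) * (t.1 - a) + h a.
    by rewrite /De; field; rewrite wa0 va0.
  by field; rewrite wa0 va0 k0.
apply: (@tends_bdd0 _ _ _ _ _ (eps^-1 * eps^-1)); first by move=> d t _; apply: Db.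
by apply: (t0 _ _ (h a)) => //; apply: tendsN.
Qed.

End Singularities.

(** * Factorisation *)

Section Factorisation.
Variable R : realType.
Local Notation C := R[i].
Implicit Types (f g h S : C -> C) (a z w v : C) (A F : seq C).
Implicit Types X Y : set C.
Local Notation disc := [set z : C | nm z < 1].

Definition blA A z : C := \prod_(a <- A) bl a z.

Lemma bl_diff a z : nm a < 1 -> nm z < 1 -> diff_at (bl a) z.
Proof.
move=> aD zD; apply: diffM; first by apply: diffB; [apply: diff_id|apply: diff_cst].
apply: diffV; first exact: nm_lt1_neq0.
by apply: diffB; [apply: diff_cst|apply: diffM; [apply: diff_id|apply: diff_cst]].
Qed.

Lemma blA_diff A z : (forall a, a \in A -> nm a < 1) -> nm z < 1 -> diff_at (blA A) z.
Proof. by move=> hA zD; apply: diff_prod => a /hA aD; apply: bl_diff. Qed.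

Lemma blA_eq0 A z : (forall a, a \in A -> nm a < 1) -> nm z < 1 ->
  (blA A z == 0) = (z \in A).
Proof.
move=> hA zD; rewrite /blA prodf_seq_eq0; apply/hasP/idP => [[a aA] /=|zA].
  by rewrite (bl_eq0 (hA a aA) zD) => /eqP ->.
by exists z => //=; rewrite (bl_eq0 zD zD).
Qed.

Lemma negsys0 f X : negsys f X 0.
Proof. by exists (fun _ => [::]); split=> // c; rewrite (thinmx0 c) eqxx. Qed.

Lemma NS_singular f X a (kappa : nat) : (forall z, X z -> nm z < 1) -> nm a < 1 ->
  NS f X kappa -> singular f X a ->
  exists2 k', kappa = k'.+1 & NS (fun z => bl a z * f z) X k'.
Proof.
move=> XD aD hN hs.
(* The empty system for b_a f already yields one negative square of [f], so [kappa] is positive. *)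
have := hN _ (singular_step XD aD hs (negsys0 _ _)).
case: kappa hN => // k' hN _; exists k' => // k hk.
by have := hN _ (singular_step XD aD hs hk).
Qed.

Lemma NS_sub f g X Y (kappa : nat) : (forall z, X z -> Y z) -> (forall z, X z -> f z = g z) ->
  NS g Y kappa -> NS f X kappa.
Proof.
move=> XY fg hN k [y [yX nd]]; apply: hN; exists y; split; first by move=> i z /yX /XY.
suff <- : gram (ker f) y = gram (ker g) y by [].
apply/matrixP => i j; rewrite !mxE; apply: bf_ext => z w /yX Xz /yX Xw.
by rewrite /ker !fg.
Qed.

(** A negative definite Gram matrix survives small moves of its points, and [X] is dense in the
    disk. *)
Lemma NS_closure h X (kappa : nat) : codisc X -> (forall z, nm z < 1 -> cont_at h z) ->
  NS h X kappa -> NS h disc kappa.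
Proof.
move=> cX ch hN k [y [yD nd]]; apply: hN.
pose P (d : R) (tau : C -> C) := forall z, nm z < 1 -> X (tau z) /\ nm (tau z - z) < d.
have tid z : nm z < 1 -> tends P (fun tau => tau z) z.
  move=> zD e e0; exists e; split=> // d d0 de tau /(_ z zD)[_ h1].
  by apply: ltW; apply: lt_le_trans h1 de.
have th z : nm z < 1 -> tends P (fun tau => h (tau z)) (h z).
  move=> zD e e0; have [d [d0 hd]] := ch z zD e e0; exists d; split=> // d' d'0 d'd tau.
  move=> /(_ z zD)[Xt h1]; apply: hd; last exact: lt_le_trans h1 d'd.
  by case: cX => XD _; apply: XD.
have [de [de0 hde]] := negdef_open (gram_herm h y) nd.
have tg (ij : 'I_k * 'I_k) : tends P
    (fun tau => bf (ker h) (mv tau (y ij.1)) (mv tau (y ij.2))) (gram (ker h) y ij.1 ij.2).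
  rewrite mxE; apply: (@tends_bf _ _ P (fun tau => tau) (fun _ => h) h).
  move=> z; rewrite mem_cat => hz; have zD : nm z < 1 by case/orP: hz => /yD.
  by split=> //; [apply: tid|apply: th].
have [d [d0 hd]] := tends_all tg de0.
have /choice[tau htau] : forall z, exists x, nm z < 1 -> X x /\ nm (x - z) < d.
  move=> z; have [zD|zD] := boolP (nm z < 1); last by exists 0.
  by have [w [Xw _ wz]] := codisc_near cX zD d0; exists w.
exists (fun i => mv tau (y i)); split.
  move=> i z /mapP[p /mapP[q qy ->] ->] /=.
  by have [] := htau q.2 (yD i _ (map_f snd qy)).
apply: hde; first exact: gram_herm.
by move=> i j; rewrite [X in X - _]mxE; exact: (hd d d0 (lexx d) tau htau (i, j)).
Qed.

(* Points near the circle where |h| > M > 1 give negative squares, and are asymptotically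
   orthogonal to any fixed combination. *)
Lemma boundary_growth h (M : R) : 1 < M ->
  (forall r : R, r < 1 -> exists z, [/\ r < nm z, nm z < 1 & M < nm (h z)]) ->
  forall k, negsys h disc k.
Proof.
move=> M1 hh; elim=> [|k [y [yD nd]]]; first exact: negsys0.
apply: (negsys_extend yD (gram_herm h y) nd) => de de0.
pose wt l : R := \sum_(p <- l) nm p.1 * ((1 + nm (h p.2)) / (1 - nm p.2)).
have wt0 i : 0 <= wt (y i).
  rewrite /wt big_seq; apply: sumr_ge0 => p py; rewrite mulr_ge0 ?nm_ge0 // divr_ge0 //.
    by have := nm_ge0 (h p.2); lra.
  by rewrite subr_ge0 ltW //; apply: (yD i); apply: map_f.
pose B := \sum_i wt (y i).
have B0 : 0 <= B by apply: sumr_ge0.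
have wB i : wt (y i) <= B by rewrite /B (bigD1 i) //= lerDl; apply: sumr_ge0.
pose q := 1 - M^-1 ^+ 2.
have Mi : 0 < M^-1 by rewrite invr_gt0; lra.
have q0 : 0 < q by rewrite subr_gt0 expr_lt1 ?ltW // invf_lt1 //; lra.
(* Makes B^2 (1 - |z|^2) / q at most [de], by 1 - |z|^2 <= 2 (1 - |z|). This bounds Q(y_i, x) Q(x,
   y_j) / Q(x, x): [wt] bounds the first two factors by multiples of |h(z)|, and q <= (|h(z)|^2 - 1)
   / |h(z)|^2. *)
pose r := 1 - de * q / (2 * (B ^+ 2 + 1)).
have B2 : 0 < 2 * (B ^+ 2 + 1) by have := exprn_ge0 2 B0; lra.
have [|z [rz zD hz]] := hh r; first by rewrite /r gtrBl divr_gt0 // mulr_gt0.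
have hz1 : 1 < nm (h z) by lra.
pose z2 := 1 - nm z ^+ 2.
have z20 : 0 < z2 by rewrite subr_gt0 expr_lt1 ?nm_ge0.
have z2le : z2 * B ^+ 2 <= de * q.
  have k1 : z2 <= 2 * (1 - nm z) by rewrite /z2; have := nm_ge0 z; nra.
  have k2 : 1 - nm z <= de * q / (2 * (B ^+ 2 + 1)) by rewrite /r in rz; lra.
  have k3 : z2 <= de * q / (B ^+ 2 + 1).
    have -> : de * q / (B ^+ 2 + 1) = 2 * (de * q / (2 * (B ^+ 2 + 1))).
      by field; apply/negP => /eqP e; have := exprn_ge0 2 B0; lra.
    lra.
  apply: le_trans (_ : z2 * (B ^+ 2 + 1) <= _); first by rewrite ler_pM2l // lerDl.
  by rewrite -ler_pdivlMr //; have := exprn_ge0 2 B0; lra.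
pose x : seq (C * C) := kpt z.
have Qxx : bf (ker h) x x = (((1 - nm (h z) ^+ 2) / z2)%:C)%C.
  by rewrite /bf !big_seq1 /= rmorph1 !mul1r ker_diag.
have neg : 1 - nm (h z) ^+ 2 < 0 by nra.
have Qyx i : nm (bf (ker h) (y i) x) <= wt (y i) * nm (h z).
  rewrite /bf big_seq; apply: le_trans (nm_sum _ _ _) _.
  rewrite /wt mulr_suml [leRHS]big_seq; apply: ler_sum => p py.
  have pD : nm p.2 < 1 by apply: (yD i); apply: map_f.
  rewrite big_seq1 /= rmorph1 mulr1 nmM -!mulrA ler_wpM2l ?nm_ge0 // /ker nmM nmV.
  have d1 : 1 - nm p.2 <= nm (1 - p.2 * z^*).
    have := nmB_le1 (p.2 * z^*); rewrite nmM nmJ.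
    have : nm p.2 * nm z <= nm p.2 * 1 by rewrite ler_wpM2l ?nm_ge0 // ltW.
    lra.
  have d2 : 0 < 1 - nm p.2 by rewrite subr_gt0.
  rewrite [leRHS]mulrCA mulrC; apply: ler_pM; rewrite ?invr_ge0 ?nm_ge0 //.
    by rewrite lef_pV2 ?posrE //; apply: lt_le_trans d1.
  apply: le_trans (nmB _ _) _; rewrite nm1 nmM nmJ mulrDl mul1r lerD2r.
  exact: ltW.
exists x; split.
- by move=> w; rewrite inE => /eqP ->.
- by rewrite Qxx realc_lt0 nmulr_rlt0 // invr_gt0.
move=> i j; rewrite mxE addrAC subrr add0r nmN nmM nmV nmM Qxx nm_real.
rewrite (bf_conj (y j) x (kerC h)) nmJ.
have -> : `|(1 - nm (h z) ^+ 2) / z2| = (nm (h z) ^+ 2 - 1) / z2.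
  by rewrite normrM ltr0_norm // opprB gtr0_norm // invr_gt0.
have hp : 0 < nm (h z) ^+ 2 - 1 by lra.
rewrite invf_div mulrA ler_pdivrMr //.
have k1 : nm (bf (ker h) (y i) x) * nm (bf (ker h) (y j) x) <= B ^+ 2 * nm (h z) ^+ 2.
  have -> : B ^+ 2 * nm (h z) ^+ 2 = (B * nm (h z)) * (B * nm (h z)) by ring.
  by apply: ler_pM; rewrite ?nm_ge0 //; apply: le_trans (Qyx _) _; rewrite ler_wpM2r ?nm_ge0.
have k2 : q * nm (h z) ^+ 2 <= nm (h z) ^+ 2 - 1.
  rewrite /q mulrBl mul1r lerD2l lerN2 -exprMn.
  have hk : 1 <= M^-1 * nm (h z) by rewrite mulrC ler_pdivlMr ?mul1r ?ltW //; lra.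
  by rewrite -[1](expr1n _ 2) lerXn2r // nnegrE; lra.
apply: le_trans (_ : B ^+ 2 * nm (h z) ^+ 2 * z2 <= _); first by rewrite ler_wpM2r // ltW.
apply: le_trans (_ : de * (q * nm (h z) ^+ 2) <= _); last by rewrite ler_pM2l.
have -> : B ^+ 2 * nm (h z) ^+ 2 * z2 = z2 * B ^+ 2 * nm (h z) ^+ 2 by ring.
by rewrite [leRHS]mulrA ler_wpM2r ?exprn_ge0 ?nm_ge0.
Qed.

Lemma NS_bounded h (kappa : nat) : (forall z, nm z < 1 -> diff_at h z) -> NS h disc kappa ->
  forall z, nm z < 1 -> nm (h z) <= 1.
Proof.
move=> dh hN z zD; apply/ler_addgt0Pr => e e0.
have M1 : 1 < 1 + e by lra.
have [r [r1 hr]] : exists r : R, r < 1 /\ forall w, r < nm w -> nm w < 1 -> nm (h w) <= 1 + e.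
  apply: contrapT => hn; have := hN kappa.+1; rewrite ltnn => H; suff: False by [].
  suff /H : negsys h disc kappa.+1 by [].
  apply: (boundary_growth M1) => r r1.
  apply: contrapT => hn'; apply: hn; exists r; split=> // w rw wD.
  by rewrite leNgt; apply/negP => lt; apply: hn'; exists w.
apply: (@max_principle _ h (Num.max 0 r)) => //.
- by rewrite le_max lexx.
- by rewrite gt_max ltr01.
- by move=> w wD; apply/diff_atP/dh.
by move=> w; rewrite gt_max => /andP[_ rw] wD; apply: hr.
Qed.

Lemma nonsingular_limit f X a : codisc X -> nm a < 1 -> ~ singular f X a ->
  exists l, forall e : R, 0 < e -> exists d : R, 0 < d /\ forall w, X w ->
     nm (w - a) < d -> nm (f w - l) <= e.
Proof.
move=> cX aD ns; apply: cauchy_limit_at.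
  by move=> d d0; have [w [? ? ?]] := codisc_near cX aD d0; exists w.
have [M [r [r0 hr]]] : exists M r : R, 0 < r /\
    forall w, X w -> nm (w - a) < r -> nm (f w) <= M.
  apply: contrapT => hn; apply: ns; apply: unbounded_singular => // d M d0.
  apply: contrapT => hn'; apply: hn; exists M, d; split=> // w Xw wd.
  by rewrite leNgt; apply/negP => lt; apply: hn'; exists w.
move=> e e0; apply: contrapT => hn; apply: ns.
apply: (@jump_singular _ f X a M e) => //; first by exists r.
move=> d d0; apply: contrapT => hn'; apply: hn; exists d; split=> // w v Xw Xv wd vd.
by rewrite leNgt; apply/negP => lt; apply: hn'; exists w, v.
Qed.

Lemma nonsingular_diff h a : nm a < 1 -> cont_at h a -> ~ singular h disc a -> diff_at h a.
Proof.
move=> aD ch ns.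
pose Y := [set z : C | nm z < 1 /\ z != a].
pose dq w := (h w - h a) / (w - a).
have [M [r [r0 hr]]] : exists M r : R, 0 < r /\
    forall w, Y w -> nm (w - a) < r -> nm (h w - h a) <= M * nm (w - a).
  apply: contrapT => hn; apply: ns; apply: steep_singular => // d M d0.
  apply: contrapT => hn'; apply: hn; exists M, d; split=> // w [wD wa] wd.
  by rewrite leNgt; apply/negP => lt; apply: hn'; exists w.
have [l hl] : exists l, forall e : R, 0 < e -> exists d : R, 0 < d /\ forall w, Y w ->
     nm (w - a) < d -> nm (dq w - l) <= e.
  apply: cauchy_limit_at.
    move=> d d0; have [w [w1 w2 w3]] := near_avoid [::] d0 aD.
    by exists w; split=> //; split=> //; rewrite inE in w3.
  move=> e e0; apply: contrapT => hn; apply: ns.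
  apply: (@kink_singular _ h a e) => // d d0.
  apply: contrapT => hn'; apply: hn; exists d; split=> // w v Yw Yv wd vd.
  by rewrite leNgt; apply/negP => lt; apply: hn'; exists w, v.
exists (fun w => if w == a then l else dq w).
  move=> e e0; have [d [d0 hd]] := hl e e0; exists d; split=> // w wD wd.
  rewrite eqxx; have [_|wa] := eqVneq w a; first by rewrite subrr nm0 ltW.
  exact: hd.
move=> w wD; have [->|wa] := eqVneq w a; first by rewrite !subrr mulr0.
by rewrite /dq divfK // subr_eq0.
Qed.

(* Every point where f, or its continuous extension, fails to be differentiable costs one
   negative square, so after finitely many factors b_a nothing is left to fix. *)
Lemma NS_factor (kappa : nat) f X : codisc X -> NS f X kappa ->
  exists A h, [/\ forall a, a \in A -> nm a < 1,
    forall z, nm z < 1 -> diff_at h z, forall z, nm z < 1 -> nm (h z) <= 1 &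
    forall z, X z -> blA A z * f z = h z].
Proof.
elim/ltn_ind: kappa f X => kappa IH f X cX hN; have [XD _] := cX.
(* Used twice: for [f] on [X] and, once [f] has no singular point, for its continuous extension on
   the whole disk. *)
have step a g Y : codisc Y -> nm a < 1 -> NS g Y kappa -> singular g Y a ->
    exists A h, [/\ forall a, a \in A -> nm a < 1,
    forall z, nm z < 1 -> diff_at h z, forall z, nm z < 1 -> nm (h z) <= 1 &
    forall z, Y z -> blA A z * g z = h z].
  move=> cY aD gN sa; have [k' e gN'] := NS_singular cY.1 aD gN sa.
  have [|A [h [hA hd h1 hh]]] := IH k' _ _ _ cY gN'; first by rewrite e.
  exists (a :: A), h; split=> //.
    by move=> b; rewrite inE => /orP[/eqP ->|/hA].
  by move=> z Yz; rewrite -hh // /blA big_cons; ring.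
have [[a [aD sa]]|ns] := pselect (exists a, nm a < 1 /\ singular f X a).
  exact: step sa.
have /choice[h hh] : forall a, exists l, nm a < 1 -> forall e : R, 0 < e ->
    exists d : R, 0 < d /\ forall w, X w -> nm (w - a) < d -> nm (f w - l) <= e.
  move=> a; have [aD|aD] := boolP (nm a < 1); last by exists 0.
  have [|l hl] := @nonsingular_limit f X a cX aD; last by exists l.
  by move=> sa; apply: ns; exists a.
have hf z : X z -> f z = h z.
  move=> Xz; apply/eqP; rewrite -subr_eq0 -nm_eq0 eq_le nm_ge0 andbT.
  apply/ler_addgt0Pr => e e0; rewrite add0r.
  have [d [d0 hd]] := hh z (XD z Xz) e e0.
  by apply: hd => //; rewrite subrr nm0.
have ch z : nm z < 1 -> cont_at h z.
  move=> zD e e0; have e2 : 0 < e / 2 by lra.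
  have [d [d0 hd]] := hh z zD _ e2; exists (d / 2); split; first by lra.
  move=> w wD wz; have [d' [d'0 hd']] := hh w wD _ e2.
  have m0 : 0 < Num.min d' (d / 2) by rewrite lt_min d'0; lra.
  have [x [Xx _]] := codisc_near cX wD m0; rewrite lt_min => /andP[x1 x2].
  have k1 := hd' x Xx x1.
  have k2 : nm (f x - h z) <= e / 2.
    by apply: hd => //; apply: le_lt_trans (nm_triang _ w _) _; lra.
  by apply: le_trans (nm_triang _ (f x) _) _; rewrite [X in X + _]nmBC; lra.
have hN' : NS h X kappa := NS_sub (fun z Xz => Xz) (fun z Xz => esym (hf z Xz)) hN.
have {}hN' := NS_closure cX ch hN'.
have [[a [aD sa]]|ns'] := pselect (exists a, nm a < 1 /\ singular h disc a).
  have [A [g [hA hd h1 hg]]] := step _ _ _ (codisc_disc R) aD hN' sa.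
  by exists A, g; split=> // z Xz; rewrite -hg ?hf //; apply: XD.
have dh z : nm z < 1 -> diff_at h z.
  by move=> zD; apply: nonsingular_diff (ch z zD) _ => // sg; apply: ns'; exists z.
exists [::], h; split=> //; first exact: NS_bounded hN'.
by move=> z Xz; rewrite /blA big_nil mul1r hf.
Qed.

(** Common zeros of [blA A] and [h] are cancelled one by one. Cancelling [bl a] loses the equation
    at [a] itself, where [f] is then unconstrained; these points are collected in [F] as candidates
    for jumps. *)
Lemma factor_reduce A h (X : set C) f : (forall a, a \in A -> nm a < 1) ->
  (forall z, nm z < 1 -> diff_at h z) -> (forall z, nm z < 1 -> nm (h z) <= 1) ->
  (forall z, X z -> blA A z * f z = h z) -> (forall z, X z -> nm z < 1) ->
  exists A' F S, [/\ forall a, a \in A' -> nm a < 1, schur S,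
    forall a, a \in A' -> S a != 0 &
    forall z, X z -> z \notin F -> blA A' z * f z = S z].
Proof.
move=> hA dh h1 hf XD.
have {hf} : forall z, X z -> z \notin [::] -> blA A z * f z = h z by move=> z Xz _; apply: hf.
move: [::] => F; move: {2}(size A) (erefl (size A)) => n.
elim: n A F h hA dh h1 => [|n IH] A F h hA dh h1 sA hf.
  move: sA => /size0nil A0; exists A, F, h; split=> //; last by rewrite A0.
  by apply: (@class_schur _ [::]) => // z zD; split=> [|_]; [apply: diff_cont|]; apply: dh.
have [/hasP[a aA /eqP ha]|/hasPn hn] := boolP (has (fun a => h a == 0) A); last first.
  exists A, F, h; split=> //.
  by apply: (@class_schur _ [::]) => // z zD; split=> [|_]; [apply: diff_cont|]; apply: dh.
have aD := hA a aA.
have [Phi cPhi hPhi] := dh a aD.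
have hP w : nm w < 1 -> h w = Phi w * (w - a) by move=> /hPhi; rewrite ha subr0.
pose k w := Phi w * (1 - w * a^*).
have kE w : nm w < 1 -> k w * bl a w = h w.
  by move=> wD; rewrite hP // /k /bl; field; apply: nm_lt1_neq0.
have Phi_off w : nm w < 1 -> w != a -> Phi w = h w / (w - a).
  by move=> wD wa; rewrite hP // mulfK // subr_eq0.
have dlin z : diff_at (fun x => 1 - x * a^*) z.
  by apply: diffB; [apply: diff_cst|apply: diffM; [apply: diff_id|apply: diff_cst]].
have ck : class_fun [:: a] k.
  move=> z zD; split.
    apply: contM; last exact: diff_cont.
    have [->//|za] := eqVneq z a.
    have [d [d0 hd]] := cont_eq_off za zD Phi_off.
    apply: (cont_ext d0 zD hd); apply: contM; first exact/diff_cont/dh.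
    apply: contV; first by rewrite subr_eq0.
    by apply: contB; [apply: cont_id|apply: cont_cst].
  rewrite inE => za; apply: diffM => //.
  have [d [d0 hd]] := cont_eq_off za zD Phi_off.
  apply: (diff_ext d0 zD hd); apply: diffM; first exact: dh.
  apply: diffV; first by rewrite subr_eq0.
  by apply: diffB; [apply: diff_id|apply: diff_cst].
have k1 z : nm z < 1 -> nm (k z) <= 1.
  move=> zD; apply/ler_addgt0Pr => e e0.
  have M1 : 1 < 1 + e by lra.
  have [r0 [r00 r01 hr]] := bl_boundary aD M1.
  apply: (class_max_principle r00 r01 _ ck _ zD); first by lra.
  move=> w w0 wD; have h2 := hr w w0 wD.
  have p2 : 0 < nm (bl a w).
    by rewrite lt_neqAle nm_ge0 andbT eq_sym; apply: contraTneq h2 => ->; rewrite mulr0 ler10.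
  by rewrite -(ler_pM2r p2) -nmM kE //; apply: le_trans (h1 w wD) h2.
have [ak _] := class_schur ck k1.
apply: (IH (rem a A) (a :: F) k) => //.
- by move=> b /mem_rem /hA.
- exact/analytic_diff.
- by rewrite size_rem // sA.
move=> z Xz; rewrite inE negb_or => /andP[za zF].
have zD := XD z Xz; have := hf z Xz zF; rewrite -(kE z zD).
rewrite /blA (perm_big _ (perm_to_rem aA)) big_cons /= mulrC mulrA => e.
have b0 : bl a z != 0 by rewrite bl_eq0.
by apply: (mulIf b0); rewrite -e; ring.
Qed.

(* Each pole, then each jump, is peeled off by one [singular_step]. *)
Lemma NS_lower A J h f X (kappa : nat) : codisc X -> NS f X kappa ->
  (forall a, a \in A -> nm a < 1) -> uniq J -> (forall z, z \in J -> X z) ->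
  (forall z, nm z < 1 -> cont_at h z) -> (forall a, a \in A -> h a != 0) ->
  (forall z, X z -> z \notin J -> blA A z * f z = h z) ->
  (forall z, z \in J -> blA A z * f z != h z) ->
  (size A + size J <= kappa)%N.
Proof.
move=> cX; have [XD _] := cX.
have avoid a (d : R) : nm a < 1 -> 0 < d ->
    exists w, [/\ X w, w \notin a :: (A ++ J) & nm (w - a) < d].
  move=> aD d0; have [_ hX] := cX; have [r [r0 hr]] := hX a aD.
  have [|w [_ h1 h2]] := @near_avoid _ (A ++ J) a (Num.min d r) _ aD; first by rewrite lt_min d0.
  move: h1; rewrite lt_min => /andP[h1 h1']; exists w; split=> //.
  by apply: hr => //; move: h2; rewrite inE negb_or => /andP[].
elim: A f kappa avoid => [|a A IH] f kappa avoid hN hA uJ JX ch hn hf hJ.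
  rewrite add0n.
  have {}avoid a (d : R) : nm a < 1 -> 0 < d ->
      exists w, [/\ X w, w \notin a :: J & nm (w - a) < d].
    by move=> aD d0; have := avoid a d aD d0.
  have {}hf z : X z -> z \notin J -> f z = h z.
    by move=> Xz zJ; rewrite -hf // /blA big_nil mul1r.
  have {}hJ z : z \in J -> f z != h z by move=> /hJ; rewrite /blA big_nil mul1r.
  elim: J f h kappa avoid hN uJ JX ch hf hJ {hA hn} => [//|a J IH] f h kappa avoid hN.
  move=> /= /andP[aJ uJ] JX ch hf hJ.
  have Xa : X a by apply: JX; rewrite inE eqxx.
  have aD := XD a Xa.
  have fa : f a != h a by apply: hJ; rewrite inE eqxx.
  have e0 : 0 < nm (f a - h a) by rewrite nm_gt0 subr_eq0.
  have near (e d : R) : 0 < e -> 0 < d ->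
      exists w, [/\ X w, nm (w - a) < d & nm (f w - h a) <= e].
    move=> e1 d0; have [d' [d'0 hd']] := ch a aD e e1.
    have [|w [Xw wJ]] := avoid a (Num.min d d') aD; first by rewrite lt_min d0.
    rewrite lt_min => /andP[w1 w2]; exists w; split=> //.
    rewrite hf //; last by move: wJ; rewrite inE negb_or => /andP[].
    by apply: hd' => //; apply: XD.
  have sg : singular f X a.
    have [[M [r [r0 hr]]]|nb] := pselect (exists M r : R, 0 < r /\
        forall w, X w -> nm (w - a) < r -> nm (f w) <= M); last first.
      apply: unbounded_singular => // d M d0.
      apply: contrapT => hn'; apply: nb; exists M, d; split=> // w Xw wd.
      by rewrite leNgt; apply/negP => lt; apply: hn'; exists w.
    (* Compare [f a] with values [f w] that are within half of the gap [nm (f a - h a)] of [h a]: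
       they differ by more than a third of it. *)
    apply: (@jump_singular _ f X a M (nm (f a - h a) / 3)) => //; first by lra.
      by exists r.
    move=> d d0; have [||w [Xw wd hw]] := near (nm (f a - h a) / 2) d; [lra|done|].
    exists a, w; split=> //; first by rewrite subrr nm0.
    have := nm_triang (f a) (f w) (h a); lra.
  have [k' -> hN'] := NS_singular XD aD hN sg.
  (* After multiplication by [bl a] both sides vanish at [a], which leaves the list of jumps; the
     other jumps persist because [bl a] is nonzero there. *)
  rewrite ltnS; apply: (IH (fun z => bl a z * f z) (fun z => bl a z * h z)) => //.
  - move=> b d bD d0; have [w [Xw wJ wd]] := avoid b d bD d0; exists w; split=> //.
    by move: wJ; rewrite !inE !negb_or => /and3P[-> _ ->].
  - by move=> z zJ; apply: JX; rewrite inE zJ orbT.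
  - by move=> z zD; apply: contM; [apply/diff_cont/bl_diff|apply: ch].
  - move=> z Xz zJ; have [->|za] := eqVneq z a; first by rewrite /bl subrr !mul0r.
    by rewrite hf // inE negb_or za.
  - move=> z zJ; have zz : z != a by apply: contraNneq aJ => <-.
    have zD : nm z < 1 by apply/XD/JX; rewrite inE zJ orbT.
    have b0 : bl a z != 0 by rewrite bl_eq0.
    rewrite (inj_eq (mulfI b0)); apply: hJ; by rewrite inE zJ orbT.
have aD : nm a < 1 by apply: hA; rewrite inE eqxx.
have sg : singular f X a.
  apply: unbounded_singular => // d M d0.
  have ha : h a != 0 by apply: hn; rewrite inE eqxx.
  have h0 : 0 < nm (h a) by rewrite nm_gt0.
  have cB : cont_at (blA (a :: A)) a by apply/diff_cont/blA_diff.
  (* Near [a] the product has modulus at most [e] and [h] at least [nm (h a) / 2], so [nm (f w)] is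
     at least |M| + 1. *)
  pose e := nm (h a) / (2 * (`|M| + 1)).
  have M0 : 0 < 2 * (`|M| + 1) by have := normr_ge0 M; lra.
  have ep : 0 < e by rewrite divr_gt0.
  have [d1 [d10 hd1]] := cB e ep.
  have [|d2 [d20 hd2]] := ch a aD (nm (h a) / 2); first by lra.
  have [|w [Xw wA]] := avoid a (Num.min d (Num.min d1 d2)) aD.
    by rewrite !lt_min d0 d10.
  rewrite !lt_min => /and3P[w1 w2 w3]; exists w; split=> //.
  have wD := XD w Xw.
  have hwA : w \notin a :: A /\ w \notin J.
    move: wA; rewrite !inE mem_cat !negb_or => /and4P[-> _ -> ->].
    by [].
  have ba : blA (a :: A) a = 0 by apply/eqP; rewrite blA_eq0 // inE eqxx.
  have bw : blA (a :: A) w != 0 by rewrite blA_eq0 // hwA.1.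
  have k1 := hd1 w wD w2; rewrite ba subr0 in k1.
  have k2 := hd2 w wD w3.
  have k3 : nm (h a) / 2 <= nm (h w).
    have := nmB (h w) (h w - h a); rewrite (_ : h w - (h w - h a) = h a); last by ring.
    lra.
  have k4 : nm (blA (a :: A) w) * nm (f w) = nm (h w).
    by rewrite -nmM hf // hwA.2.
  have k5 : nm (h a) / 2 <= e * nm (f w).
    by apply: le_trans k3 _; rewrite -k4 ler_wpM2r ?nm_ge0.
  have k6 : `|M| + 1 <= nm (f w).
    move: k5; rewrite /e mulrAC ler_pdivlMr // => k5.
    rewrite -(ler_pM2l h0); lra.
  by have := ler_norm M; lra.
have [k' -> hN'] := NS_singular XD aD hN sg.
(* One copy of the pole is absorbed by [bl a], and [h] stays the same. *)
rewrite addSn ltnS; apply: (IH (fun z => bl a z * f z)) => //.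
- move=> b d bD d0; have [w [Xw wJ wd]] := avoid b d bD d0; exists w; split=> //.
  by move: wJ; rewrite !inE !mem_cat !negb_or => /and3P[-> _ ->].
- by move=> b bA; apply: hA; rewrite inE bA orbT.
- by move=> b bA; apply: hn; rewrite inE bA orbT.
- by move=> z Xz zJ; rewrite mulrA [_ * bl a z]mulrC; have := hf z Xz zJ; rewrite /blA big_cons.
by move=> z zJ; rewrite mulrA [_ * bl a z]mulrC; have := hJ z zJ; rewrite /blA big_cons.
Qed.

End Factorisation.

(** * Blaschke products *)

Section Blaschke.
Variable R : realType.
Local Notation C := R[i].
Implicit Types (p q : {poly C}) (a z w : C) (A : seq C).

Lemma horner_diff p z : diff_at (fun w => p.[w]) z.
Proof.
elim/poly_ind: p => [|p c IH].
  by under [X in diff_at X]funext do rewrite horner0; apply: diff_cst.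
under [X in diff_at X]funext do rewrite hornerMXaddC.
by apply: diffD; [apply: diffM => //; apply: diff_id|apply: diff_cst].
Qed.

(** Cayley transform of the natural numbers: infinitely many explicit points of the unit circle,
    enough to identify polynomials. *)
Definition circle_pt (k : nat) : C := (1 + k%:R * 'i%C) / (1 - k%:R * 'i%C).

Lemma circle_pt_den k : 1 - k%:R * 'i%C != 0 :> C.
Proof.
have e : (1 - k%:R * 'i%C) * (1 + k%:R * 'i%C) = (1 + k ^ 2)%:R :> C.
  rewrite natrD natrX; transitivity (1 - k%:R ^+ 2 * 'i%C ^+ 2 : C); first by ring.
  by rewrite sqr_i; ring.
apply/negP => /eqP e0; move: e; rewrite e0 mul0r => /esym/eqP.
by rewrite pnatr_eq0.
Qed.

Lemma nm_circle_pt k : nm (circle_pt k) = 1.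
Proof.
have iJ : ('i%C : C)^* = - 'i%C by rewrite complexiE conjCi.
have e : (1 + k%:R * 'i%C : C) = (1 - k%:R * 'i%C)^*.
  by rewrite rmorphB rmorphM /= rmorph1 rmorph_nat iJ mulrN opprK.
by rewrite nmM nmV e nmJ divff // gt_eqF // nm_gt0 circle_pt_den.
Qed.

Lemma circle_pt_inj : injective circle_pt.
Proof.
move=> k l /eqP; rewrite /circle_pt eqr_div ?circle_pt_den // => /eqP e.
have : (2 * 'i%C) * (k%:R - l%:R : C) = 0.
  transitivity ((1 + k%:R * 'i%C) * (1 - l%:R * 'i%C) - (1 + l%:R * 'i%C) * (1 - k%:R * 'i%C) : C).
    by ring.
  by rewrite e subrr.
have i0 : ('i%C : C) != 0 by rewrite complexiE neq0Ci.
move/eqP; rewrite !mulf_eq0 (negbTE i0) pnatr_eq0 /= subr_eq0 eqr_nat => /eqP //.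
Qed.

Lemma poly_eq_circle p q : (forall z, nm z = 1 -> p.[z] = q.[z]) -> p = q.
Proof.
move=> h; apply/eqP; rewrite -subr_eq0; apply/negP => /negP pq.
have := @max_poly_roots _ (p - q) [seq circle_pt k | k <- iota 0 (size (p - q)%R)] pq.
rewrite (map_inj_uniq circle_pt_inj) iota_uniq size_map size_iota ltnn => H.
suff: false by []; apply: H => //; apply/allP => z /mapP[k _ ->].
by rewrite rootE hornerD hornerN h ?subrr // nm_circle_pt.
Qed.

(** The reciprocal polynomial: on the circle it turns conjugation into multiplication by a power of
    z ([conj_prod_circle]). *)
Definition revp A : {poly C} := \prod_(a <- A) (1 - a^* *: 'X).

Lemma horner_revp A z : (revp A).[z] = \prod_(a <- A) (1 - z * a^*).
Proof.
rewrite horner_prod; apply: eq_bigr => a _.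
by rewrite hornerD hornerN hornerZ hornerX hornerC mulrC.
Qed.

Lemma horner_factor p z : p.[z] = lead_coef p * \prod_(a <- roots_mult p) (z - a).
Proof.
rewrite {1}(roots_multE p) hornerZ horner_prod; congr (_ * _).
by apply: eq_bigr => a _; rewrite hornerXsubC.
Qed.

Lemma root_roots_mult p z : p != 0 -> root p z = (z \in roots_mult p).
Proof.
move=> p0; rewrite rootE horner_factor mulf_eq0 lead_coef_eq0 (negbTE p0) /= prodf_seq_eq0.
apply/hasP/idP => [[a aA] /=|zA]; first by rewrite subr_eq0 => /eqP ->.
by exists z => //=; rewrite subrr.
Qed.

Lemma conj_prod_circle A z : nm z = 1 ->
  (\prod_(a <- A) (z - a))^* * z ^+ size A = (revp A).[z].
Proof.
move=> z1; have zz : z^* * z = 1 by rewrite mulrC mulJ_nm z1 expr1n.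
rewrite horner_revp rmorph_prod; elim: A => [|a A IH].
  by rewrite !big_nil mulr1.
rewrite !big_cons -IH exprS rmorphB /=.
transitivity ((z^* * z - z * a^*) * (\prod_(j <- A) (z - j)^* * z ^+ size A)); last by rewrite zz.
by rewrite /=; ring.
Qed.

Lemma nm_bl_circle a z : nm a < 1 -> nm z = 1 -> nm (bl a z) = 1.
Proof.
move=> aD z1; have := mobius_id z a; rewrite z1 expr1n subrr mul0r => /eqP.
rewrite subr_eq0 => /eqP e.
have d0 : 0 < nm (1 - z * a^*).
  by have := nmB_le1 (z * a^*); rewrite nmM nmJ z1 mul1r; lra.
have e' : nm (1 - z * a^*) = nm (z - a).
  by apply/eqP; rewrite -(@eqrXn2 _ 2) ?nm_ge0 // e.
by rewrite nm_bl -e' divff // gt_eqF.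
Qed.

(* On the circle |p|^2 = |q|^2 reads p p~ X^m = q q~ X^n; the location of the roots then
   forces q to be a multiple of p~. *)
Lemma blaschke_prod p q : blaschke p q -> exists u : C, [/\ nm u = 1,
  forall a, a \in roots_mult p -> nm a < 1 &
  forall z, nm z < 1 -> ratfun p q z = u * blA (roots_mult p) z].
Proof.
move=> [q0 cpq an uni].
have uni' z : nm z = 1 -> nm (ratfun p q z) = 1.
  by move=> z1; have := uni z; rewrite !nmE z1 => /(_ erefl) [].
have pqc z : nm z = 1 -> p.[z] != 0 /\ q.[z] != 0.
  move=> /uni'; rewrite /ratfun nmM nmV => h; rewrite -!nm_eq0; split.
    by apply: contra_eq_neq h => ->; rewrite mul0r eq_sym oner_eq0.
  by apply: contra_eq_neq h => ->; rewrite invr0 mulr0 eq_sym oner_eq0.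
have p0 : p != 0.
  by have [p1 _] := pqc 1 (nm1 R); apply: contraNneq p1 => ->; rewrite horner0.
have cqp : coprimep q p by rewrite coprimep_sym.
(* At a zero of [q] the quotient is 0 by the convention for division, while nearby |p| stays away
   from 0 and |q| is small: continuity would fail. *)
have qD z : nm z < 1 -> q.[z] != 0.
  move=> zD; apply/negP => /eqP qz.
  have rz : root q z by rewrite rootE qz.
  have pz : p.[z] != 0 := coprimep_root cqp rz.
  have cr : cont_at (ratfun p q) z by apply/diff_cont; apply: (analytic_diff _).1 an z zD.
  have pz0 : 0 < nm p.[z] by rewrite nm_gt0.
  have [d1 [d10 h1]] := cr 1 ltr01.
  have cp : cont_at (fun w => p.[w]) z by apply/diff_cont/horner_diff.
  have cq : cont_at (fun w => q.[w]) z by apply/diff_cont/horner_diff.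
  have [|d2 [d20 h2]] := cp (nm p.[z] / 3); first by lra.
  have [|d3 [d30 h3]] := cq (nm p.[z] / 3); first by lra.
  have [|w [wD]] := @near_avoid _ (roots_mult q) z (Num.min d1 (Num.min d2 d3)) _ zD.
    by rewrite !lt_min d10 d20.
  rewrite !lt_min inE negb_or => /and3P[w1 w2 w3] /andP[_].
  rewrite -root_roots_mult // rootE => qw.
  have := h1 w wD w1; have := h2 w wD w2; have := h3 w wD w3.
  rewrite /ratfun qz invr0 mulr0 !subr0 nmM nmV.
  rewrite ler_pdivrMr ?nm_gt0 // mul1r => k1 k2 k3.
  have := nmB p.[w] (p.[w] - p.[z]); rewrite (_ : p.[w] - (p.[w] - p.[z]) = p.[z]); last by ring.
  lra.
pose A := roots_mult p; pose D := roots_mult q.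
have Dout d : d \in D -> 1 < nm d.
  move=> dD; have rd : q.[d] = 0 by apply/eqP; rewrite -rootE root_roots_mult.
  rewrite ltNge le_eqVlt; apply/negP => /orP[/eqP /pqc[_]|/qD]; by rewrite rd eqxx.
pose pr := (lead_coef p)^* *: revp A; pose qr := (lead_coef q)^* *: revp D.
have prE z : nm z = 1 -> (p.[z])^* * z ^+ size A = pr.[z].
  by move=> z1; rewrite horner_factor rmorphM -mulrA conj_prod_circle // hornerZ.
have qrE z : nm z = 1 -> (q.[z])^* * z ^+ size D = qr.[z].
  by move=> z1; rewrite horner_factor rmorphM -mulrA conj_prod_circle // hornerZ.
have E : p * pr * 'X^(size D) = q * qr * 'X^(size A).
  apply: poly_eq_circle => z z1; rewrite !hornerM !hornerXn -prE // -qrE //.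
  have : p.[z] * (p.[z])^* = q.[z] * (q.[z])^*.
    rewrite !mulJ_nm; have := uni' z z1; rewrite nmM nmV => h.
    have [_ qz] := pqc z z1; congr ((_ ^+ 2)%:C)%C.
    by rewrite -[LHS](divfK (x := nm q.[z])) ?nm_eq0 // h mul1r.
  move: p.[z] (q.[z]) (z ^+ size A) (z ^+ size D) => x y s t e.
  transitivity (x * x^* * (s * t)); first by ring.
  by rewrite e; ring.
have Ain a : a \in A -> nm a < 1.
  move=> aA; have ra : p.[a] = 0 by apply/eqP; rewrite -rootE root_roots_mult.
  rewrite ltNge le_eqVlt; apply/negP => /orP[/eqP e|a1].
    by have [] := pqc a (esym e); rewrite ra eqxx.
  (* For a root [a] outside the closed disk, [E] forces a root of [qr] at [a], that is a root [d] of
     [q] with [a * d^*] equal to 1, against [Dout]. *)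
  have := congr1 (horner^~ a) E; rewrite /= !hornerM ra !mul0r hornerXn => /esym /eqP.
  have rt : root p a by rewrite rootE ra.
  have qa : q.[a] != 0 := coprimep_root cpq rt.
  have a0 : a != 0 by rewrite -nm_gt0; lra.
  rewrite !mulf_eq0 (negbTE qa) /= expf_eq0 (negbTE a0) andbF orbF hornerZ mulf_eq0.
  rewrite conjC_eq0 lead_coef_eq0 (negbTE q0) /= horner_revp prodf_seq_eq0.
  move=> /hasP[d dD] /=; rewrite subr_eq0 => /eqP /(congr1 (@nm R)).
  rewrite nm1 nmM nmJ; have := Dout d dD; nra.
have lp : (lead_coef p)^* != 0 by rewrite conjC_eq0 lead_coef_eq0.
have cX (r : {poly C}) n : r.[0] != 0 -> coprimep r 'X^n.
  by move=> r0; apply: coprimep_expr; rewrite coprimepX rootE.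
have pr0 : pr.[0] != 0.
  rewrite hornerZ horner_revp big1 ?mulr1 // => a _; by rewrite mul0r subr0.
have q00 : q.[0] != 0 by apply: qD; rewrite nm0.
(* [q] is coprime to [p] and to powers of X. Conversely the roots of [pr] lie outside the closed
   disk and those of [qr] inside it, so [pr] is coprime to [qr]. Hence [q] and [pr] are
   associates. *)
have dv1 : q %| pr.
  have : q %| p * pr * 'X^(size D) by rewrite E -mulrA dvdp_mulIl.
  by rewrite Gauss_dvdpl ?cX // Gauss_dvdpr // coprimep_sym.
have dv2 : pr %| q.
  have : pr %| q * qr * 'X^(size A) by rewrite -E mulrAC dvdp_mulIr.
  rewrite Gauss_dvdpl ?cX // Gauss_dvdpl //.
  apply/Pdiv.ClosedField.coprimepP => z; rewrite rootE hornerZ mulf_eq0 (negbTE lp) /=.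
  rewrite horner_revp prodf_seq_eq0 => /hasP[a aA] /=; rewrite subr_eq0 => /eqP e1.
  rewrite hornerZ mulf_neq0 ?conjC_eq0 ?lead_coef_eq0 // horner_revp prodf_seq_neq0.
  apply/allP => d dD /=; rewrite subr_eq0; apply/eqP => e2.
  have := congr1 (@nm R) e1; have := congr1 (@nm R) e2; rewrite nm1 !nmM !nmJ.
  by have := Ain a aA; have := Dout d dD; have := nm_ge0 z; have := nm_ge0 a; nra.
have /eqpf_eq[c c0 qE] : q %= pr by rewrite /eqp dv1 dv2.
pose u := lead_coef p / (c * (lead_coef p)^*).
have ratE z : ratfun p q z = u * blA A z.
  rewrite /ratfun qE hornerZ hornerZ horner_revp horner_factor -/A.
  have -> : blA A z = (\prod_(a <- A) (z - a)) / \prod_(a <- A) (1 - z * a^*).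
    by rewrite /blA /bl big_split /= prodfV.
  by rewrite /u !invfM; ring.
exists u; split=> //.
have := uni' 1 (nm1 R); rewrite ratE nmM nm_prod big_seq big1 ?mulr1 // => a aA.
by apply: nm_bl_circle; [apply: Ain|apply: nm1].
Qed.

Lemma blaschke_of A : (forall a, a \in A -> nm a < 1) ->
  exists p q, [/\ blaschke p q, blaschke_degree p q = size A &
    forall z, ratfun p q z = blA A z].
Proof.
move=> hA; pose p := \prod_(a <- A) ('X - a%:P); pose q := revp A.
have ratE z : ratfun p q z = blA A z.
  rewrite /ratfun horner_revp horner_prod.
  under eq_bigr do rewrite hornerXsubC.
  by rewrite /blA /bl big_split /= prodfV.
have qc z : nm z <= 1 -> q.[z] != 0.
  move=> z1; rewrite horner_revp prodf_seq_neq0; apply/allP => a /hA aD /=.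
  rewrite subr_eq0; apply/eqP => /(congr1 (@nm R)); rewrite nm1 nmM nmJ.
  by have := nm_ge0 a; have := nm_ge0 z; nra.
exists p, q; split=> //; first split.
- have := qc 0; rewrite nm0 ler01 => /(_ isT); apply: contraNneq => ->; by rewrite horner0.
- apply/Pdiv.ClosedField.coprimepP => z; rewrite rootE horner_prod prodf_seq_eq0.
  move=> /hasP[a aA] /=; rewrite hornerXsubC subr_eq0 => /eqP ->.
  by apply: qc; apply/ltW/hA.
- apply/analytic_diff => z zD; apply: (@diff_ext _ _ (blA A) _ 1) => //.
  exact: blA_diff.
- have n1 (w : C) : `|w| = 1 <-> nm w = 1 by rewrite nmE; split=> [[]|->].
  move=> z /n1 z1; apply/n1; rewrite ratE nm_prod big_seq big1 // => a aA.
  by apply: nm_bl_circle => //; apply: hA.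
rewrite /blaschke_degree (permP (roots_mult_prod A)); apply/eqP; rewrite -all_count.
by apply/allP => a /hA; rewrite nmE -(ltcR (nm a) 1).
Qed.

End Blaschke.

(** * Standard functions *)

Section StandardFunctions.
Variable R : realType.
Local Notation C := R[i].
Local Open Scope sesquilinear_scope.
Implicit Types (f g h S : C -> C) (a z w : C) (A : seq C) (l : seq (C * C)).
Implicit Types X : set C.
Local Notation disc := [set z : C | nm z < 1].

Fixpoint annihilated l (Fs : seq (C -> C)) : Prop :=
  if Fs is F :: Fs' then lin l F = 0 /\ annihilated l Fs' else True.

Lemma annihilated_cat l Fs Gs :
  annihilated l (Fs ++ Gs) <-> annihilated l Fs /\ annihilated l Gs.
Proof. by elim: Fs => [|F Fs IH] /=; [tauto|rewrite IH; tauto]. Qed.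

Lemma annihilated_nth l Fs :
  (forall i, (i < size Fs)%N -> lin l (nth (fun=> 0) Fs i) = 0) -> annihilated l Fs.
Proof.
elim: Fs => [//|F Fs IH] h /=; split; first exact: (h 0%N).
by apply: IH => i hi; apply: (h i.+1).
Qed.

Definition comb k (y : 'I_k -> seq (C * C)) (c : 'rV[C]_k) : seq (C * C) :=
  flatten [seq scl (c 0 i) (y i) | i <- enum 'I_k].

Lemma lin_comb k (y : 'I_k -> seq (C * C)) c F :
  lin (comb y c) F = \sum_i c 0 i * lin (y i) F.
Proof.
rewrite /lin /comb big_flatten big_map big_enum; apply: eq_bigr => i _.
by rewrite big_map mulr_sumr; apply: eq_bigr => p _; rewrite mulrA.
Qed.

Lemma bf_comb K k (y : 'I_k -> seq (C * C)) c :
  bf K (comb y c) (comb y c) = hq (gram K y) c.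
Proof.
have e1 m : bf K (comb y c) m = \sum_i c 0 i * bf K (y i) m.
  rewrite {1}/bf /comb big_flatten big_map big_enum; apply: eq_bigr => i _.
  by rewrite -bf_scll.
have e2 m : bf K m (comb y c) = \sum_i (c 0 i)^* * bf K m (y i).
  under [RHS]eq_bigr do rewrite -bf_sclr.
  rewrite /bf [RHS]exchange_big /=; apply: eq_bigr => p _.
  by rewrite /comb big_flatten big_map big_enum.
rewrite e1 /hq; apply: eq_bigr => i _; rewrite e2 mulr_sumr; apply: eq_bigr => j _.
by rewrite mxE mulrA.
Qed.

Lemma mem_pts_comb k (y : 'I_k -> seq (C * C)) c z :
  z \in pts (comb y c) -> exists i, z \in pts (y i).
Proof.
move=> /mapP[p /flattenP[s /mapP[i _ ->] ps] ->]; exists i.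
by rewrite -(mem_pts_scl (c 0 i)); apply: map_f.
Qed.

(** Each function of [Fs] imposes one linear condition, so the form is nonnegative on a subspace of
    codimension at most [size Fs]. *)
Lemma NS_upper f X (Fs : seq (C -> C)) :
  (forall l, (forall z, z \in pts l -> X z) -> annihilated l Fs -> 0 <= bf (ker f) l l) ->
  NS f X (size Fs).
Proof.
move=> hF k [y [yX nd]].
pose E : 'M[C]_(k, size Fs) := \matrix_(i, s) lin (y i) (nth (fun=> 0) Fs s).
apply: (@nonneg_codim _ k (size Fs) k (gram (ker f) y) E 1%:M).
  move=> x xE; rewrite -bf_comb; apply: hF.
    by move=> z /mem_pts_comb[i /yX].
  apply: annihilated_nth => i hi; rewrite lin_comb.
  have /rowP /(_ (Ordinal hi)) := xE; rewrite !mxE => e; rewrite -[RHS]e.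
  by apply: eq_bigr => j _; rewrite mxE.
by rewrite mul1mx trmx1 map_mx1 mulmx1.
Qed.

(* ker (blA A) is a combination of the rank-one kernels of these functions. *)
Fixpoint esys A : seq (C -> C) :=
  if A is a :: A' then (fun z => blA A' z * sz z a) :: esys A' else [::].

Lemma size_esys A : size (esys A) = size A.
Proof. by elim: A => //= a A ->. Qed.

Lemma blA_null A l : (forall a, a \in A -> nm a < 1) ->
  (forall z, z \in pts l -> nm z < 1) -> annihilated l (esys A) ->
  bf (ker (blA A)) l l = 0.
Proof.
elim: A => [|a A IH] hA lD /=.
  move=> _; rewrite (@bf_ext _ _ (fun _ _ => 0)); last first.
    by move=> z w _ _; rewrite /ker /blA !big_nil rmorph1 mulr1 subrr mul0r.
  by rewrite /bf big1 // => p _; rewrite big1 // => q _; rewrite mulr0.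
move=> [e0 eA].
have -> : bf (ker (blA (a :: A))) l l = bf (ker (fun z => bl a z * blA A z)) l l.
  by apply: bf_ext => z w _ _; rewrite /ker /blA !big_cons.
have aD : nm a < 1 by apply: hA; rewrite inE eqxx.
rewrite ker_mul_bl //; last by move=> z; rewrite mem_cat orbb => /lD.
rewrite IH ?add0r // => [|b bA]; last by apply: hA; rewrite inE bA orbT.
have -> : bf sz (tw (blA A) l) (kpt a) = 0.
  rewrite -[RHS]e0 /bf /lin big_map; apply: eq_bigr => p _.
  by rewrite big_seq1 /= rmorph1; ring.
by rewrite mul0r mulr0.
Qed.

(** The indicator functions force the total weight at each point of [Zs] to vanish, so the
    combination lives off [Zs]. *)
Lemma lin_filter (Zs : seq C) l F : uniq Zs ->
  annihilated l [seq (fun w => (w == z)%:R) | z <- Zs] ->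
  lin l F = lin [seq p <- l | p.2 \notin Zs] F.
Proof.
move=> uZ hl.
have e : \sum_(p <- l | p.2 \in Zs) p.1 * F p.2 = 0.
  transitivity (\sum_(z <- Zs) F z * lin l (fun w => (w == z)%:R)); last first.
    elim: Zs hl {uZ} => [|z Zs IH] /=; first by rewrite big_nil.
    by move=> [e0 /IH e1]; rewrite big_cons e0 mulr0 add0r.
  under [RHS]eq_bigr do rewrite /lin mulr_sumr.
  rewrite exchange_big /= big_mkcond; apply: eq_bigr => p _.
  have [pZ|pZ] := boolP (p.2 \in Zs).
    rewrite (bigD1_seq p.2) //= eqxx mulr1 [F _ * _]mulrC big1 ?addr0 // => z zp.
    by rewrite eq_sym (negbTE zp) !mulr0.
  rewrite big_seq big1 // => z zZ; case: eqP => [e|_]; last by rewrite !mulr0.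
  by rewrite e zZ in pZ.
rewrite /lin big_filter (bigID (fun p => p.2 \in Zs)) /= e add0r.
by [].
Qed.

(** One linear condition per jump removes the jump points, and one per zero of the Blaschke product
    kills its form once the weights are divided by [B]. What is left is the nonnegative form of
    [S]. *)
Lemma standard_upper f S X A (Zs : seq C) (u : C) : (forall z, X z -> nm z < 1) ->
  nm u = 1 -> (forall a, a \in A -> nm a < 1) -> schur S -> uniq Zs ->
  (forall z, X z -> z \notin Zs -> blA A z != 0 /\ f z = S z / (u * blA A z)) ->
  NS f X (size A + size Zs)%N.
Proof.
move=> XD u1 hA sS uZ hf.
pose B z := u * blA A z.
pose Fs := [seq (fun z => e z / B z) | e <- esys A] ++ [seq (fun w => (w == z)%:R) | z <- Zs].
have -> : (size A + size Zs)%N = size Fs by rewrite size_cat !size_map size_esys.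
apply: NS_upper => l lX /annihilated_cat[h1 h2].
pose l' := [seq p <- l | p.2 \notin Zs].
have l'X z : z \in pts l' -> X z /\ z \notin Zs.
  by move=> /mapP[p]; rewrite mem_filter => /andP[pZ pl] ->; split=> //; apply/lX/map_f.
rewrite (@bf_lineq _ _ l l') => [|F]; last exact: lin_filter.
pose l2 := tw (fun z => (B z)^-1) l'.
have u0 : u != 0 by rewrite -nm_gt0 u1.
have uu : u * u^* = 1 by rewrite mulJ_nm u1 expr1n.
have -> : bf (ker f) l' l' = bf (ker S) l2 l2 - bf (ker (blA A)) l2 l2.
  rewrite !bf_tw -[- _]mulN1r -bf_scale -bf_add; apply: bf_ext => z w.
  move=> /l'X[Xz zZ] /l'X[Xw wZ]; have [bz fz] := hf z Xz zZ; have [bw fw] := hf w Xw wZ.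
  have a1 := nm_lt1_neq0 (XD z Xz) (XD w Xw).
  have bw' : (blA A w)^* != 0 by rewrite conjC_eq0.
  have u0' : u^* != 0 by rewrite conjC_eq0.
  rewrite /ker fz fw /B !rmorphM !fmorphV !rmorphM /=.
  have -> : u^* = u^-1 by apply: (mulfI u0); rewrite uu divff.
  by field; rewrite a1 bz bw' u0.
have l2D z : z \in pts l2 -> nm z < 1 by rewrite mem_pts_tw => /l'X[/XD].
rewrite blA_null ?subr0 //.
  exact: schur_ker_ge0.
have e2 F : lin l2 F = lin l' (fun z => F z / B z).
  by rewrite /lin big_map; apply: eq_bigr => p _ /=; ring.
elim: (esys A) h1 => [//|F Es IH] /= [k1 /IH k2]; split=> //.
by rewrite e2 -(lin_filter _ uZ h2).
Qed.

(** Minimality stands in for attainment: [NS_lower] bounds every admissible [k] from below without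
    exhibiting a negative system. *)
Definition index_is f X (kappa : nat) := NS f X kappa /\
  forall k, NS f X k -> (kappa <= k)%N.

Lemma index_unique f X k k' : index_is f X k -> index_is f X k' -> k = k'.
Proof.
by move=> [h1 h2] [h3 h4]; apply/eqP; rewrite eqn_leq h2 // h4.
Qed.

Definition dom (L : set C) : set C := [set z | nm z < 1 /\ ~ L z].

Lemma NS_nodes L f (kappa : nat) : NS f (dom L) kappa <->
  forall n (z : 'I_n -> C), nodes L z -> (sq_minus (pick_matrix f z) <= kappa)%N.
Proof.
split=> [hN n z [_ zL]|h k [y [yX nd]]].
  by apply/hN/negsys_of_sq => i; have [/inDE] := zL i.
pose s := undup (flatten [seq pts (y i) | i <- enum 'I_k]).
have sy i z : z \in pts (y i) -> z \in s.
  move=> zy; rewrite mem_undup; apply/flattenP; exists (pts (y i)) => //.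
  by apply/mapP; exists i; rewrite ?mem_enum.
have sX z : z \in s -> dom L z.
  by rewrite mem_undup => /flattenP[_ /mapP[i _ ->] /yX].
have us : uniq s by apply: undup_uniq.
apply: leq_trans (sq_of_negsys us sy nd) (h _ _ _); split.
  by move=> i j /eqP; rewrite nth_uniq // => /eqP /val_inj.
by move=> i; have [/inDE] := sX _ (mem_nth 0 (ltn_ord i)).
Qed.

Lemma in_S_kappaE L f (kappa : nat) : discrete_set L ->
  in_S_kappa L f kappa <-> index_is f (dom L) kappa.
Proof.
move=> dL; split=> [[_ [ub [n [z [nz e]]]]]|[hN hl]].
  split; first exact/NS_nodes.
  by move=> k /NS_nodes /(_ n z nz); rewrite e.
split=> //; have ub := (NS_nodes L f kappa).1 hN; split=> //.
apply: contrapT => hn.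
case: kappa hN hl ub hn => [|k] hN hl ub hn.
  (* Index 0 is attained by the empty family of nodes. *)
  apply: hn; exists 0%N, (fun _ => 0); split; last first.
    by apply/eqP; rewrite -leqn0; apply: ub; split=> [[]|[]].
  by split=> [[]|[]].
have := hl k; rewrite ltnn => H; suff: false by [].
apply: H; apply/NS_nodes => n z nz; rewrite leqNgt; apply/negP => lt.
apply: hn; exists n, z; split=> //; apply/eqP; rewrite eqn_leq lt andbT.
exact: ub.
Qed.

Lemma standard_index L f g (Ws Zs : seq C) (nq : nat) : discrete_set L ->
  standard_function g Ws Zs nq ->
  (forall z, inD z -> ~ L z -> z \notin Ws /\ g z = f z) ->
  (forall z, z \in Zs -> ~ L z) ->
  index_is f (dom L) (nq + size Zs).
Proof.
move=> dL [S [p [q [[uZ _ ZD _ _] [[bpq dq sS] [[_ Zsub disj] [gE gJ]]]]]]] gf ZL.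
have [u [u1 Ain ratE]] := blaschke_prod bpq.
pose A := roots_mult p.
have dqA : nq = size A.
  rewrite -dq /blaschke_degree; apply/eqP; rewrite -all_count; apply/allP => a /Ain.
  by rewrite nmE -(ltcR (nm a) 1).
have u0 : u != 0 by rewrite -nm_gt0 u1.
have cX : codisc (dom L) by apply: discrete_codisc.
have hf z : dom L z -> z \notin Zs -> blA A z != 0 /\ f z = S z / (u * blA A z).
  move=> [zD zL] zZ; have /inDE zD' := zD; have [zW gz] := gf z zD' zL.
  have r0 : ratfun p q z != 0.
    apply/negP => /eqP r0; have : zeroset (ratfun p q) z by split.
    by move=> /Zsub /=; rewrite (negbTE zW) (negbTE zZ).
  rewrite -gz gE // ratE //; split=> //.
  by move: r0; rewrite ratE // mulf_eq0 negb_or => /andP[].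
rewrite dqA; split; first by apply: standard_upper hf => // z [].
move=> k hN.
apply: (@NS_lower _ A Zs (fun z => S z / u) f (dom L)) => //.
- by move=> z zZ; split; [apply/inDE/ZD|apply: ZL].
- move=> z zD; apply: contM; last exact: cont_cst.
  by apply/diff_cont; apply: (analytic_diff S).1 sS.1 z zD.
- move=> a aA; have aD := Ain a aA; have /inDE aD' := aD.
  rewrite mulf_neq0 ?invr_eq0 //; apply/negP => /eqP Sa.
  have : (zeroset (ratfun p q) `&` zeroset S) a.
    split; split=> //; rewrite ratE //.
    by apply/eqP; rewrite mulf_eq0 blA_eq0 // aA orbT.
  by rewrite disj.
- move=> z Xz zZ; have [b0 ->] := hf z Xz zZ.
  by field; rewrite u0 b0.
move=> z zZ; have zD' := ZD z zZ; have zD := (inDE z).1 zD'.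
have [zW gz] := gf z zD' (ZL z zZ).
(* At a jump that is also a pole the left side vanishes, while [S z] does not, because the zero sets
   are disjoint. *)
have [r0|r0] := eqVneq (ratfun p q z) 0.
  move: (r0); rewrite ratE // => /eqP; rewrite mulf_eq0 (negbTE u0) /= => /eqP ->.
  rewrite mul0r eq_sym mulf_neq0 ?invr_eq0 //; apply/negP => /eqP Sz.
  have : (zeroset (ratfun p q) `&` zeroset S) z by split.
  by rewrite disj.
have := gJ z zZ r0; rewrite gz ratE // => ne; apply: contraNneq ne => e.
move: r0; rewrite ratE // mulf_eq0 negb_or => /andP[_ b0].
have -> : S z = blA A z * f z * u by rewrite e divfK.
by apply/eqP; field; rewrite u0 b0.
Qed.

Lemma index_standard L f (kappa : nat) : discrete_set L -> index_is f (dom L) kappa ->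
  exists g (Ws Zs : seq C), [/\ (size Zs <= kappa)%N,
    standard_function g Ws Zs (kappa - size Zs)%N,
    (forall z, inD z -> ~ L z -> z \notin Ws /\ g z = f z) &
    (forall z, z \in Zs -> ~ L z)].
Proof.
move=> dL hi; have [hN _] := hi; have cX : codisc (dom L) by apply: discrete_codisc.
have [A0 [h [hA0 dh h1 hh]]] := NS_factor cX hN.
have [A [F [S [hA sS SA fS]]]] := factor_reduce hA0 dh h1 hh cX.1.
have [p [q [bpq dq ratE]]] := blaschke_of hA.
pose X := dom L.
(* Off the finite list [F ++ A] the function already equals S / blA on its domain. Zeros of [blA A]
   inside the domain become both poles and jumps; those in [L] go to [Ws]. *)
pose jump z := `[< X z >] && ((blA A z == 0) || (S z / blA A z != f z)).
pose Zs := undup [seq z <- F ++ A | jump z].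
pose Ws := undup [seq a <- A | `[< L a >]].
pose g z := if `[< X z >] then f z else S z / blA A z.
have ZsX z : z \in Zs -> X z.
  by rewrite mem_undup mem_filter => /andP[/andP[/asboolP]].
have WsP z : z \in Ws -> z \in A /\ L z.
  by rewrite mem_undup mem_filter => /andP[/asboolP].
have gf z : inD z -> ~ L z -> z \notin Ws /\ g z = f z.
  move=> /inDE zD zL; split; first by apply/negP => /WsP[_ /zL].
  by rewrite /g; case: asboolP => // /(_ (conj zD zL)).
have st : standard_function g Ws Zs (size A).
  exists S, p, q; split; [|split; [|split; [|split]]].
  - split; rewrite ?undup_uniq //.
    + by move=> z /ZsX [] /inDE.
    + by move=> z /WsP[/hA /inDE].
    + by move=> z /ZsX[_ zL]; apply/negP => /WsP[_ /zL].
  - by [].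
  - split.
    + move=> w /= /WsP[wA _]; have wD := hA w wA; split; first exact/inDE.
      by apply/eqP; rewrite ratE blA_eq0.
    + move=> z [/inDE zD /eqP]; rewrite ratE => b0 /=.
      have zA : z \in A by rewrite -(blA_eq0 hA).
      have [zL|zL] := pselect (L z).
        by apply/orP; left; rewrite mem_undup mem_filter zA andbT; apply/asboolP.
      apply/orP; right; rewrite mem_undup mem_filter mem_cat zA orbT andbT /jump b0 andbT.
      by apply/asboolP.
    + apply/seteqP; split=> // z [[/inDE zD /eqP]]; rewrite ratE blA_eq0 // => zA [_ Sz].
      by have := SA z zA; rewrite Sz eqxx.
  - move=> z /inDE zD zW zZ; rewrite ratE /g; case: asboolP => // Xz.
    have nj : ~~ jump z || (z \notin F ++ A).
      by move: zZ; rewrite mem_undup mem_filter negb_and.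
    have [zFA|zFA] := boolP (z \in F ++ A).
      move: nj; rewrite zFA orbF negb_and => /orP[/asboolP //|].
      by rewrite negb_or negbK => /andP[_ /eqP].
    move: zFA; rewrite mem_cat negb_or => /andP[zF zA].
    by rewrite -fS // [blA A z * _]mulrC mulfK // blA_eq0.
  - move=> z zZ; rewrite ratE => b0; rewrite /g.
    have Xz := ZsX z zZ; case: asboolP => // _.
    move: zZ; rewrite mem_undup mem_filter /jump (negbTE b0) /= => /andP[/andP[_]] //.
have ZL z : z \in Zs -> ~ L z by move=> /ZsX[].
(* The number of poles is not counted directly: the constructed function has index
   [size A + size Zs], and uniqueness of the index identifies this with [kappa]. *)
have hi2 := standard_index dL st gf ZL.
have -> := index_unique hi hi2.
by exists g, Ws, Zs; rewrite addnK; split=> //; apply: leq_addl.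
Qed.

End StandardFunctions.

(** * The Schur complement of a Pick matrix *)

Section SchurComplement.
Variable R : realType.
Local Notation C := R[i].
Local Open Scope sesquilinear_scope.
Variables (f : C -> C) (s : seq C).
Local Notation m := (size s).
Local Notation nd := (fun i : 'I_m => (s`_i)%R).
Let P : 'M[C]_m := pick_matrix f nd.
Hypothesis sD : forall z, z \in s -> nm z < 1.
Hypothesis Pu : P \in unitmx.
Implicit Types (z w : C) (l : seq (C * C)).

(* sc_e z = c(z) P^-1, where c(z) is the row of kernel values at the nodes, and sc_ker is
   the Schur complement of P in the Pick kernel. *)
Definition sc_e z : 'rV[C]_m := (\row_j ker f z s`_j) *m invmx P.

Definition sc_ker z w : C := ker f z w -
  \sum_i \sum_j sc_e z 0 i * (sc_e w 0 j)^* * P i j.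

Lemma ndD (i : 'I_m) : nm s`_i < 1.
Proof. by apply/sD/mem_nth. Qed.

Lemma sc_eP z j : \sum_i sc_e z 0 i * P i j = ker f z s`_j.
Proof.
have := mulmxKV Pu (\row_j ker f z s`_j) => /rowP /(_ j).
by rewrite mxE [RHS]mxE => <-.
Qed.

Lemma sc_ePc z j : \sum_i (sc_e z 0 i)^* * P j i = ker f s`_j z.
Proof.
rewrite (kerC f z s`_j) -sc_eP rmorph_sum; apply: eq_bigr => i _.
by rewrite rmorphM /= -(pick_herm f nd i j).
Qed.

Lemma sc_kerC z w : sc_ker w z = (sc_ker z w)^*.
Proof.
rewrite /sc_ker rmorphB /= -kerC; congr (_ - _).
rewrite rmorph_sum exchange_big /=; apply: eq_bigr => i _; rewrite rmorph_sum.
apply: eq_bigr => j _ /=; rewrite (pick_herm f nd i j) !rmorphM /= conjCK.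
by ring.
Qed.

Lemma sc_ker_node (i : 'I_m) w : sc_ker s`_i w = 0.
Proof.
have -> : sc_ker s`_i w = ker f s`_i w - \sum_k (sc_e w 0 k)^* * \sum_j sc_e s`_i 0 j * P j k.
  rewrite /sc_ker exchange_big; congr (_ - _); apply: eq_bigr => k _.
  by rewrite mulr_sumr; apply: eq_bigr => j _; ring.
apply/eqP; rewrite subr_eq0; apply/eqP; rewrite -sc_ePc; apply: eq_bigr => k _.
by rewrite sc_eP; congr (_ * _); rewrite /P mxE.
Qed.

Definition sc_d l : 'rV[C]_m := \row_i lin l (fun z => sc_e z 0 i).

Lemma sc_dE l i : sc_d l 0 i = lin l (fun z => sc_e z 0 i).
Proof. by rewrite mxE. Qed.

Lemma sc_PE i j : P i j = ker f s`_i s`_j.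
Proof. by rewrite /P mxE. Qed.

(* l minus its projection on the nodes. *)
Definition sc_hat l : seq (C * C) := l ++ [seq (- sc_d l 0 i, nd i) | i <- enum 'I_m].

Lemma bf_sc_hat_node l (j : 'I_m) : bf (ker f) (sc_hat l) (kpt s`_j) = 0.
Proof.
rewrite bf_catl /bf big_map big_enum /=.
under eq_bigr do rewrite big_seq1 /= rmorph1 mulr1.
under [X in _ + X]eq_bigr do rewrite big_seq1 /= rmorph1 mulr1 mulNr.
rewrite sumrN; apply/eqP; rewrite subr_eq0; apply/eqP.
under [LHS]eq_bigr do rewrite -sc_eP mulr_sumr.
rewrite exchange_big /=; apply: eq_bigr => i _; rewrite sc_dE /lin mulr_suml.
by apply: eq_bigr => p _; rewrite sc_PE mulrA.
Qed.

Lemma bf_nodes K l (c : 'I_m -> C) :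
  bf K l [seq (c i, nd i) | i <- enum 'I_m] = \sum_i (c i)^* * bf K l (kpt s`_i).
Proof.
rewrite /bf; under [LHS]eq_bigr do rewrite big_map big_enum.
rewrite exchange_big /=; apply: eq_bigr => i _; rewrite mulr_sumr; apply: eq_bigr => p _.
by rewrite big_seq1 /= rmorph1; ring.
Qed.

Lemma bf_sc_ker l l' : bf (ker f) l l' = bf sc_ker l l' +
  \sum_i \sum_j sc_d l 0 i * (sc_d l' 0 j)^* * P i j.
Proof.
have -> : bf sc_ker l l' = bf (ker f) l l' +
    bf (fun z w => - \sum_i \sum_j sc_e z 0 i * (sc_e w 0 j)^* * P i j) l l'.
  by rewrite -bf_add; apply: bf_ext.
rewrite -addrA [X in _ + X](_ : _ = 0) ?addr0 //; apply/eqP; rewrite addr_eq0; apply/eqP.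
rewrite -sumrN /bf.
transitivity (\sum_(p <- l) \sum_(q <- l') \sum_i \sum_j
   - (p.1 * sc_e p.2 0 i * (q.1 * sc_e q.2 0 j)^* * P i j)).
  apply: eq_bigr => p _; apply: eq_bigr => q _; rewrite mulrN mulr_sumr -sumrN.
  apply: eq_bigr => i _; rewrite mulr_sumr -sumrN; apply: eq_bigr => j _.
  by rewrite rmorphM /=; ring.
under eq_bigr do rewrite exchange_big.
rewrite exchange_big /=; apply: eq_bigr => i _.
under eq_bigr do rewrite exchange_big.
rewrite exchange_big -sumrN; apply: eq_bigr => j _ /=.
rewrite !sc_dE /lin rmorph_sum !mulr_suml -sumrN; apply: eq_bigr => p _.
by rewrite mulr_sumr mulr_suml -sumrN.
Qed.

Lemma bf_sc_hat l : bf (ker f) (sc_hat l) (sc_hat l) = bf sc_ker l l.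
Proof.
rewrite bf_sc_ker [X in _ + X](_ : _ = 0).
  rewrite addr0 bf_catl !bf_catr.
  have z0 l' (c : 'I_m -> C) : bf sc_ker l' [seq (c i, nd i) | i <- enum 'I_m] = 0.
    rewrite bf_nodes big1 // => i _; rewrite /bf big1 ?mulr0 // => p _.
    by rewrite big_seq1 sc_kerC sc_ker_node rmorph0 mulr0.
  set n := [seq _ | _ <- _]; have z1 l' : bf sc_ker l' n = 0 by apply: z0.
  have z2 : bf sc_ker n l = 0 by rewrite (bf_conj l _ sc_kerC) z1 rmorph0.
  by rewrite !z1 z2 !addr0.
have d0 : sc_d (sc_hat l) = 0.
  suff : sc_d (sc_hat l) *m P = 0 by move/(congr1 (mulmx^~ (invmx P))); rewrite mulmxK // mul0mx.
  apply/rowP => j; rewrite !mxE.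
  transitivity (\sum_i \sum_(p <- sc_hat l) p.1 * sc_e p.2 0 i * P i j).
    by apply: eq_bigr => i _; rewrite sc_dE /lin mulr_suml.
  rewrite exchange_big /=.
  transitivity (bf (ker f) (sc_hat l) (kpt s`_j)); last exact: bf_sc_hat_node.
  apply: eq_bigr => p _.
  rewrite big_seq1 /= rmorph1 mulr1 -sc_eP mulr_sumr; apply: eq_bigr => i _.
  by rewrite mulrA.
by rewrite d0 big1 // => i _; rewrite big1 // => j _; rewrite mxE !mul0r.
Qed.

(** Both [sc_p] and [sc_q] vanish at the nodes, where [sc_e] is a unit row. The normalisation point
    1 is on the circle, so no denominator is zero ([nd_neq1]). *)
Definition sc_p z : C := 1 - (1 - z) * \sum_i sc_e z 0 i / (1 - s`_i).
Definition sc_q z : C := f z - (1 - z) * \sum_i sc_e z 0 i * f s`_i / (1 - s`_i).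

Lemma nd_neq1 (i : 'I_m) : 1 - s`_i != 0.
Proof.
rewrite subr_eq0 eq_sym; apply: contraTneq (ndD i) => ->.
by rewrite nm1 ltxx.
Qed.

Lemma ker_den x y : nm x < 1 -> nm y < 1 -> 1 - f x * (f y)^* = ker f x y * (1 - x * y^*).
Proof. by move=> xD yD; rewrite /ker divfK // nm_lt1_neq0. Qed.

(* The scalar form of J - Theta(z) J Theta(w)^* for the elementary factor Theta
   normalised at 1. *)
Lemma sc_ker_factor z w : nm z < 1 -> nm w < 1 ->
  sc_ker z w = (sc_p z * (sc_p w)^* - sc_q z * (sc_q w)^*) / (1 - z * w^*).
Proof.
move=> zD wD; have zw := nm_lt1_neq0 zD wD.
apply: (mulIf zw); rewrite divfK //.
pose ez i := sc_e z 0 i; pose ew j := (sc_e w 0 j)^*.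
(* Every cross term of the product becomes a double sum against [P], through [sc_eP], [sc_ePc] and
   [ker_den]; the identity is then checked term by term. *)
have t1 : \sum_i ez i / (1 - s`_i) - (f w)^* * \sum_i ez i * f s`_i / (1 - s`_i) =
    \sum_i \sum_j ez i * ew j * P i j * ((1 - s`_i * w^*) / (1 - s`_i)).
  rewrite mulr_sumr -sumrB; apply: eq_bigr => i _.
  rewrite -mulr_suml; have -> : \sum_j ez i * ew j * P i j = ez i * ker f s`_i w.
    by rewrite -sc_ePc mulr_sumr; apply: eq_bigr => j _; rewrite /ew mulrA.
  transitivity (ez i * (1 - f s`_i * (f w)^*) / (1 - s`_i)); first by ring.
  by rewrite ker_den ?ndD //; ring.
have t2 : \sum_j ew j / (1 - (s`_j)^*) - f z * \sum_j ew j * (f s`_j)^* / (1 - (s`_j)^*) =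
    \sum_i \sum_j ez i * ew j * P i j * ((1 - z * (s`_j)^*) / (1 - (s`_j)^*)).
  rewrite exchange_big mulr_sumr -sumrB; apply: eq_bigr => j _ /=.
  rewrite -mulr_suml; have -> : \sum_i ez i * ew j * P i j = ew j * ker f z s`_j.
    by rewrite -sc_eP mulr_sumr; apply: eq_bigr => i _; rewrite /ez; ring.
  transitivity (ew j * (1 - f z * (f s`_j)^*) / (1 - (s`_j)^*)); first by ring.
  by rewrite ker_den ?ndD //; ring.
have t3 : (\sum_i ez i / (1 - s`_i)) * (\sum_j ew j / (1 - (s`_j)^*)) -
    (\sum_i ez i * f s`_i / (1 - s`_i)) * (\sum_j ew j * (f s`_j)^* / (1 - (s`_j)^*)) =
    \sum_i \sum_j ez i * ew j * P i j *
      ((1 - s`_i * (s`_j)^*) / ((1 - s`_i) * (1 - (s`_j)^*))).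
  rewrite !mulr_suml -sumrB; apply: eq_bigr => i _.
  rewrite !mulr_sumr -sumrB; apply: eq_bigr => j _.
  rewrite invfM.
  transitivity (ez i * ew j * (1 - f s`_i * (f s`_j)^*) * ((1 - s`_i)^-1 * (1 - (s`_j)^*)^-1)).
    by ring.
  by rewrite ker_den ?ndD // sc_PE; ring.
have pJ : (sc_p w)^* = 1 - (1 - w^*) * \sum_j ew j / (1 - (s`_j)^*).
  rewrite /sc_p rmorphB rmorphM rmorphB /= !rmorph1 rmorph_sum; congr (1 - _ * _).
  by apply: eq_bigr => j _; rewrite rmorphM fmorphV rmorphB /= rmorph1.
have qJ : (sc_q w)^* = (f w)^* - (1 - w^*) * \sum_j ew j * (f s`_j)^* / (1 - (s`_j)^*).
  rewrite /sc_q rmorphB rmorphM rmorphB /= !rmorph1 rmorph_sum; congr (_ - _ * _).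
  by apply: eq_bigr => j _; rewrite !rmorphM fmorphV rmorphB /= rmorph1.
rewrite pJ qJ /sc_p /sc_q -/(ez _).
set a1 := \sum_i ez i / _ in t1 t3 *; set a2 := \sum_i ez i * _ / _ in t1 t3 *.
set b1 := \sum_j ew j / _ in t2 t3 *; set b2 := \sum_j ew j * _ / _ in t2 t3 *.
transitivity ((1 - f z * (f w)^*) - (1 - z) * (a1 - (f w)^* * a2) - (1 - w^*) * (b1 - f z * b2)
   + (1 - z) * (1 - w^*) * (a1 * b1 - a2 * b2)); last by ring.
rewrite t1 t2 t3 ker_den // /sc_ker mulrBl -!addrA; congr (_ + _).
rewrite !mulr_sumr mulr_suml -!sumrN -!big_split /=; apply: eq_bigr => i _.
rewrite !mulr_sumr mulr_suml -!sumrN -!big_split /=; apply: eq_bigr => j _.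
rewrite -/(ez i) -/(ew j).
have n1 := nd_neq1 i; have n2 : 1 - (s`_j)^* != 0.
  by have := nd_neq1 j; rewrite -conjC_eq0 rmorphB rmorph1.
by field; rewrite n1 n2.
Qed.

(** If both vanish at [z], the row [x] is in the kernel of the invertible [P], hence 0. Away from
    the nodes this forces [sc_e z = 0], and then [sc_p z] would be 1. *)
Lemma sc_pq_zero z : nm z < 1 -> sc_p z = 0 -> sc_q z = 0 -> z \in s.
Proof.
move=> zD p0 q0.
pose x : 'rV[C]_m := \row_i (sc_e z 0 i * (z - s`_i) / (1 - s`_i)).
have xP : x *m P = 0.
  apply/rowP => j; rewrite !mxE.
  have n2 : 1 - (s`_j)^* != 0 by have := nd_neq1 j; rewrite -conjC_eq0 rmorphB rmorph1.
  apply: (mulIf n2); rewrite mul0r.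
  transitivity (sc_p z - sc_q z * (f s`_j)^*); last by rewrite p0 q0 mul0r subr0.
  rewrite /sc_p /sc_q.
  transitivity ((1 - f z * (f s`_j)^*) - (1 - z) * (\sum_i sc_e z 0 i / (1 - s`_i) -
     (\sum_i sc_e z 0 i * f s`_i / (1 - s`_i)) * (f s`_j)^*)); last by ring.
  rewrite ker_den ?ndD // -sc_eP !mulr_suml -sumrB mulr_sumr -sumrB; apply: eq_bigr => i _.
  have n1 := nd_neq1 i; rewrite mxE.
  transitivity (sc_e z 0 i * P i j * (1 - z * (s`_j)^*) -
    (1 - z) * (sc_e z 0 i * (1 - f s`_i * (f s`_j)^*) / (1 - s`_i))); last by field.
  by rewrite ker_den ?ndD // sc_PE; field.
have x0 : x = 0 by have := congr1 (mulmx^~ (invmx P)) xP; rewrite mulmxK // mul0mx.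
apply/negPn/negP => zs.
have e0 i : sc_e z 0 i = 0.
  have /rowP /(_ i) := x0; rewrite !mxE => /eqP.
  rewrite mulf_eq0 invr_eq0 (negbTE (nd_neq1 i)) orbF mulf_eq0 subr_eq0.
  by move=> /orP[/eqP //|/eqP e]; move: zs; rewrite e mem_nth.
move: p0; rewrite /sc_p big1 ?mulr0 ?subr0 => [/eqP|i _]; first by rewrite oner_eq0.
by rewrite e0 mul0r.
Qed.

Lemma bf_drop K (A : pred C) l : (forall z w, K w z = (K z w)^*) ->
  (forall z w, z \in pts l -> ~~ A z -> K z w = 0) ->
  bf K l l = bf K [seq p <- l | A p.2] [seq p <- l | A p.2].
Proof.
move=> hK h0.
have dl n : bf K l n = bf K [seq p <- l | A p.2] n.
  rewrite /bf [in RHS]big_filter [RHS]big_mkcond big_seq [RHS]big_seq /=.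
  apply: eq_bigr => p pl; case: ifP => // /negbT np.
  by rewrite big1 // => q _; rewrite h0 ?mulr0 //; apply: map_f.
by rewrite dl (bf_conj l _ hK) dl -(bf_conj _ _ hK).
Qed.

Lemma sc_psd X : codisc X ->
  (forall l, (size l <= 3)%N -> (forall z, z \in pts l -> X z) -> 0 <= bf sc_ker l l) ->
  forall l, (forall z, z \in pts l -> X z) -> 0 <= bf sc_ker l l.
Proof.
move=> cX h3; have [XD _] := cX.
pose X0 := [set z | X z /\ z \notin s].
have cX0 : codisc X0 := codisc_remove s cX.
(* Positivity at the single point [z]: if [sc_p z] were 0, only a nonpositive multiple of |sc_q z|^2
   would remain, so [sc_q z] would vanish too. *)
have pn0 z : X0 z -> sc_p z != 0.
  move=> [Xz zs]; have zD := XD z Xz; apply/negP => /eqP p0.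
  have := h3 [:: (1, z)] isT; rewrite /bf !big_seq1 /= rmorph1 !mul1r.
  rewrite sc_ker_factor // p0 mul0r sub0r mulJ_nm mulNr => H.
  have : 0 <= - ((((nm (sc_q z) ^+ 2)%:C)%C : C) / (1 - z * z^*)).
    by apply: H => w; rewrite inE => /eqP ->.
  rewrite mulJ_nm -[1]/((1%:C)%C) -rmorphB /= -fmorphV -rmorphM oppr_ge0 /=.
  have z20 : 0 < 1 - nm z ^+ 2 by rewrite subr_gt0 expr_lt1 // nm_ge0.
  rewrite -[0]/((0%:C)%C) lecR pmulr_lle0 ?invr_gt0 // => q2.
  have q0 : sc_q z = 0.
    apply/eqP; rewrite -nm_eq0 -sqrf_eq0.
    by rewrite eq_le q2 exprn_ge0 ?nm_ge0.
  by move: zs; rewrite (sc_pq_zero zD p0 q0).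
pose g z := sc_q z / sc_p z.
have kg z w : X0 z -> X0 w ->
    ker g z w = (sc_p z)^-1 * ((sc_p w)^-1)^* * sc_ker z w.
  move=> Xz Xw; have zD := XD _ Xz.1; have wD := XD _ Xw.1.
  have p1 := pn0 z Xz; have p2 : (sc_p w)^* != 0 by rewrite conjC_eq0 pn0.
  rewrite sc_ker_factor // /ker /g rmorphM !fmorphV /=.
  by field; rewrite p1 p2 nm_lt1_neq0.
have hg : psdn 3 X0 g.
  move=> l sl lX.
  have -> : bf (ker g) l l = bf sc_ker (tw (fun z => (sc_p z)^-1) l) (tw (fun z => (sc_p z)^-1) l).
    by rewrite bf_tw; apply: bf_ext => z w /lX Xz /lX Xw; apply: kg.
  by apply: h3; rewrite ?size_map // => z; rewrite mem_pts_tw => /lX[].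
have [S [sS SE]] := hindmarsh cX0 hg.
move=> l lX; rewrite (@bf_drop sc_ker [pred z | z \notin s]) => [||z w zl]; first last.
- rewrite /= negbK => zs; have iz : (index z s < m)%N by rewrite index_mem.
  by rewrite -(nth_index 0 zs) -[index z s]/(val (Ordinal iz)) sc_ker_node.
- exact: sc_kerC.
set l' := [seq p <- l | _].
have l'X z : z \in pts l' -> X0 z.
  by move=> /mapP[p]; rewrite mem_filter => /andP[/= pZ pl] ->; split=> //; apply/lX/map_f.
have -> : bf sc_ker l' l' = bf (ker S) (tw sc_p l') (tw sc_p l').
  rewrite bf_tw; apply: bf_ext => z w /l'X Xz /l'X Xw.
  have p1 := pn0 z Xz; have p2 : (sc_p w)^* != 0 by rewrite conjC_eq0 pn0.
  have -> : ker S z w = ker g z w by rewrite /ker !SE.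
  by rewrite kg // fmorphV; field; rewrite p1 p2.
by apply: schur_ker_ge0 => // z; rewrite mem_pts_tw => /l'X[/XD].
Qed.

End SchurComplement.

(** * Stabilisation of k_n *)

Section Stabilisation.
Variable R : realType.
Local Notation C := R[i].
Local Open Scope sesquilinear_scope.
Implicit Types (f : C -> C) (L X : set C) (s t : seq C).

Definition sq_seq f s : nat := sq_minus (pick_matrix f (fun i : 'I_(size s) => (s`_i)%R)).

Lemma sq_minus_le n (P : 'M[C]_n) : herm P -> (sq_minus P <= n)%N.
Proof.
by move=> /spectral_pack[B [d [_ _ _ ->]]]; rewrite (leq_trans (max_card _)) // card_ord.
Qed.

Lemma kn_ge L f n (z : 'I_n -> C) : nodes L z -> (sq_minus (pick_matrix f z) <= kn L f n)%N.
Proof.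
move=> nz; have lt : (sq_minus (pick_matrix f z) < n.+1)%N.
  by rewrite ltnS; apply: sq_minus_le (pick_herm f z).
apply: (@leq_bigmax_cond _ _ (fun k : 'I_n.+1 => k : nat) (Ordinal lt)).
by apply/asboolP; exists z.
Qed.

Lemma kn_le L f n m :
  (forall z : 'I_n -> C, nodes L z -> (sq_minus (pick_matrix f z) <= m)%N) ->
  (kn L f n <= m)%N.
Proof. by move=> h; apply/bigop.bigmax_leqP => k /asboolP[z [nz <-]]; apply: h. Qed.

Lemma nodes_seq L s : uniq s -> (forall z, z \in s -> dom L z) ->
  nodes L (fun i : 'I_(size s) => s`_i).
Proof.
move=> us sX; split; first by move=> i j /eqP; rewrite nth_uniq // => /eqP /val_inj.
by move=> i; have [/inDE] := sX _ (mem_nth 0 (ltn_ord i)).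
Qed.

Lemma sq_seq_le_kn L f s : uniq s -> (forall z, z \in s -> dom L z) ->
  (sq_seq f s <= kn L f (size s))%N.
Proof. by move=> us sX; apply/kn_ge/nodes_seq. Qed.

(** [kn] looks at exactly [n] distinct nodes, so smaller sets have to be padded; [sq_seq_sub] shows
    that padding loses nothing. *)
Lemma extend_seq X s k : codisc X -> uniq s -> (forall z, z \in s -> X z) ->
  exists t, [/\ uniq t, forall z, z \in t -> X z, {subset s <= t} & size t = (size s + k)%N].
Proof.
move=> cX us sX; elim: k => [|k [t [ut tX st et]]]; first by exists s; rewrite addn0; split.
have [_ hX] := cX; have [|r [r0 hr]] := hX 0; first by rewrite nm0.
have [|w [_ w1]] := near_avoid t r0 (z := 0); first by rewrite nm0.
rewrite inE negb_or => /andP[w0 wt]; exists (w :: t); rewrite /= wt et addnS; split=> //.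
  by move=> z; rewrite inE => /orP[/eqP ->|/tX //]; apply: hr.
by move=> z /st; rewrite inE => ->; rewrite orbT.
Qed.

Lemma negsys_sq f s : negsys f [set z | z \in s] (sq_seq f s).
Proof. by apply: negsys_of_sq => i /=; apply: mem_nth. Qed.

Lemma sq_seq_ge f s k : uniq s -> negsys f [set z | z \in s] k -> (k <= sq_seq f s)%N.
Proof. by move=> us [y [yX nd]]; apply: sq_of_negsys nd. Qed.

Lemma seq_of_nodes L f n (z : 'I_n -> C) : nodes L z ->
  exists s, [/\ uniq s, forall z, z \in s -> dom L z, size s = n &
    (sq_minus (pick_matrix f z) <= sq_seq f s)%N].
Proof.
move=> [iz zL]; exists [seq z i | i <- enum 'I_n]; split.
- by rewrite map_inj_uniq // enum_uniq.
- by move=> w /mapP[i _ ->]; have [/inDE] := zL i.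
- by rewrite size_map size_enum_ord.
apply: sq_seq_ge; first by rewrite map_inj_uniq // enum_uniq.
by apply: negsys_of_sq => i /=; apply: map_f; rewrite mem_enum.
Qed.

Lemma sq_seq_sub f s t : uniq t -> {subset s <= t} -> (sq_seq f s <= sq_seq f t)%N.
Proof.
move=> ut st; apply: sq_seq_ge => //; have [y [yX nd]] := negsys_sq f s.
by exists y; split=> // i z /yX /st.
Qed.

(* A vector c in the kernel of the Pick matrix lets one clear the i-th coordinate
   of every vector of a negative subspace. *)
Lemma drop_node f s : uniq s -> pick_matrix f (fun i : 'I_(size s) => s`_i) \notin unitmx ->
  exists2 z, z \in s & (sq_seq f s <= sq_seq f (rem z s))%N.
Proof.
move=> us; set P := pick_matrix _ _ => Pn.
have hP : herm P by apply: pick_herm.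
have [c [c0 cP]] : exists c : 'rV[C]_(size s), c != 0 /\ c *m P = 0.
  have : kermx P != 0 by rewrite kermx_eq0 row_free_unit.
  by move=> /rowV0Pn[c /sub_kermxP cP c0]; exists c.
have Pc : P *m c^t* = 0.
  have eP : P = P^t* by apply/matrixP => x y; rewrite [RHS]mxE [in RHS]mxE -hP.
  have : (c *m P)^t* = 0 by rewrite cP trmx0 map_mx0.
  by rewrite trmx_mul map_mxM -eP.
have [i ci] := row_neq0 c0.
exists s`_i; first exact: mem_nth.
have [Y nY] := sq_minus_attained hP.
pose Y' := Y - ((c 0 i)^-1 *: col i Y) *m c.
have Y'i k : Y' k i = 0.
  by rewrite !mxE big_ord1 !mxE mulrAC mulVf // mul1r subrr.
have Y'P : Y' *m P *m Y'^t* = Y *m P *m Y^t*.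
  have e1 : Y' *m P = Y *m P by rewrite mulmxBl -mulmxA cP mulmx0 subr0.
  rewrite e1 -!mulmxA; congr (_ *m _).
  by rewrite /Y' linearB /= map_mxB mulmxBr trmx_mul map_mxM mulmxA Pc mul0mx subr0.
apply: sq_seq_ge; first exact: rem_uniq.
exists (fun k => [seq (Y' k j, s`_(val j)) | j <- enum 'I_(size s) & j != i]); split.
  move=> k w /mapP[p /mapP[j]]; rewrite mem_filter => /andP[ji _] -> -> /=.
  rewrite mem_rem_uniq // inE mem_nth // andbT nth_uniq //.
suff -> : gram (ker f) (fun k => [seq (Y' k j, s`_(val j)) | j <- enum 'I_(size s) & j != i]) =
   Y' *m P *m Y'^t* by rewrite Y'P.
have PE j k : P j k = ker f s`_j s`_k by rewrite /P mxE.
clearbody P Y'; apply/matrixP => a b; rewrite mxE.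
have full k (F : C * C -> C) : (forall p, p.1 = 0 -> F p = 0) ->
   \sum_(p <- [seq (Y' k j, s`_(val j)) | j <- enum 'I_(size s) & j != i]) F p =
   \sum_j F (Y' k j, s`_(val j)).
  move=> F0; rewrite big_map big_filter big_enum_cond big_mkcond.
  apply: eq_bigr => j _; case: ifP => // /negbT; rewrite andTb negbK => /eqP ->.
  by rewrite F0 //= Y'i.
rewrite /bf (full a) => [|p p0]; last by rewrite big1 // => q _; rewrite p0 !mul0r.
rewrite [RHS]mxE.
transitivity (\sum_j \sum_k Y' a j * (Y' b k)^* * P j k).
  apply: eq_bigr => j _; rewrite (full b) => [|p ->]; last by rewrite rmorph0 mulr0 mul0r.
  by apply: eq_bigr => k _; rewrite PE.
rewrite exchange_big; apply: eq_bigr => k _ /=.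
by rewrite !mxE mulr_suml; apply: eq_bigr => j _; ring.
Qed.

Lemma stable_NS L f n (kappa : nat) : discrete_set L ->
  kn L f n = kappa -> kn L f (n + 3) = kappa -> NS f (dom L) kappa.
Proof.
move=> dL e1 e2; have cX : codisc (dom L) by apply: discrete_codisc.
(* The bound for exactly [n + 3] nodes covers shorter lists and lists with repetitions, by removing
   duplicates and padding. *)
have bnd t k : (size t <= n + 3)%N -> (forall z, z \in t -> dom L z) ->
    negsys f [set z | z \in t] k -> (k <= kappa)%N.
  move=> st tX [y [yt nd]].
  have utX z : z \in undup t -> dom L z by rewrite mem_undup => /tX.
  have [t' [ut' t'X sub et']] :=
    extend_seq (n + 3 - size (undup t)) cX (undup_uniq t) utX.
  rewrite -e2; have -> : (n + 3)%N = size t'.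
    by rewrite et' subnKC // (leq_trans (size_undup t)).
  apply: leq_trans (sq_seq_le_kn f ut' t'X); apply: sq_seq_ge => //.
  by exists y; split=> // i z /yt zt; apply: sub; rewrite mem_undup.
pose Att m := `[< exists s, [/\ uniq s, forall z, z \in s -> dom L z, size s = m &
   (kappa <= sq_seq f s)%N] >].
have [m0 m0n Am0] : exists2 m, (m <= n)%N & Att m.
  (* The argument through [kappa.-1] needs [kappa] positive; for 0 the empty list serves. *)
  case: (posnP kappa) => [k0|k0].
    by exists 0%N => //; apply/asboolP; exists [::]; rewrite k0; split.
  exists n => //; apply/asboolP.
  have [z [nz hz]] : exists z : 'I_n -> C, nodes L z /\ (kappa <= sq_minus (pick_matrix f z))%N.
    apply: contrapT => hn.
    have : (kn L f n <= kappa.-1)%N.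
      apply: kn_le => z nz; rewrite -ltnS prednK // ltnNge; apply/negP => le.
      by apply: hn; exists z.
    by rewrite e1 -ltnS prednK // ltnn.
  have [s [us sX es hs]] := seq_of_nodes f nz.
  by exists s; split=> //; apply: leq_trans hz hs.
have exA : exists m, Att m by exists m0.
case: (ex_minnP exA) => m /asboolP[s [us sX es ks]] minm.
have mn : (m <= n)%N by apply: leq_trans (minm _ Am0) m0n.
have sD z : z \in s -> nm z < 1 by move=> /sX[].
(* A singular Pick matrix would allow dropping a node, against the minimality of [m]. *)
have Pu : pick_matrix f (fun i : 'I_(size s) => s`_i) \in unitmx.
  apply: contrapT => /negP /(drop_node us)[z zs hz].
  have : Att (size (rem z s)).
    apply/asboolP; exists (rem z s); split=> //; first exact: rem_uniq.
      by move=> w /mem_rem /sX.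
    exact: leq_trans ks hz.
  move=> /minm; rewrite size_rem // es => h.
  have m_gt0 : (0 < m)%N by rewrite -es; case: (s) zs.
  by move: h; rewrite -ltnS prednK // ltnn.
have sqk : sq_seq f s = kappa.
  apply/eqP; rewrite eqn_leq ks andbT; apply: (bnd s) => //; last exact: negsys_sq.
  by rewrite es (leq_trans mn) // leq_addr.
(* A negative combination on at most three points, made orthogonal to the nodes by [sc_hat], would
   add a negative square on at most [m + 3 <= n + 3] points. *)
have psd3 l : (size l <= 3)%N -> (forall z, z \in pts l -> dom L z) -> 0 <= bf (sc_ker f s) l l.
  move=> sl lX.
  have real : bf (sc_ker f s) l l \is Num.real.
    by apply/CrealP; rewrite -(bf_conj _ _ (@sc_kerC _ f s)).
  rewrite real_leNgt ?real0 //; apply/negP => neg.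
  have [y [ys nd]] := negsys_sq f s.
  suff /bnd : negsys f [set z | z \in s ++ pts l] kappa.+1.
    rewrite ltnn => H; suff : false by [].
    apply: H; first by rewrite size_cat es size_map leq_add.
    by move=> z; rewrite mem_cat => /orP[/sX|/lX].
  rewrite -sqk.
  apply: (negsys_extend (y := y) _ (gram_herm f y) nd); first by move=> i z /ys; rewrite /= mem_cat => ->.
  move=> de de0; exists (sc_hat f s l); split.
  - move=> z; rewrite mem_pts_cat /= mem_cat => /orP[->|]; first by rewrite orbT.
    by move=> /mapP[p /mapP[i _ ->] -> /=]; rewrite mem_nth.
  - by rewrite bf_sc_hat.
  move=> i j.
  have -> : bf (ker f) (y i) (sc_hat f s l) = 0.
    rewrite (bf_conj (sc_hat f s l) _ (kerC f)).
    suff -> : bf (ker f) (sc_hat f s l) (y i) = 0 by rewrite rmorph0.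
    have -> : bf (ker f) (sc_hat f s l) (y i) =
       \sum_(p <- y i) p.1^* * bf (ker f) (sc_hat f s l) (kpt p.2).
      rewrite /bf exchange_big /=; apply: eq_bigr => p _; rewrite mulr_sumr.
      by apply: eq_bigr => q _; rewrite big_seq1 /= rmorph1; ring.
    rewrite big_seq big1 // => p py.
    have /ys /= ps : p.2 \in pts (y i) by apply: map_f.
    have iz : (index p.2 s < size s)%N by rewrite index_mem.
    by rewrite -(nth_index 0 ps) -[index p.2 s]/(val (Ordinal iz)) bf_sc_hat_node // mulr0.
  by rewrite !mul0r subr0 mxE subrr nm0 ltW.
have psd := sc_psd sD Pu cX psd3.
move=> k [y [yX nd]]; rewrite -sqk /sq_seq.
set P := pick_matrix _ _.
(* Since the complement is nonnegative, a negative system of [f] stays negative after projection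
   onto the nodes, so [k] is at most the number of negative squares of [P]. *)
pose Y : 'M[C]_(k, size s) := \matrix_(a, i) sc_d f s (y a) 0 i.
apply: (@sq_minus_ge _ _ _ P Y); first exact: pick_herm.
move=> c c0.
have := nd c c0; have := psd (comb y c); rewrite bf_comb => H.
have {}H : 0 <= hq (gram (sc_ker f s) y) c by apply: H => z /mem_pts_comb[i /yX].
have -> : hq (gram (ker f) y) c = hq (gram (sc_ker f s) y) c + hq (Y *m P *m Y^t*) c.
  rewrite /hq -big_split; apply: eq_bigr => a _ /=; rewrite -big_split; apply: eq_bigr => b _ /=.
  rewrite -mulrDr; congr (_ * _); rewrite !mxE (bf_sc_ker f s); congr (_ + _).
  rewrite exchange_big; apply: eq_bigr => v _ /=.
  rewrite [X in X * _]mxE [X in _ * X]mxE [X in X^*]mxE mulr_suml; apply: eq_bigr => u _.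
  by rewrite !mxE; ring.
by move=> neg; apply: le_lt_trans neg; rewrite lerDr.
Qed.

Lemma index_stable L f (kappa : nat) : discrete_set L ->
  (index_is f (dom L) kappa <-> exists n, kn L f n = kappa /\ kn L f (n + 3) = kappa).
Proof.
move=> dL; have cX : codisc (dom L) by apply: discrete_codisc.
split=> [hi|[n [e1 e2]]].
  have [hN _] := hi; have /(in_S_kappaE f kappa dL).2 [_ [ub [n [z [nz e]]]]] := hi.
  have knk m : (kn L f m <= kappa)%N by apply: kn_le => z' nz'; apply: ub.
  exists n; split; apply/eqP; rewrite eqn_leq knk /=.
    by rewrite -e kn_ge.
  have [s [us sX es hs]] := seq_of_nodes f nz.
  have [t [ut tX st et]] := extend_seq 3 cX us sX.
  rewrite -e (leq_trans hs) // (leq_trans (sq_seq_sub f ut st)) //.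
  by rewrite -es -et sq_seq_le_kn.
have hN := stable_NS dL e1 e2; split=> // k /NS_nodes hk.
by rewrite -e1; apply: kn_le => z nz; apply: hk.
Qed.

End Stabilisation.

Theorem theorem1p4 (R : realType) (L : set R[i]) (f : R[i] -> R[i])
    (kappa : nat) :
  discrete_set L ->
  (in_S_kappa L f kappa <->
     exists (g : R[i] -> R[i]) (Ws Zs : seq R[i]),
       [/\ (size Zs <= kappa)%N,
           standard_function g Ws Zs (kappa - size Zs)%N,
           (forall z, inD z -> ~ L z -> z \notin Ws /\ g z = f z) &
           (forall z, z \in Zs -> ~ L z)]) /\
  (in_S_kappa L f kappa <->
     exists n : nat, kn L f n = kappa /\ kn L f (n + 3) = kappa).
Proof.
move=> dL; rewrite in_S_kappaE //; split; last exact: index_stable.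
split=> [|[g [Ws [Zs [sZ st gf ZL]]]]]; first exact: index_standard.
by have := standard_index dL st gf ZL; rewrite subnK.
Qed.
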